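(* Let $d \ge 1$, let $D \subset \mathbb{R}^d$ be a domain containing $[-2,2]^d$, and let $\{X_\epsilon\}_{\epsilon \in (0,1]}$ be a collection of centred Gaussian fields on $D$ with covariance $$\mathbb{E}[X_\epsilon(x)X_\epsilon(y)] = -\log(|x-y|+\epsilon) + g_\epsilon(x,y), \qquad x,y \in D,$$ where each $g_\epsilon$ is continuous and $\sup_{x,y\in D}|g_\epsilon(x,y)| \le C_g$ for a constant $C_g>0$ independent of $\epsilon$. For $\beta \in \mathbb{R}$ let $Z_\epsilon(\beta) := \int_{[-1,1]^d} e^{\beta X_\epsilon(x)}\,dx$. Then for every $q>1$ the limit $$\tilde{\eta}_q := \lim_{\epsilon \to 0} \frac{\log \mathbb{E}\left[\frac{Z_\epsilon(q\beta)}{Z_\epsilon(\beta)^q}\right]}{\log \epsilon}$$ exists and is given by $$\tilde{\eta}_q = \begin{cases} -\frac{\beta^2q^2}{2} + \frac{\beta^2 q}{2}, & 0 \le \beta^2 < \frac{2d}{2q-1},\\[2pt] \frac{(2d-\beta^2)^2}{8\beta^2} - d(q-1), & \frac{2d}{2q-1} \le \beta^2 < 2d,\\[2pt] -d(q-1), & \beta^2 \ge 2d.\end{cases}$$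
   Context: $|\cdot|$ denotes the Euclidean norm on $\mathbb{R}^d$. The fields $X_\epsilon$ have continuous covariance and are defined pointwise. *)

(* Defs.v *)
From HB Require Import structures.
From mathcomp Require Import all_boot all_order all_algebra.
From mathcomp Require Import all_classical all_reals all_analysis.
Set Implicit Arguments. Unset Strict Implicit. Unset Printing Implicit Defensive.
Import Order.TTheory GRing.Theory Num.Theory.
Import numFieldNormedType.Exports.
Local Open Scope classical_set_scope.
Local Open Scope ring_scope.

Section defs.
Variable R : realType.

Definition eucl_dist (d : nat) (x y : d.-tuple R) : R :=
  Num.sqrt (\sum_(i < d) (tnth x i - tnth y i) ^+ 2).

Definition eucl_open (d : nat) (U : set (d.-tuple R)) : Prop :=
  forall x, U x -> exists2 r : R, 0 < r & forall y, eucl_dist x y < r -> U y.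

Definition eucl_connected (d : nat) (D : set (d.-tuple R)) : Prop :=
  forall U V : set (d.-tuple R), eucl_open U -> eucl_open V ->
    D `<=` U `|` V -> D `&` U `&` V = set0 ->
    D `&` U = set0 \/ D `&` V = set0.

Definition domain (d : nat) (D : set (d.-tuple R)) : Prop :=
  D !=set0 /\ eucl_open D /\ eucl_connected D.

Definition sym_cube (d : nat) (a : R) : set (d.-tuple R) :=
  [set x | forall i : 'I_d, - a <= tnth x i <= a].

Definition continuous_on2 (d : nat) (D : set (d.-tuple R))
    (g : d.-tuple R -> d.-tuple R -> R) : Prop :=
  forall x y, D x -> D y -> forall e : R, 0 < e ->
    exists2 delta : R, 0 < delta & forall x' y', D x' -> D y' ->
      eucl_dist x x' < delta -> eucl_dist y y' < delta ->
      `|g x' y' - g x y| < e.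

(* Lebesgue integral over [-1,1]^d of a nonnegative function, written as the
   iterated integral of one-dimensional Lebesgue integrals (Tonelli). *)
Fixpoint cube_int (d : nat) : (d.-tuple R -> \bar R) -> \bar R :=
  match d return (d.-tuple R -> \bar R) -> \bar R with
  | 0 => fun f => f [tuple]
  | n.+1 => fun f =>
      (\int[@lebesgue_measure R]_(t in `[(-1)%R, 1%R]%classic) cube_int (fun v => f [tuple of t :: v]))%E
  end.

Definition centred_gaussian_rv (d0 : measure_display) (Omega : measurableType d0)
    (P : probability Omega R) (Y : Omega -> R) (v : R) : Prop :=
  0 <= v /\ measurable_fun setT Y /\
  forall A : set R, measurable A ->
    P (Y @^-1` A) = if v == 0 then \d_(0 : R) A else normal_prob 0 (Num.sqrt v) A.

Definition centred_gaussian_field (d0 : measure_display) (Omega : measurableType d0)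
    (P : probability Omega R) (d : nat) (D : set (d.-tuple R))
    (X : Omega -> d.-tuple R -> R) : Prop :=
  forall (n : nat) (pts : 'I_n -> d.-tuple R) (a : 'I_n -> R),
    (forall i, D (pts i)) ->
    exists v : R, centred_gaussian_rv P (fun w => \sum_(i < n) a i * X w (pts i)) v.

Definition Zpart (d0 : measure_display) (Omega : measurableType d0) (d : nat)
    (X : Omega -> d.-tuple R -> R) (beta : R) (w : Omega) : R :=
  fine (cube_int (fun x : d.-tuple R => (expR (beta * X w x))%:E)).

Definition eta_tilde (d : nat) (q beta : R) : R :=
  if beta ^+ 2 < (2 * d%:R) / (2 * q - 1) then
    - (beta ^+ 2 * q ^+ 2) / 2 + (beta ^+ 2 * q) / 2
  else if beta ^+ 2 < 2 * d%:R then
    (2 * d%:R - beta ^+ 2) ^+ 2 / (8 * beta ^+ 2) - d%:R * (q - 1)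
  else - (d%:R * (q - 1)).

End defs.
Arguments sym_cube {R} d a _.

(* Main.v *)
(* Put T = ln (1/eps), so that Var X_eps(x) = T + O(1). Discretise the cube by a grid of
   mesh about eps with sites x_i; the ratio Z(q beta)/Z(beta)^q is then, up to the volume
   factor eps^(d(1-q)) and errors controlled by the exponential moments of the increments
   of the field within a cell, the Gibbs moment
     V = sum_i (exp(beta X(x_i)) / S)^q  <= 1,   S = sum_j exp(beta X(x_j)),
   and the exponent of E V has to be found.

   For beta^2 <= 2d let q0 = min(q, 1/2 + d/beta^2).
   Lower bound: a reversed Jensen inequality reduces E V to the tilted fractional moments
   E[exp(q0 beta X(x_i)) S^h] with small h. These are bounded by splitting S into the shells
   around x_i on which X is close to the average Y of X over a ball of the same size, and
   applying Jensen conditionally on Y.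
   Upper bound: V_q <= V_{q0}, and Hoelder's inequality separates exp(q0 beta X(x_i)) from
   S^(-q0). With M slabs at macroscopic distance, S is at least exp(f), f being the mean over
   the slabs of ln S_slab. Gaussian concentration of f, whose variance is O(T/M), converts a
   lower bound on the positive moments of S_slab (a second moment computation truncated at
   all scales) into an upper bound on E exp(-q0 f).
   For beta^2 >= 2d, V <= 1 is the upper bound, and monotonicity of l^p norms reduces the
   lower bound to beta^2 = 2d. *)
Require Import Defs.
From HB Require Import structures.
From mathcomp Require Import all_boot all_order all_algebra.
From mathcomp Require Import all_classical all_reals all_analysis.
From mathcomp Require Import ring lra zify measurable_realfun.
Import Order.TTheory GRing.Theory Num.Theory.
Import numFieldNormedType.Exports.
Local Open Scope classical_set_scope.
Local Open Scope ring_scope.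
Set Implicit Arguments.
Unset Strict Implicit.
Unset Printing Implicit Defensive.

(** * Gaussian integrals and uniqueness of laws *)

Import HBNNSimple.

(** The cut-off q0 is where S starts to feel the tilt by exp(q0 beta X(x_i)). Under the tilt the
    field at distance exp(-tau T) of x_i rises by q0 beta tau T, so the shell there contributes to S
    with exponent (d + beta^2/2)(1 - tau) + q0 beta^2 tau; this stays below its value at tau = 0
    exactly when q0 <= 1/2 + d/beta^2. Up to that power S keeps its typical size and both bounds
    have the same exponent. If q0 < q, the tilted site has a Gibbs weight exp(o(T)), so the
    remaining power q - q0 costs nothing. The covariance is known only up to O(1), so neither a
    branching structure nor independence between scales is at hand. All estimates use covariances of
    sites and averages up to an error dl T, and Gaussian moment generating functions. Only exponents
    matter, hence losses exp(o(T)), such as the number of shells, are free; but ln S of a single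
    slab fluctuates too much for a power of order one, which is why several slabs are averaged. *)

Lemma ge0_integral_density d (T : measurableType d) (R : realType)
    (mu nu : {measure set T -> \bar R}) (g : T -> R) :
  measurable_fun setT g -> (forall x, 0 <= g x) ->
  (forall A, measurable A -> nu A = \int[mu]_(x in A) (g x)%:E)%E ->
  forall f : T -> \bar R, measurable_fun [set: T] f -> (forall x, (0 <= f x)%E) ->
  (\int[nu]_x f x = \int[mu]_x (f x * (g x)%:E))%E.
Proof.
move=> mg g0 nuE f mf f0.
pose h := nnsfun_approx measurableT mf.
have mh n : measurable_fun setT (EFin \o h n) by apply/measurable_EFinP.
have mhg n : measurable_fun setT (fun x => (h n x)%:E * (g x)%:E)%E.
  by apply: emeasurable_funM => //; exact/measurable_EFinP.
have hcvg x : (h n x)%:E @[n --> \oo] --> f x by apply: cvg_nnsfun_approx.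
have hnd x : {homo (fun n => (h n x)%:E) : a b / (a <= b)%N >-> (a <= b)%E}.
  by move=> a b ab; rewrite lee_fin; exact/lefP/nd_nnsfun_approx.
have L : (\int[nu]_x (h n x)%:E @[n --> \oo] --> \int[nu]_x f x)%E.
  rewrite (_ : f = fun x => limn (fun n => (h n x)%:E)); last first.
    by apply/funext => x; apply/esym/cvg_lim => //.
  by apply: cvg_monotone_convergence => // n x _; rewrite lee_fin.
have Rr : (\int[mu]_x ((h n x)%:E * (g x)%:E) @[n --> \oo] --> \int[mu]_x (f x * (g x)%:E))%E.
  rewrite (_ : (fun x => f x * (g x)%:E)%E = fun x => limn (fun n => (h n x)%:E * (g x)%:E)%E); last first.
    by apply/funext => x; apply/esym/cvg_lim => //; apply: cvgeZr => //.
  apply: cvg_monotone_convergence => //.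
    by move=> n x _; rewrite mule_ge0 ?lee_fin.
  by move=> x _ a b ab; rewrite lee_wpmul2r ?lee_fin//; have := hnd x _ _ ab; rewrite lee_fin.
suff E : (fun n => \int[nu]_x (h n x)%:E)%E = (fun n => \int[mu]_x ((h n x)%:E * (g x)%:E))%E.
  by move: L; rewrite E => /cvg_lim <- //; move/cvg_lim : Rr => ->.
apply/funext => n.
have hE x : ((h n x)%:E = \sum_(y \in range (h n)) (y * \1_(h n @^-1` [set y]) x)%:E)%E.
  by rewrite fimfunE -fsumEFin.
under eq_integral do rewrite hE.
rewrite ge0_integral_fsum//; last 2 first.
  by move=> r; apply/measurable_EFinP; apply: measurable_funM => //.
  by move=> m y Ey; exact: nnfun_muleindic_ge0.
transitivity (\int[mu]_x \sum_(y \in range (h n)) ((y * \1_(h n @^-1` [set y]) x)%:E * (g x)%:E))%E; last first.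
  apply: eq_integral => x _; rewrite hE ge0_mule_fsuml// => r.
  exact: nnfun_muleindic_ge0.
rewrite ge0_integral_fsum//; last 2 first.
  move=> r; apply: emeasurable_funM; apply/measurable_EFinP => //.
  by apply: measurable_funM => //.
  by move=> m y Ey; apply: mule_ge0; [exact: nnfun_muleindic_ge0|rewrite lee_fin].
apply: eq_fsbigr => r /set_mem [t _ hr].
have r0 : 0 <= r by rewrite -hr.
rewrite (eq_integral (fun x => r%:E * (\1_(h n @^-1` [set r]) x)%:E)%E)//.
rewrite ge0_integralZl ?lee_fin//; last exact/measurable_EFinP.
rewrite integral_indic// setIT nuE//.
under [RHS]eq_integral do rewrite EFinM -muleA.
rewrite ge0_integralZl ?lee_fin//; last 2 first.
  by apply: emeasurable_funM; apply/measurable_EFinP => //.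
  by move=> x _; rewrite mule_ge0 ?lee_fin.
congr (_ * _)%E; rewrite integral_mkcond; apply: eq_integral => x _.
rewrite patchE indicE; case: ifPn => xr; first by rewrite mul1e.
by rewrite mul0e.
Qed.

Section normal.
Variable R : realType.
Notation mu := (@lebesgue_measure R).

Lemma ge0_integral_normal (m s : R) (f : R -> R) :
  measurable_fun setT f -> (forall x, 0 <= f x) ->
  (\int[normal_prob m s]_x (f x)%:E = \int[mu]_x (f x * normal_pdf m s x)%:E)%E.
Proof.
move=> mf f0; rewrite (@ge0_integral_density _ _ _ mu (normal_prob m s) (normal_pdf m s)) => //.
- exact: measurable_normal_pdf.
- exact: normal_pdf_ge0.
- exact/measurable_EFinP.
Qed.

Lemma normal_mgf (s t : R) : s != 0 ->
  (\int[normal_prob 0 s]_x (expR (t * x))%:E = (expR (t ^+ 2 * s ^+ 2 / 2))%:E)%E.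
Proof.
move=> s0; rewrite ge0_integral_normal//; last first.
  apply: measurableT_comp => //; exact: measurable_funM.
(* Completing the square: the exponential tilt moves the mean from 0 to t s^2. *)
have E x : expR (t * x) * normal_pdf 0 s x =
    expR (t ^+ 2 * s ^+ 2 / 2) * normal_pdf (t * s ^+ 2) s x.
  rewrite !normal_pdfE// /normal_fun mulrCA [RHS]mulrCA -!expRD; congr (_ * expR _).
  by field.
under eq_integral do rewrite E EFinM.
rewrite ge0_integralZl ?lee_fin ?expR_ge0//; last 2 first.
  by apply/measurable_EFinP; exact: measurable_normal_pdf.
  by move=> x _; rewrite lee_fin normal_pdf_ge0.
by rewrite integral_normal_pdf mule1.
Qed.

(** The fundamental theorem of calculus on growing intervals, and dominated convergence: the form in
    which integration by parts is used below on the whole line. *)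
Lemma Rintegral_derivative_eq0 (F f : R -> R) :
  (forall x, is_derive x (1 : R) F (f x)) -> continuous f ->
  mu.-integrable setT (EFin \o f) ->
  F n%:R @[n --> \oo] --> 0 -> F (- n%:R) @[n --> \oo] --> 0 ->
  (\int[mu]_x f x = 0)%R.
Proof.
move=> dF cf intf F1 F2.
have cF : continuous F.
  by move=> x; apply: differentiable_continuous; apply/derivable1_diffP; apply: ex_derive.
pose g n (x : R) := ((f \_ `[- n.+1%:R, n.+1%:R]) x)%:E.
have mf : measurable_fun setT f by exact: continuous_measurable_fun.
have [|||||_ _] := @dominated_convergence _ _ _ mu setT measurableT g (EFin \o f) (abse \o EFin \o f).
- by move=> n; apply/measurable_EFinP/(measurable_restrictT _ _).1 => //; exact: measurable_funTS.
- by apply/measurable_EFinP.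
- apply: aeW => x _; apply: cvg_near_cst.
  exists (Num.truncn `|x|) => // n /= xn.
  rewrite /g patchE mem_set//= in_itv/=.
  have : `|x| < n.+1%:R.
    by rewrite (lt_le_trans (truncnS_gt _))// ler_nat ltnS.
  by rewrite ltr_norml => /andP[/ltW -> /ltW ->].
- exact: integrable_abse.
- apply: aeW => x n _; rewrite /g patchE; case: ifP => //= _.
  by rewrite normr0 lee_fin.
rewrite [X in X @ _ --> _ -> _](_ : _ = fun n : nat => (F n.+1%:R - F (- n.+1%:R))%:E); last first.
  apply/funext => n /=.
  transitivity (\int[mu]_(x in `[(- n.+1%:R)%R, n.+1%:R]) (f x)%:E)%E.
    rewrite [RHS]integral_mkcond; apply: eq_integral => x _.
    by rewrite /g !patchE; case: ifP.
  rewrite (@continuous_FTC2 _ f F) ?EFinB//.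
  - by rewrite (@lt_trans _ _ 0) ?oppr_lt0.
  - exact: continuous_subspaceT.
  - split.
    + by move=> x _; exact: ex_derive.
    + by apply: cvg_at_right_filter; exact: cF.
    + by apply: cvg_at_left_filter; exact: cF.
  - by move=> x _; rewrite derive1E; apply: derive_val.
move=> L.
have L0 : (F n.+1%:R - F (- n.+1%:R))%:E @[n --> \oo] --> (0 : R)%:E.
  apply: cvg_EFin; first by near=> n.
  rewrite -[X in _ --> X](subr0 0).
  apply: (@cvgB _ R^o _ _ _ (fun n => F n.+1%:R) (fun n => F (- n.+1%:R))).
    by rewrite (cvg_shiftS (fun n => F n%:R)).
  by rewrite (cvg_shiftS (fun n => F (- n%:R))).
rewrite /Rintegral; rewrite (cvg_unique _ L L0)//.
Unshelve. all: by end_near. Qed.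

End normal.

(** * Characteristic function of the normal law *)

Section normal_trig.
Variables (R : realType) (s : R).
Hypothesis s0 : s != 0.
Notation mu := (@lebesgue_measure R).
Notation p := (normal_pdf 0 s).

Let pE x : p x = normal_peak s * expR (- (s ^+ 2 *+ 2)^-1 * x ^+ 2).
Proof. by rewrite normal_pdfE// /normal_fun subr0; congr (_ * expR _); rewrite !mulNr mulrC. Qed.

Let is_derive_p x : is_derive x (1 : R) p (- (x / s ^+ 2) * p x).
Proof.
rewrite (_ : normal_pdf 0 s = fun x => normal_peak s * expR (- (s ^+ 2 *+ 2)^-1 * x ^+ 2)); last first.
  by apply/funext => ?; rewrite pE.
apply: is_derive_eq; rewrite /GRing.scale/=.
by field.
Qed.

Let cos_norm_le1 (x : R) : `|cos x| <= 1. Proof. by rewrite ler_norml cos_geN1 cos_le1. Qed.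

Let measurable_p : measurable_fun setT p := measurable_normal_pdf 0 s.

Let integrable_expR_p (t : R) : mu.-integrable setT (fun x => (expR (t * x) * p x)%:E).
Proof.
apply/integrableP; split.
  apply/measurable_EFinP; apply: measurable_funM => //.
  by apply: measurableT_comp => //; exact: measurable_funM.
under eq_integral do rewrite /= ger0_norm ?mulr_ge0 ?expR_ge0 ?normal_pdf_ge0//.
rewrite -ge0_integral_normal//; last first.
  by apply: measurableT_comp => //; exact: measurable_funM.
by rewrite normal_mgf// ltry.
Qed.

Let ler_norm_expR (x : R) : `|x| <= expR (1 * x) + expR (-1 * x).
Proof.
rewrite mul1r mulN1r; have := expR_ge1Dx x; have := expR_ge1Dx (- x).
by have := expR_gt0 x; have := expR_gt0 (- x); case: (leP 0 x) => x0; [rewrite ger0_norm//|rewrite ltr0_norm//]; lra.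
Qed.

Let integrable_abs_p : mu.-integrable setT (fun x => (`|x| * p x)%:E).
Proof.
have H : mu.-integrable setT (fun x => (expR (1 * x) * p x)%:E + (expR (-1 * x) * p x)%:E)%E.
  exact: integrableD.
apply: (le_integrable measurableT _ _ H) => //.
- apply/measurable_EFinP; apply: measurable_funM => //.
- move=> x _; rewrite lee_fin ger0_norm ?mulr_ge0 ?normal_pdf_ge0//.
  rewrite -mulrDl ger0_norm ?mulr_ge0 ?addr_ge0 ?expR_ge0 ?normal_pdf_ge0//.
  by rewrite ler_wpM2r ?normal_pdf_ge0// ler_norm_expR.
Qed.

Let integrable_bounded_p (f : R -> R) : measurable_fun setT f -> (forall x, `|f x| <= 1) ->
  mu.-integrable setT (fun x => (f x * p x)%:E).
Proof.
move=> mf f1; apply: (le_integrable measurableT _ _ (integrable_normal_pdf 0 s)) => //.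
- by apply/measurable_EFinP; apply: measurable_funM.
- move=> x _; rewrite lee_fin normrM; apply: ler_piMl => //.
Qed.

Let measurable_cos_lin (b th : R) : measurable_fun setT (fun x : R => cos (b * x + th)).
Proof.
apply: continuous_measurable_fun => x.
apply: (@continuous_comp _ _ _ (fun x : R => b * x + th) cos); last exact: continuous_cos.
by apply: (@cvgD _ R^o); [apply: (@cvgM _ R^o)|]; [exact: cvg_cst|exact: cvg_id|exact: cvg_cst].
Qed.

Let measurable_sin_lin (b th : R) : measurable_fun setT (fun x : R => sin (b * x + th)).
Proof.
apply: continuous_measurable_fun => x.
apply: (@continuous_comp _ _ _ (fun x : R => b * x + th) sin); last exact: continuous_sin.
by apply: (@cvgD _ R^o); [apply: (@cvgM _ R^o)|]; [exact: cvg_cst|exact: cvg_id|exact: cvg_cst].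
Qed.

Let cvg_p0 : p n%:R @[n --> \oo] --> (0 : R).
Proof.
pose k := (s ^+ 2 *+ 2)^-1 : R.
have k0 : 0 < k by rewrite invr_gt0 pmulrn_lgt0// exprn_even_gt0.
apply: (@squeeze_cvgr _ _ _ _ (fun=> 0) (fun n : nat => normal_peak s * expR (- (k * n%:R)))).
- near=> n; rewrite normal_pdf_ge0/= pE.
  rewrite ler_wpM2l ?normal_peak_ge0// ler_expR mulNr lerN2 ler_wpM2l//; first exact: ltW.
  by rewrite -natrX ler_nat; have [->|] := posnP n; rewrite // => ?; rewrite leq_pmull.
- exact: cvg_cst.
- rewrite -[X in _ --> X](mulr0 (normal_peak s)).
  apply: cvgM; first exact: cvg_cst.
  apply: (cvg_comp (fun n : nat => n%:R : R) (fun x => expR (- (k * x)))); first exact: cvgr_idn.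
  apply: (cvg_comp (fun x => k * x) (fun x => expR (- x))); last exact: cvgr_expR.
  by apply: gt0_cvgMry => //; exact: cvg_id.
Unshelve. all: by end_near. Qed.

Let p_even x : p (- x) = p x.
Proof. by rewrite !pE sqrrN. Qed.

Let phi th b := (\int[mu]_x (cos (b * x + th) * p x))%R.

(** The derivative of sin(b x + th) p(x) integrates to 0, and p' = -(x/s^2) p. *)
Let phi_ibp th b :
  (\int[mu]_x (x * sin (b * x + th) * p x) = s ^+ 2 * b * phi th b)%R.
Proof.
have ic := integrable_bounded_p (measurable_cos_lin b th) (fun x => cos_norm_le1 (b * x + th)).
have ixs : mu.-integrable setT (fun x => (x * sin (b * x + th) * p x)%:E).
  apply: (le_integrable measurableT _ _ integrable_abs_p) => //.
    apply/measurable_EFinP; apply: measurable_funM => //.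
    exact: (measurable_funM (@measurable_id _ _ setT) (measurable_sin_lin b th)).
  move=> x _; rewrite lee_fin !normrM normr_id ler_wpM2r//.
  by apply: ler_piMr => //; rewrite ler_norml sin_geN1 sin_le1.
have cp : continuous p by apply: continuous_normal_pdf.
have clin : continuous (fun x : R => b * x + th).
  move=> x; apply: (@cvgD _ R^o); last exact: cvg_cst.
  by apply: (@cvgM _ R^o); [exact: cvg_cst|exact: cvg_id].
have csin : continuous (fun x : R => sin (b * x + th)).
  by move=> x; apply: continuous_comp; [exact: clin|exact: continuous_sin].
have ccos : continuous (fun x : R => cos (b * x + th)).
  by move=> x; apply: continuous_comp; [exact: clin|exact: continuous_cos].
have sinp_le (x : R) : `|sin (b * x + th) * p x| <= p x.
  rewrite normrM (ger0_norm (normal_pdf_ge0 _ _ _)); apply: ler_piMl; rewrite ?normal_pdf_ge0//.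
  by rewrite ler_norml sin_geN1 sin_le1.
have ii : mu.-integrable setT (fun x => (b * (cos (b * x + th) * p x))%:E -
     ((s ^+ 2)^-1 * (x * sin (b * x + th) * p x))%:E)%E.
  apply: integrableB => //.
    by under eq_fun do rewrite EFinM; exact: integrableZl.
  by under eq_fun do rewrite EFinM; exact: integrableZl.
have : (\int[mu]_x (b * (cos (b * x + th) * p x) - (s ^+ 2)^-1 * (x * sin (b * x + th) * p x)) = 0)%R.
  apply: (@Rintegral_derivative_eq0 R (fun x => sin (b * x + th) * p x)).
- move=> x; have dp := is_derive_p x; apply: is_derive_eq; rewrite /GRing.scale/=.
  by field.
- move=> x; apply: (@cvgB _ R^o).
    apply: (@cvgM _ R^o); first exact: cvg_cst.
    by apply: (@cvgM _ R^o); [exact: ccos|exact: cp].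
  apply: (@cvgM _ R^o); first exact: cvg_cst.
  apply: (@cvgM _ R^o); last exact: cp.
  by apply: (@cvgM _ R^o); [exact: cvg_id|exact: csin].
- exact: ii.
- apply: norm_cvg0; apply: (squeeze_cvgr _ (cvg_cst 0) cvg_p0).
  by near=> n; rewrite normr_ge0 sinp_le.
- apply: norm_cvg0; apply: (squeeze_cvgr _ (cvg_cst 0) cvg_p0).
  by near=> n; rewrite normr_ge0 -[leRHS]p_even sinp_le.
rewrite RintegralB//; last 2 first.
- by rewrite /comp; under eq_fun do rewrite EFinM; exact: integrableZl.
- by rewrite /comp; under eq_fun do rewrite EFinM; exact: integrableZl.
rewrite !RintegralZl// => /eqP; rewrite subr_eq0 => /eqP E.
by rewrite -mulrA [b * _]E mulrA divff ?mul1r// expf_neq0.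
Unshelve. all: by end_near. Qed.

Let d1cos th b x : ('D_1 (fun b : R => cos (b * x + th) * p x) b) = - (x * sin (b * x + th) * p x).
Proof.
by apply: derive_val; apply: is_derive_eq; rewrite /GRing.scale/=; ring.
Qed.

Let is_derive_phi th b : is_derive b (1 : R) (phi th) (- (s ^+ 2 * b * phi th b)).
Proof.
have bI : `]b - 1, b + 1[%classic b by rewrite /= in_itv/=; lra.
have ic (c : R) : mu.-integrable setT (EFin \o (fun x => cos (c * x + th) * p x)).
  by apply: integrable_bounded_p => // x; rewrite ler_norml cos_geN1 cos_le1.
have ub (c x : R) : `|partial1of2 (fun b x => cos (b * x + th) * p x) c x| <= `|x| * p x.
  rewrite partial1of2E d1cos normrN normrM (ger0_norm (normal_pdf_ge0 _ _ _)).
  rewrite ler_wpM2r ?normal_pdf_ge0// normrM; apply: ler_piMr => //.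
  by rewrite ler_norml sin_geN1 sin_le1.
have g0 (x : R) : 0 <= `|x| * p x by rewrite mulr_ge0 ?normal_pdf_ge0.
split.
  apply: (@derivable_under_integral R _ _ mu (fun b x => cos (b * x + th) * p x) setT measurableT b _ _ bI _ _ _ g0 integrable_abs_p) => //.
rewrite -derive1E (@differentiation_under_integral R _ _ mu (fun b x => cos (b * x + th) * p x) setT measurableT b _ _ bI _ _ _ g0 integrable_abs_p) => //.
rewrite /partial1of2 -phi_ibp -mulN1r -RintegralZl//; last first.
  apply: (le_integrable measurableT _ _ integrable_abs_p) => //.
    apply/measurable_EFinP; apply: measurable_funM => //.
    exact: (measurable_funM (@measurable_id _ _ setT) (measurable_sin_lin b th)).
  move=> x _; rewrite lee_fin !normrM normr_id ler_wpM2r//.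
  by apply: ler_piMr => //; rewrite ler_norml sin_geN1 sin_le1.
by apply: eq_Rintegral => x _; rewrite derive1E d1cos mulN1r.
Qed.

(** By the linear differential equation [is_derive_phi], the product of phi with exp(s^2 b^2 / 2) is
    constant. *)
Let phiE th b : phi th b = cos th * expR (- (s ^+ 2 * b ^+ 2 / 2)).
Proof.
pose g b := phi th b * expR (s ^+ 2 * b ^+ 2 / 2).
have dg c : is_derive c (1 : R) g 0.
  have dphi := is_derive_phi th c; rewrite /g.
  by apply: is_derive_eq; rewrite /GRing.scale/=; field.
have : g b = g 0 by apply: is_derive_0_is_cst.
rewrite {2}/g expr0n/= mulr0 mul0r expR0 mulr1 => gE.
rewrite expRN -[LHS](mulfK (lt0r_neq0 (expR_gt0 (s ^+ 2 * b ^+ 2 / 2)))) -/(g b) gE; congr (_ / _).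
rewrite /phi; under eq_Rintegral do rewrite mul0r add0r.
rewrite RintegralZl//; last exact: integrable_normal_pdf.
by rewrite /Rintegral integral_normal_pdf mulr1.
Qed.

Lemma normal_cos (b th : R) :
  (\int[normal_prob 0 s]_x (1 + cos (b * x + th))%:E =
   (1 + cos th * expR (- (s ^+ 2 * b ^+ 2 / 2)))%:E)%E.
Proof.
have c0 (x : R) : 0 <= 1 + cos (b * x + th) by have := cos_geN1 (b * x + th); lra.
rewrite ge0_integral_normal//; last first.
  by apply: measurable_funD => //; exact: measurable_cos_lin.
have ic := integrable_bounded_p (measurable_cos_lin b th) (fun x => cos_norm_le1 (b * x + th)).
under eq_integral do rewrite mulrDl mul1r EFinD.
rewrite integralD//; last exact: integrable_normal_pdf.
rewrite integral_normal_pdf -phiE EFinD; congr (_ + _)%E.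
by rewrite /phi /Rintegral fineK//; exact: integrable_fin_num.
Qed.

End normal_trig.

Section density_measure.
Context d (T : measurableType d) (R : realType).
Variables (mu : {measure set T -> \bar R}) (f : T -> R).
Hypotheses (mf : measurable_fun setT f) (f0 : forall x, 0 <= f x).

(** The proofs about f are arguments so that the measure structure can be attached to the term
    [mdensity mf f0]. *)
Definition mdensity of measurable_fun setT f & (forall x, 0 <= f x) :=
  fun A : set T => (\int[mu]_(x in A) (f x)%:E)%E.

Let m := mdensity mf f0.

Let m0 : m set0 = 0%E. Proof. by rewrite /m /mdensity integral_set0. Qed.

Let m_ge0 A : (0 <= m A)%E.
Proof. by apply: integral_ge0 => x _; rewrite lee_fin. Qed.

Let m_sigma_additive : semi_sigma_additive m.
Proof.
move=> /= A mA tA mUA; rewrite /m /mdensity ge0_integral_bigcup//=; last 2 first.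
- by apply/measurable_EFinP; exact: measurable_funTS.
- by move=> x _; rewrite lee_fin.
by apply: is_cvg_ereal_nneg_natsum_cond => n _ _; apply: integral_ge0 => x _; rewrite lee_fin.
Qed.

HB.instance Definition _ := isMeasure.Build _ _ _ (mdensity mf f0) m0 m_ge0 m_sigma_additive.

Lemma ge0_integral_mdensity (h : T -> \bar R) : measurable_fun setT h -> (forall x, (0 <= h x)%E) ->
  (\int[mdensity mf f0]_x h x = \int[mu]_x (h x * (f x)%:E))%E.
Proof. by move=> mh h0; apply: ge0_integral_density. Qed.

End density_measure.

Section normal_tail.
Variable R : realType.
Notation mu := (@lebesgue_measure R).

Lemma normal_mgf_center (m s t : R) : s != 0 ->
  (\int[normal_prob m s]_x (expR (t * (x - m)))%:E = (expR (t ^+ 2 * s ^+ 2 / 2))%:E)%E.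
Proof.
move=> s0; rewrite ge0_integral_normal//; last first.
  by apply: measurableT_comp => //; apply: measurable_funM => //; exact: measurable_funB.
have E x : expR (t * (x - m)) * normal_pdf m s x =
    expR (t ^+ 2 * s ^+ 2 / 2) * normal_pdf (m + t * s ^+ 2) s x.
  rewrite !normal_pdfE// /normal_fun mulrCA [RHS]mulrCA -!expRD; congr (_ * expR _).
  by field.
under eq_integral do rewrite E EFinM.
rewrite ge0_integralZl ?lee_fin ?expR_ge0//; last 2 first.
  by apply/measurable_EFinP; exact: measurable_normal_pdf.
  by move=> x _; rewrite lee_fin normal_pdf_ge0.
by rewrite integral_normal_pdf mule1.
Qed.

(** Markov's inequality for exp(k (x - m) / s), whose integral is exp(1/2). The sign k treats both
    tails at once; decay in eta/s is enough for s -> 0. *)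
Lemma normal_tail (m s eta k : R) (A : set R) : 0 < s -> measurable A ->
  `|k| = 1 -> (forall z, A z -> eta <= k * (z - m)) ->
  (normal_prob m s A <= (expR (2^-1 - eta / s))%:E)%E.
Proof.
move=> s0 mA k1 Aeta; have sn0 : s != 0 by rewrite gt_eqF.
rewrite -[X in normal_prob m s X]setIT -integral_indic//.
apply: (@le_trans _ _ (\int[normal_prob m s]_x (expR (- (eta / s)) * expR (k / s * (x - m)))%:E)%E).
  apply: ge0_le_integral => //.
  - by apply/measurable_EFinP.
  - apply/measurable_EFinP; apply: measurable_funM => //.
    by apply: measurableT_comp => //; apply: measurable_funM => //; exact: measurable_funB.
  move=> z _; rewrite lee_fin indicE -expRD; case: (boolP (z \in A)) => zA; last exact: expR_ge0.
  rewrite (_ : _ + _ = (k * (z - m) - eta) / s); last by field.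
  rewrite -[leLHS]expR0 ler_expR; apply: divr_ge0; last exact: ltW.
  by rewrite subr_ge0 Aeta//; exact/set_mem.
under eq_integral do rewrite EFinM.
rewrite ge0_integralZl ?lee_fin ?expR_ge0//; last first.
  apply/measurable_EFinP; apply: measurableT_comp => //.
  by apply: measurable_funM => //; exact: measurable_funB.
rewrite normal_mgf_center// -EFinM lee_fin -expRD ler_expR.
rewrite expr_div_n -(real_normK (num_real k)) k1 expr1n mul1r mulVf ?expf_neq0//.
by rewrite mul1r addrC.
Qed.

End normal_tail.

(** * A finite measure on the line is determined by its trigonometric integrals *)

Section cos_unique.
Variable R : realType.
Variables mu nu : {finite_measure set R -> \bar R}.
Hypothesis munu : forall b t : R,
  (\int[mu]_x (1 + cos (b * x + t))%:E = \int[nu]_x (1 + cos (b * x + t))%:E)%E.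

Let cos_ge0 (x : R) : 0 <= 1 + cos x.
Proof. by have := cos_geN1 x; lra. Qed.

Let muT : mu setT = nu setT.
Proof.
have := munu 0 (pi / 2).
under eq_integral do rewrite mul0r add0r cos_pihalf addr0.
under [RHS]eq_integral do rewrite mul0r add0r cos_pihalf addr0.
by rewrite !integral_cst// !mul1e.
Qed.

(** Averaging cos(u (x - z)) over a normal frequency u produces a Gaussian bump in x - z, which
    carries the hypothesis on trigonometric integrals over to bumps. *)
Let cos_double (m : {finite_measure set R -> \bar R}) (s z : R) : s != 0 ->
  (m setT + \int[m]_x (expR (- (s ^+ 2 * (x - z) ^+ 2 / 2)))%:E =
  \int[normal_prob 0 s]_u \int[m]_x (1 + cos (u * x - u * z))%:E)%E.
Proof.
move=> s0.
rewrite (@fubini_tonelli _ _ _ _ _ (normal_prob 0 s) m (fun p => (1 + cos (p.1 * p.2 - p.1 * z))%:E)) /=; last 2 first.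
- apply/measurable_EFinP; apply: measurable_funD => //; apply: measurableT_comp.
    by apply: continuous_measurable_fun; exact: continuous_cos.
  by apply: measurable_funB; apply: measurable_funM.
- by move=> x; rewrite lee_fin.
have E x : (\int[normal_prob 0 s]_u (1 + cos (u * x - u * z))%:E =
    1 + (expR (- (s ^+ 2 * (x - z) ^+ 2 / 2)))%:E)%E.
  under eq_integral do rewrite -mulrBr mulrC -[X in cos X]addr0.
  by rewrite normal_cos// cos0 mul1r EFinD.
under [RHS]eq_integral do rewrite E.
rewrite ge0_integralD//; last first.
  apply/measurable_EFinP; apply: measurableT_comp => //.
  apply: measurableT_comp => //; apply: measurable_funM => //; apply: measurable_funM => //.
  by apply: measurable_funX; exact: measurable_funB.
by rewrite integral_cst// mul1e.
Qed.

Let bump (s z : R) : s != 0 ->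
  (\int[mu]_x (expR (- (s ^+ 2 * (x - z) ^+ 2 / 2)))%:E =
   \int[nu]_x (expR (- (s ^+ 2 * (x - z) ^+ 2 / 2)))%:E)%E.
Proof.
move=> s0; have := cos_double mu z s0; have := cos_double nu z s0.
rewrite (_ : (\int[normal_prob 0 s]_u _)%E = (\int[normal_prob 0 s]_u \int[mu]_x (1 + cos (u * x - u * z))%:E)%E); last first.
  by apply: eq_integral => u _; rewrite munu.
move=> <-; rewrite muT => /(congr1 (fun y => y - nu setT)%E).
by rewrite ![(nu setT + _)%E]addeC !addeK// fin_num_measure.
Qed.

(** Exchanging integrals expresses the mass of a ray under the convolution of m with a normal law
    through bumps of width s. *)
Let smoothed (m : {finite_measure set R -> \bar R}) (s a : R) : 0 < s ->
  (\int[m]_x normal_prob x s `[a, +oo[%classic =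
   \int[@lebesgue_measure R]_z ((normal_peak s * \1_(`[a, +oo[%classic) z)%:E *
     \int[m]_x (expR (- (s^-1 ^+ 2 * (x - z) ^+ 2 / 2)))%:E))%E.
Proof.
move=> s0; have sn0 : s != 0 by rewrite gt_eqF.
have mg : measurable_fun setT (fun p : R * R => expR (- (s^-1 ^+ 2 * (p.1 - p.2) ^+ 2 / 2))).
  apply: measurableT_comp => //.
  apply: measurableT_comp => //; apply: measurable_funM => //; apply: measurable_funM => //.
  by apply: measurable_funX; exact: measurable_funB.
transitivity (\int[m]_x \int[@lebesgue_measure R]_z (normal_peak s * \1_(`[a, +oo[%classic) z *
    expR (- (s^-1 ^+ 2 * (x - z) ^+ 2 / 2)))%:E)%E.
  apply: eq_integral => x _; rewrite /normal_prob integral_mkcond; apply: eq_integral => z _.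
  rewrite patchE indicE; case: ifPn => _; last by rewrite mulr0 mul0r.
  rewrite mulr1 normal_pdfE// /normal_fun; congr ((_ * expR _)%:E).
  by field.
rewrite (@fubini_tonelli _ _ _ _ _ m (@lebesgue_measure R) (fun p => (normal_peak s * \1_(`[a, +oo[%classic) p.2 *
    expR (- (s^-1 ^+ 2 * (p.1 - p.2) ^+ 2 / 2)))%:E)) /=; last 2 first.
- apply/measurable_EFinP; apply: measurable_funM => //; apply: measurable_funM => //.
  by apply: measurableT_comp => //.
- by move=> x; rewrite lee_fin !mulr_ge0 ?expR_ge0 ?normal_peak_ge0.
apply: eq_integral => z _.
under eq_integral do rewrite EFinM.
rewrite ge0_integralZl ?lee_fin ?mulr_ge0 ?normal_peak_ge0//.
apply/measurable_EFinP.
exact: (@measurableT_comp _ _ _ _ _ _ (fun p : R * R => expR (- (s^-1 ^+ 2 * (p.1 - p.2) ^+ 2 / 2))) _ (fun x => (x, z))).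
Qed.

Let smoothed_eq (s a : R) : 0 < s ->
  (\int[mu]_x normal_prob x s `[a, +oo[%classic = \int[nu]_x normal_prob x s `[a, +oo[%classic)%E.
Proof.
move=> s0; rewrite !smoothed//; apply: eq_integral => z _.
by rewrite bump// invr_neq0// gt_eqF.
Qed.

Let measurable_smooth (s a : R) : s != 0 -> measurable_fun setT (fun x => normal_prob x s `[a, +oo[%classic).
Proof.
move=> s0; pose f (p : R * R) := (normal_pdf p.1 s p.2 * \1_(`[a, +oo[%classic) p.2)%:E.
rewrite (_ : (fun x => _) = fubini_F (@lebesgue_measure R) f); last first.
  apply/funext => x; rewrite /normal_prob integral_mkcond; apply: eq_integral => z _.
  by rewrite /f/= patchE indicE; case: ifPn => _; rewrite ?mulr1// mulr0.
apply: measurable_fun_fubini_tonelli_F => [|p]; last first.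
  by rewrite lee_fin mulr_ge0 ?normal_pdf_ge0.
apply/measurable_EFinP; apply: measurable_funM => //; last exact: measurableT_comp.
under eq_fun do rewrite normal_pdfE// /normal_fun.
apply: measurable_funM => //; apply: measurableT_comp => //; apply: measurable_funM => //.
by apply: measurableT_comp => //; apply: measurable_funX; exact: measurable_funB.
Qed.

(** Both rays are compared with the smoothed mass of [a, +oo[: a normal variable of width s moves a
    point by eta or more in a given direction with probability at most exp(1/2 - eta/s), which
    vanishes with s. *)
Let ray_le (a eta : R) : 0 < eta ->
  (mu `[(a + eta)%R, +oo[%classic <= nu `[(a - eta)%R, +oo[%classic)%E.
Proof.
move=> eta0.
have step (s : R) : 0 < s -> (mu `[(a + eta)%R, +oo[%classic <= nu `[(a - eta)%R, +oo[%classic +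
    (expR (2^-1 - eta / s))%:E * nu setT + (expR (2^-1 - eta / s))%:E * nu setT)%E.
  move=> s0; have ms := measurable_smooth a (lt0r_neq0 s0); set e := expR _; have e0 : (0 <= e%:E)%E by rewrite lee_fin expR_ge0.
  apply: (@le_trans _ _ (\int[mu]_x (normal_prob x s `[a, +oo[%classic + e%:E))%E).
    rewrite -[X in mu X]setIT -integral_indic//; apply: ge0_le_integral => //.
    - by apply/measurable_EFinP.
    - by apply: emeasurable_funD.
    move=> x _; rewrite indicE; case: (boolP (x \in _)) => [|_]; last first.
      by rewrite adde_ge0 ?lee_fin ?expR_ge0.
    rewrite inE/= in_itv/= andbT => ax.
    have -> : 1%E = (normal_prob x s `[a, +oo[%classic + normal_prob x s `]-oo, a[%classic)%E :> \bar R.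
      rewrite -measureU//; last first.
        by rewrite -subset0 => y [] /=; rewrite !in_itv/= andbT => /le_lt_trans h /h; rewrite ltxx.
      rewrite (_ : _ `|` _ = setT); first by apply/esym; exact: probability_setT.
      by apply/seteqP; split => // y _ /=; rewrite !in_itv/= andbT; case: (leP a y); [left|right].
    rewrite leeD2l//; apply: (normal_tail (k := -1)) => //; first by rewrite normrN1.
    by move=> z /=; rewrite in_itv/=; lra.
  rewrite ge0_integralD// integral_cst// smoothed_eq// leeD//; last by rewrite -muT.
  apply: (@le_trans _ _ (\int[nu]_x ((\1_(`[(a - eta)%R, +oo[%classic) x)%:E + e%:E))%E).
    apply: ge0_le_integral => //.
    - by apply: emeasurable_funD => //; apply/measurable_EFinP.
    move=> x _; rewrite indicE; case: (boolP (x \in _)) => [_|].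
      by rewrite -[leLHS]adde0 leeD ?lee_fin ?expR_ge0//; exact: probability_le1.
    rewrite notin_setE/= in_itv/= andbT => /negP; rewrite -ltNge => ax; rewrite add0e.
    apply: (normal_tail (k := 1)) => //; first by rewrite normr1.
    by move=> z /=; rewrite in_itv/=; lra.
  rewrite ge0_integralD//; last by apply/measurable_EFinP.
  by rewrite integral_cst// integral_indic// setIT.
apply/lee_addgt0Pr => e e0.
set M := fine (nu setT).
have nuM : nu setT = M%:E by rewrite fineK// fin_num_measure.
have M0 : 0 <= M by apply: fine_ge0.
(* With s = eta / (1/2 + L) the error in [step] is 2 M exp(-L), and exp L >= 1 + L >= 2 M / e. *)
pose L := 2 * M / e.
have L0 : 0 <= L by apply: divr_ge0; [exact: mulr_ge0|exact: ltW].
have L2 : 0 < 2^-1 + L by rewrite ltr_wpDr// invr_gt0.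
have := step (eta / (2^-1 + L)) (divr_gt0 eta0 L2).
rewrite invf_div mulrCA divff ?gt_eqF// mulr1 opprD addrA subrr add0r nuM.
move/le_trans; apply; rewrite -addeA leeD2l// -EFinM -EFinD lee_fin.
have : expR (- L) * (2 * M) <= e.
  rewrite expRN mulrC ler_pdivrMr ?expR_gt0//.
  apply: (@le_trans _ _ (e * (1 + L))); last by rewrite (ler_wpM2l (ltW e0))// expR_ge1Dx.
  by rewrite /L mulrDr mulr1 mulrCA divff ?gt_eqF// mulr1 lerDr (ltW e0).
by lra.
Unshelve. all: by end_near. Qed.

Lemma ray_le_closed (a : R) : (mu `[a, +oo[%classic <= nu `[a, +oo[%classic)%E.
Proof.
have E : `[a, +oo[%classic = \bigcap_n `[a - 2 * n.+1%:R^-1, +oo[%classic :> set R.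
  apply/seteqP; split => [x/=|x/=].
    by rewrite in_itv/= andbT => ax n _ /=; rewrite in_itv/= andbT (le_trans _ ax)// gerBl mulr_ge0.
  move=> H; rewrite in_itv/= andbT; apply/ler_addgt0Pr => e e0.
  have := H (Num.truncn (2 / e)) I; rewrite /= in_itv/= andbT lerBlDr => /le_trans; apply.
  rewrite lerD2l ler_pdivrMr// mulrC -ler_pdivrMr//.
  by apply/ltW; exact: truncnS_gt.
rewrite [X in (_ <= nu X)%E]E.
have L : nu `[a - 2 * n.+1%:R^-1, +oo[%classic @[n --> \oo] -->
    nu (\bigcap_n `[a - 2 * n.+1%:R^-1, +oo[%classic).
  apply: nonincreasing_cvg_mu => //.
  - by rewrite -ge0_fin_numE// fin_num_measure.
  - by rewrite -E.
  - move=> m n mn; apply/subsetPset => x /=; rewrite !in_itv/= !andbT; apply: le_trans.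
    by rewrite lerD2l lerN2 ler_wpM2l// lef_pV2 ?posrE// ler_nat ltnS.
have /cvg_lim <- // := L.
apply: lime_ge; first by apply/cvg_ex; eexists; exact: L.
apply: nearW => n.
(* Centred at a - 1/(n+1), so that the left ray starts at a itself and the right one at a -
   2/(n+1). *)
have := @ray_le (a - n.+1%:R^-1) n.+1%:R^-1.
rewrite subrK (_ : a - _ - _ = a - 2 / n.+1%:R); last ring.
apply.
by rewrite invr_gt0.
Qed.

End cos_unique.

(* Uniqueness of characteristic functions, by Gaussian smoothing. The integrands [1 + cos] are
   nonnegative, so that no integrability is needed. *)
Lemma cos_unique (R : realType) (mu nu : {finite_measure set R -> \bar R}) :
  (forall b t : R, \int[mu]_x (1 + cos (b * x + t))%:E =
                   \int[nu]_x (1 + cos (b * x + t))%:E)%E ->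
  forall A : set R, measurable A -> mu A = nu A.
Proof.
move=> munu A mA.
apply: (@measure_unique _ R _ (@RGenCInfty.G R) (fun k : nat => `[(- k%:R)%R, +oo[%classic)) => //.
- exact: RGenCInfty.measurableE.
- move=> _ _ [x ->] [y ->]; exists (Num.max x y).
  apply/seteqP; split => z /=; rewrite !in_itv/= !andbT ge_max; first by move=> [-> ->].
  by move=> /andP[].
- by move=> i; eexists.
- apply/seteqP; split => // x _; exists (Num.truncn `|x|).+1 => //=.
  rewrite in_itv/= andbT lerNl (le_trans (ler_norm _))// normrN.
  by apply/ltW; exact: truncnS_gt.
- move=> _ [x ->]; apply/eqP; rewrite eq_le; apply/andP; split; exact: ray_le_closed.
- by move=> k; rewrite -ge0_fin_numE// fin_num_measure.
Qed.

Section law.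
Context d d' (T : measurableType d) (U : measurableType d') (R : realType).

Variables (P : {measure set T -> \bar R}) (f : T -> U).
Hypothesis mf : measurable_fun setT f.

Definition law : {measure set U -> \bar R} := 
  measure_function_pushforward__canonical__measure_function_Measure P mf.

Lemma lawE A : law A = P (f @^-1` A). Proof. by []. Qed.

Lemma ge0_integral_law (h : U -> \bar R) : measurable_fun [set: U] h ->
  (forall y, (0 <= h y)%E) -> (\int[law]_y h y = \int[P]_x h (f x))%E.
Proof. by move=> mh h0; rewrite /law (ge0_integral_pushforward mf)//. Qed.

End law.

Section measurable_trig.
Context d (T : measurableType d) (R : realType).
Lemma measurable_cos_comp (f : T -> R) : measurable_fun setT f -> measurable_fun setT (fun w => cos (f w)).
Proof.
by move=> mf; apply: measurableT_comp => //; apply: continuous_measurable_fun; exact: continuous_cos.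
Qed.
End measurable_trig.

Section cos_unique_weighted.
Variable R : realType.

(** [cos_unique] applied to the law of Y under the measure of density f on C. It serves to confine
    one more coordinate of a vector, f being 1 + cos of a linear form and C the constraint on the
    earlier coordinates. *)
Lemma cos_unique_weighted d d' (T : measurableType d) (T' : measurableType d')
    (P : {measure set T -> \bar R}) (P' : {measure set T' -> \bar R})
    (C : set T) (C' : set T') (f : T -> R) (f' : T' -> R) (Y : T -> R) (Y' : T' -> R) :
  measurable C -> measurable C' -> measurable_fun setT f -> measurable_fun setT f' ->
  (forall x, 0 <= f x) -> (forall x, 0 <= f' x) ->
  measurable_fun setT Y -> measurable_fun setT Y' ->
  (\int[P]_(x in C) (f x)%:E < +oo)%E ->
  (\int[P']_(x in C') (f' x)%:E < +oo)%E ->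
  (forall b t : R, \int[P]_(x in C) ((1 + cos (b * Y x + t)) * f x)%:E =
                   \int[P']_(x in C') ((1 + cos (b * Y' x + t)) * f' x)%:E)%E ->
  forall A : set R, measurable A ->
    (\int[P]_(x in C `&` Y @^-1` A) (f x)%:E = \int[P']_(x in C' `&` Y' @^-1` A) (f' x)%:E)%E.
Proof.
move=> mC mC' mf mf' f0 f0' mY mY' fin fin' H A mA.
have key d1 (T1 : measurableType d1) (Q : {measure set T1 -> \bar R}) (D : set T1) (g Z : T1 -> R) :
    measurable D -> measurable_fun setT g -> (forall x, 0 <= g x) -> measurable_fun setT Z ->
    (\int[Q]_(x in D) (g x)%:E < +oo)%E ->
    exists m : {finite_measure set R -> \bar R},
    (forall b t : R, \int[m]_x (1 + cos (b * x + t))%:E =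
      \int[Q]_(x in D) ((1 + cos (b * Z x + t)) * g x)%:E)%E /\
    (forall B : set R, measurable B -> m B = \int[Q]_(x in D `&` Z @^-1` B) (g x)%:E)%E.
  move=> mD mg g0 mZ gfin.
  have mh : measurable_fun setT (fun x => g x * \1_D x) by apply: measurable_funM.
  have h0 x : 0 <= g x * \1_D x by rewrite mulr_ge0.
  pose m := law (mdensity Q mh h0) mZ.
  have mE (B : set R) : measurable B -> (m B = \int[Q]_(x in D `&` Z @^-1` B) (g x)%:E)%E.
    move=> mB; rewrite lawE /mdensity setIC integral_mkcondr; apply: eq_integral => x _.
    by rewrite patchE indicE; case: ifPn => _; rewrite ?mulr1 ?mulr0.
  have mfin : (m setT < +oo)%E by rewrite mE// setIT.
  pose m1 : {finite_measure set R -> \bar R} := mfrestr measurableT mfin.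
  have m1E (B : set R) : measurable B -> m1 B = m B by move=> mB; rewrite /m1 /= /mfrestr /mrestr setIT.
  exists m1; split => [b t|B mB]; last by rewrite m1E// mE.
  rewrite (eq_measure_integral m)//; last by move=> B mB _; exact: m1E.
  have mc : measurable_fun setT (fun x : R => (1 + cos (b * x + t))%:E).
    apply/measurable_EFinP; apply: measurable_funD => //; apply: measurable_cos_comp.
    by apply: measurable_funD => //; exact: measurable_funM.
  have c0 (x : R) : (0 <= (1 + cos (b * x + t))%:E)%E.
    by rewrite lee_fin; have := cos_geN1 (b * x + t); lra.
  rewrite ge0_integral_law// ge0_integral_mdensity//; last first.
    exact: (measurableT_comp mc mZ).
  rewrite [RHS]integral_mkcond; apply: eq_integral => x _.
  rewrite patchE indicE; case: ifPn => _; first by rewrite mulr1.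
  by rewrite mulr0 mule0.
have [m [m1 m2]] := key _ _ P C f Y mC mf f0 mY fin.
have [m' [m1' m2']] := key _ _ P' C' f' Y' mC' mf' f0' mY' fin'.
rewrite -m2// -m2'//; apply: cos_unique => // b t.
by rewrite m1 m1'.
Qed.

End cos_unique_weighted.

Section integral_ge0_real.
Context d (T : measurableType d) (R : realType) (mu : {measure set T -> \bar R}).
Variable D : set T.
Hypothesis mD : measurable D.
Implicit Types f g : T -> R.

Lemma ge0_integral_addr f g : measurable_fun D f -> measurable_fun D g ->
  (forall x, 0 <= f x) -> (forall x, 0 <= g x) ->
  (\int[mu]_(x in D) (f x + g x)%:E = \int[mu]_(x in D) (f x)%:E + \int[mu]_(x in D) (g x)%:E)%E.
Proof.
move=> mf mg f0 g0; under eq_integral do rewrite EFinD.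
by rewrite ge0_integralD//; [move=> x _; rewrite lee_fin|exact/measurable_EFinP|move=> x _; rewrite lee_fin|exact/measurable_EFinP].
Qed.

Lemma ge0_integral_mulr c f : measurable_fun D f -> 0 <= c -> (forall x, 0 <= f x) ->
  (\int[mu]_(x in D) (c * f x)%:E = c%:E * \int[mu]_(x in D) (f x)%:E)%E.
Proof.
move=> mf c0 f0; under eq_integral do rewrite EFinM.
by rewrite ge0_integralZl//; [exact/measurable_EFinP|move=> x _; rewrite lee_fin].
Qed.

Lemma ge0_ler_integral f g : measurable_fun D f -> measurable_fun D g ->
  (forall x, D x -> 0 <= f x) -> (forall x, D x -> f x <= g x) ->
  (\int[mu]_(x in D) (f x)%:E <= \int[mu]_(x in D) (g x)%:E)%E.
Proof.
move=> mf mg f0 fg; apply: ge0_le_integral => //; try exact/measurable_EFinP.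
Qed.

Lemma ge0_integral_sumr (I : Type) (s : seq I) (P : pred I) (F : I -> T -> R) :
  (forall i, measurable_fun D (F i)) -> (forall i x, 0 <= F i x) ->
  (\int[mu]_(x in D) (\sum_(i <- s | P i) F i x)%:E = \sum_(i <- s | P i) \int[mu]_(x in D) (F i x)%:E)%E.
Proof.
move=> mF F0; elim: s => [|i s IH].
  by rewrite big_nil; under eq_integral do rewrite big_nil; rewrite integral0.
rewrite big_cons -IH; case: ifPn => Pi; last first.
  by apply: eq_integral => x _; rewrite big_cons (negbTE Pi).
rewrite -ge0_integral_addr//.
- by apply: eq_integral => x _; rewrite big_cons Pi.
- by under eq_fun do rewrite big_mkcond; apply: measurable_sum => k; case: (P k).
- by move=> x; rewrite sumr_ge0.
Qed.

End integral_ge0_real.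

(** * Cramer-Wold: a joint law is determined by its linear forms *)

Section cos_vec_unique.
Context (R : realType) d d' (T : measurableType d) (T' : measurableType d').
Variables (P : probability T R) (P' : probability T' R) (n : nat).
Variables (X : 'I_n -> T -> R) (X' : 'I_n -> T' -> R).
Hypotheses (mX : forall i, measurable_fun setT (X i)) (mX' : forall i, measurable_fun setT (X' i)).
Hypothesis H : forall (a : 'I_n -> R) (t : R),
  (\int[P]_w (1 + cos (\sum_i a i * X i w + t))%:E =
   \int[P']_w (1 + cos (\sum_i a i * X' i w + t))%:E)%E.

Let box (T0 : Type) (Z : 'I_n -> T0 -> R) (B : 'I_n -> set R) (k : nat) : set T0 :=
  [set w | forall i : 'I_n, (i < k)%N -> B i (Z i w)].

Let boxS T0 (Z : 'I_n -> T0 -> R) B (k : nat) (kn : (k < n)%N) :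
  box Z B k.+1 = box Z B k `&` Z (Ordinal kn) @^-1` B (Ordinal kn).
Proof.
apply/seteqP; split => w /=; rewrite /box/=.
  by move=> h; split => [i ik|]; apply: h => //=; exact: ltnW.
move=> [h1 h2] i; rewrite ltnS leq_eqVlt => /predU1P[ik|]; last exact: h1.
by rewrite (_ : i = Ordinal kn)//; exact: val_inj.
Qed.

Let box0 T0 (Z : 'I_n -> T0 -> R) B : box Z B 0 = setT.
Proof. by apply/seteqP; split. Qed.

Let mbox d1 (T1 : measurableType d1) (Z : 'I_n -> T1 -> R) B k : (k <= n)%N ->
  (forall i, measurable_fun setT (Z i)) -> (forall i, measurable (B i)) -> measurable (box Z B k).
Proof.
move=> + mZ mB; elim: k => [|k IH] kn; first by rewrite box0.
rewrite boxS; apply: measurableI; first exact/IH/ltnW.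
by rewrite -[X in measurable X]setTI; exact: mZ.
Qed.

Let lin (T0 : Type) (Z : 'I_n -> T0 -> R) (a : 'I_n -> R) (w : T0) := \sum_i a i * Z i w.

Let mlin d1 (T1 : measurableType d1) (Z : 'I_n -> T1 -> R) a :
  (forall i, measurable_fun setT (Z i)) -> measurable_fun setT (lin Z a).
Proof. by move=> mZ; apply: measurable_sum => i; exact: measurable_funM. Qed.

Let mcoslin d1 (T1 : measurableType d1) (Z : 'I_n -> T1 -> R) a t :
  (forall i, measurable_fun setT (Z i)) -> measurable_fun setT (fun w => 1 + cos (lin Z a w + t)).
Proof.
move=> mZ; apply: measurable_funD => //; apply: measurable_cos_comp.
by apply: measurable_funD => //; exact: mlin.
Qed.

Let cos_ge0 (x : R) : 0 <= 1 + cos x.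
Proof. by have := cos_geN1 x; lra. Qed.

Let fin d1 (T1 : measurableType d1) (Q : probability T1 R) (Z : 'I_n -> T1 -> R) a t D :
  (forall i, measurable_fun setT (Z i)) -> measurable D ->
  (\int[Q]_(w in D) (1 + cos (lin Z a w + t))%:E < +oo)%E.
Proof.
move=> mZ mD; apply: (@le_lt_trans _ _ (\int[Q]_(w in D) 2%:E)%E).
  apply: ge0_le_integral => //.
  - by apply/measurable_EFinP; apply: measurable_funTS; exact: mcoslin.
  - by move=> w _; rewrite lee_fin; have := cos_le1 (lin Z a w + t); lra.
rewrite integral_cst// lte_mul_pinfty// ?lee_fin//.
by rewrite (le_lt_trans (probability_le1 Q mD))// ltry.
Qed.

Let linD T0 (Z : 'I_n -> T0 -> R) a j b w :
  lin Z (fun i => a i + (if i == j then b else 0)) w = lin Z a w + b * Z j w.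
Proof.
rewrite /lin (eq_bigr (fun i => a i * Z i w + (if i == j then b * Z i w else 0))).
  by rewrite big_split/= -big_mkcond/= big_pred1_eq.
by move=> i _; rewrite mulrDl; case: ifP => _; rewrite ?mul0r.
Qed.

Let cosM (x y : R) : (1 + cos x) * (1 + cos y) + 2 =
  (1 + cos x) + (1 + cos y) + 2^-1 * (1 + cos (y + x)) + 2^-1 * (1 + cos (y - x)).
Proof. by rewrite cosD cosB; field. Qed.

(** Induction on the number of coordinates confined to their sets. To confine the next one,
    [cos_unique_weighted] asks for the integral of a product of two factors 1 + cos of linear forms;
    by [cosM] it is a combination of integrals of single factors, known by induction. *)
Let core k : (k <= n)%N -> forall B : 'I_n -> set R, (forall i, measurable (B i)) ->
  forall a t, (\int[P]_(w in box X B k) (1 + cos (lin X a w + t))%:E =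
              \int[P']_(w in box X' B k) (1 + cos (lin X' a w + t))%:E)%E.
Proof.
elim: k => [|k IH] kn B mB a t; first by rewrite !box0; exact: H.
have {}IH := IH (ltnW kn) B mB.
have mC := mbox (ltnW kn) mX mB; have mC' := mbox (ltnW kn) mX' mB.
rewrite !boxS; apply: cos_unique_weighted => //.
- exact: mcoslin.
- exact: mcoslin.
- exact: fin.
- exact: fin.
move=> b s; set j := Ordinal kn.
(* The constant 2 of [cosM] is written as twice the integral of 1 + cos(pi / 2) and kept on the
   left, so that all integrands are nonnegative; it is cancelled at the end. *)
have key d1 (T1 : measurableType d1) (Q : probability T1 R) (Z : 'I_n -> T1 -> R) D :
  (forall i, measurable_fun setT (Z i)) -> measurable D ->
  (\int[Q]_(x in D) ((1 + cos (b * Z j x + s)) * (1 + cos (lin Z a x + t)))%:E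
   + 2%:E * \int[Q]_(x in D) (1 + cos (lin Z (fun=> 0) x + pi / 2))%:E =
   \int[Q]_(x in D) (1 + cos (lin Z (fun i => 0 + (if i == j then b else 0)) x + s))%:E +
   \int[Q]_(x in D) (1 + cos (lin Z a x + t))%:E +
   (2^-1)%:E * \int[Q]_(x in D) (1 + cos (lin Z (fun i => a i + (if i == j then b else 0)) x + (t + s)))%:E +
   (2^-1)%:E * \int[Q]_(x in D) (1 + cos (lin Z (fun i => a i + (if i == j then - b else 0)) x + (t - s)))%:E)%E.
  move=> mZ mD.
  have m1 c u : measurable_fun D (fun w => 1 + cos (lin Z c w + u)).
    by apply: measurable_funTS; exact: mcoslin.
  have m2 : measurable_fun D (fun x => (1 + cos (b * Z j x + s)) * (1 + cos (lin Z a x + t))).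
    apply: measurable_funTS; apply: measurable_funM; last exact: mcoslin.
    apply: measurable_funD => //; apply: measurable_cos_comp; apply: measurable_funD => //.
    exact: measurable_funM.
  have h0 : (0 : R) <= 2^-1 by rewrite invr_ge0.
  have p1 c u x : 0 <= 1 + cos (lin Z c x + u) by [].
  have p2 e c u x : 0 <= e -> 0 <= e * (1 + cos (lin Z c x + u)) by move=> e0; rewrite mulr_ge0.
  rewrite -!ge0_integral_mulr//.
  rewrite -!ge0_integral_addr//;
    try (by repeat first [exact: m1 | exact: m2 | exact: measurable_cst | apply: measurable_funM | apply: measurable_funD]);
    try (by move=> x; repeat first [exact: p1 | done | apply: addr_ge0 | apply: mulr_ge0]).
  - apply: eq_integral => x _; congr EFin.
    have -> : lin Z (fun=> 0) x = 0 by rewrite /lin big1// => i _; rewrite mul0r.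
    rewrite add0r cos_pihalf addr0 mulr1 !linD.
    have -> : lin Z (fun=> 0) x = 0 by rewrite /lin big1// => i _; rewrite mul0r.
    rewrite add0r cosM; congr (_ + _ + _ * (1 + cos _) + _ * (1 + cos _)); ring.
have := key _ _ P X _ mX mC; have := key _ _ P' X' _ mX' mC'.
rewrite !IH => <-.
have f2 := fin P' (fun=> 0) (pi / 2) mX' mC'.
move=> /(congr1 (fun y => y - 2%:E * \int[P']_(x in box X' B k) (1 + cos (lin X' (fun=> 0) x + pi / 2))%:E)%E).
by rewrite !addeK//; apply: fin_numM => //; rewrite ge0_fin_numE//; apply: integral_ge0.
Qed.

Let tup d1 (T1 : measurableType d1) (Z : 'I_n -> T1 -> R) (w : T1) : n.-tuple R := [tuple Z i w | i < n].

Let mtup d1 (T1 : measurableType d1) (Z : 'I_n -> T1 -> R) :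
  (forall i, measurable_fun setT (Z i)) -> measurable_fun setT (tup Z).
Proof.
move=> mZ; apply/measurable_fun_tnthP => i.
by rewrite (_ : _ \o _ = Z i)//; apply/funext => w /=; rewrite tnth_mktuple.
Qed.

Let G : set (set (n.-tuple R)) :=
  [set A | exists2 B : 'I_n -> set R, (forall i, measurable (B i)) & A = [set z | forall i, B i (tnth z i)]].

Let GE : measurable = <<s G >>.
Proof.
apply/seteqP; split => A.
  apply: smallest_sub; first exact: smallest_sigma_algebra.
  rewrite -bigcup_seq => _ [i _ [B mB <-]]; apply: sub_gen_smallest.
  exists (fun j => if j == i then B else setT); first by move=> j; case: ifP.
  rewrite setTI; apply/seteqP; split => z /=; last by move=> /(_ i); rewrite eqxx.
  by move=> Bz j; case: eqP => // ->.
apply: smallest_sub; first exact: sigma_algebra_measurable.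
move=> _ [B mB ->].
rewrite (_ : [set z | _] = box (fun i (z : n.-tuple R) => tnth z i) B n); last first.
  by apply/seteqP; split => z; rewrite /box/= => h i; [move=> _|]; exact: h.
by apply: mbox => // i; exact: measurable_tnth.
Qed.

Lemma cos_vec_unique (Phi : n.-tuple R -> \bar R) : measurable_fun [set: n.-tuple R] Phi ->
  (forall z, (0 <= Phi z)%E) ->
  (\int[P]_w Phi [tuple X i w | i < n] = \int[P']_w Phi [tuple X' i w | i < n])%E.
Proof.
move=> mPhi Phi0.
rewrite -(@ge0_integral_law _ _ _ _ _ _ (tup X) (mtup mX))//.
rewrite -(@ge0_integral_law _ _ _ _ _ _ (tup X') (mtup mX'))//.
apply: eq_measure_integral => A mA _.
apply: (measure_unique G (fun=> setT)) => //.
- move=> _ _ [B mB ->] [B' mB' ->]; exists (fun i => B i `&` B' i); first by move=> i; exact: measurableI.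
  by apply/seteqP; split => z /=; [move=> [h1 h2] i; split|move=> h; split => i; case: (h i)].
- by move=> _; exists (fun=> setT) => //; apply/seteqP; split.
- by rewrite bigcup_const//; exists 0%N.
- move=> _ [B mB ->].
  (* With zero coefficients and phase pi / 2 the integrand 1 + cos is 1, so that [core] speaks of
     the measure of a box. *)
  have E d1 (T1 : measurableType d1) (Q : probability T1 R) (Z : 'I_n -> T1 -> R) (mZ : forall i, measurable_fun setT (Z i)) :
    law Q (mtup mZ) [set z | forall i, B i (tnth z i)] =
    (\int[Q]_(w in box Z B n) (1 + cos (lin Z (fun=> 0) w + pi / 2))%:E)%E.
    rewrite lawE (_ : _ @^-1` _ = box Z B n); last first.
      apply/seteqP; split => w; rewrite /box/=.
        by move=> h i _; have := h i; rewrite tnth_mktuple.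
      by move=> h i; rewrite tnth_mktuple; exact: h.
    rewrite -[LHS]mul1e -integral_cst//; last exact: mbox.
    apply: eq_integral => w _; rewrite /lin big1 ?add0r ?cos_pihalf ?addr0// => i _.
    by rewrite mul0r.
  by rewrite !E core.
- by move=> _; rewrite lawE preimage_setT (le_lt_trans (probability_le1 _ _))// ltry.
Qed.

End cos_vec_unique.

(** * Gaussian vectors and concentration *)

Section cos_family_unique.
Context (R : realType) d d' (T : measurableType d) (T' : measurableType d').
Variables (P : probability T R) (P' : probability T' R) (J : finType).
Variables (X : J -> T -> R) (X' : J -> T' -> R).
Hypotheses (mX : forall j, measurable_fun setT (X j)) (mX' : forall j, measurable_fun setT (X' j)).
Hypothesis H : forall (a : J -> R) (t : R),
  (\int[P]_w (1 + cos (\sum_j a j * X j w + t))%:E =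
   \int[P']_w (1 + cos (\sum_j a j * X' j w + t))%:E)%E.

(** Measurability of F refers to the product sigma-algebra on tuples, transported by [enum_rank]. *)
Lemma cos_family_unique (F : (J -> R) -> R) :
  measurable_fun setT (fun z : #|J|.-tuple R => F (fun j => tnth z (enum_rank j))) ->
  (forall x, 0 <= F x) ->
  (\int[P]_w (F (X^~ w))%:E = \int[P']_w (F (X'^~ w))%:E)%E.
Proof.
move=> mF F0.
have sumE T0 (Z : J -> T0 -> R) (a : 'I_#|J| -> R) w :
    \sum_i a i * Z (enum_val i) w = \sum_j a (enum_rank j) * Z j w.
  by rewrite (reindex enum_rank)/=; [apply: eq_bigr => j _; rewrite enum_rankK|exact/onW_bij/enum_rank_bij].
have E T0 (Z : J -> T0 -> R) w :
    F (fun j => tnth [tuple Z (enum_val i) w | i < #|J|] (enum_rank j)) = F (Z^~ w).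
  by congr F; apply/funext => j; rewrite tnth_mktuple enum_rankK.
have := @cos_vec_unique R _ _ T T' P P' _ (fun i => X (enum_val i)) (fun i => X' (enum_val i))
  (fun i => mX _) (fun i => mX' _) _
  (fun z => (F (fun j => tnth z (enum_rank j)))%:E) _ _.
move=> /(_ (fun a t => _)) K.
under eq_integral do rewrite -E.
under [RHS]eq_integral do rewrite -E.
apply: K.
- move=> a t.
  under eq_integral do rewrite sumE.
  under [RHS]eq_integral do rewrite sumE.
  exact: H.
- exact/measurable_EFinP.
- by move=> z; rewrite lee_fin.
Qed.

End cos_family_unique.

Section centred_gaussian_rv_facts.
Context (R : realType) d (T : measurableType d) (P : probability T R) (Y : T -> R) (v : R).
Hypothesis Yv : centred_gaussian_rv P Y v.

Let v0 : 0 <= v. Proof. by case: Yv. Qed.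

Lemma measurable_gaussian_rv : measurable_fun setT Y. Proof. by case: Yv => _ []. Qed.

Lemma ge0_integral_gaussian_rv (f : R -> R) : measurable_fun setT f -> (forall x, 0 <= f x) ->
  (\int[P]_w (f (Y w))%:E = if v == 0%R then (f 0%R)%:E
    else \int[normal_prob 0 (Num.sqrt v)]_x (f x)%:E)%E.
Proof.
move=> mf f0; have mY := measurable_gaussian_rv.
have mfE : measurable_fun setT (fun x => (f x)%:E) by exact/measurable_EFinP.
transitivity (\int[law P mY]_y (f y)%:E)%E; first by rewrite ge0_integral_law.
case: Yv => _ [_ lawY]; case: (eqVneq v 0) lawY => v00 lawY.
  rewrite (eq_measure_integral (\d_(0 : R))) => [|A mA _]; last exact: lawY.
  by rewrite integral_dirac// diracT mul1e.
(* The image under the identity moves [normal_prob] from the type whose sigma-algebra is generated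
   by [ocitv] to R, where the law of Y lives. *)
have mid : measurable_fun [set: g_sigma_algebraType (@ocitv R)] (fun x => x : R).
  by move=> _ A mA; rewrite setTI.
transitivity (\int[law (normal_prob 0 (Num.sqrt v)) mid]_y (f y)%:E)%E; last first.
  by rewrite ge0_integral_law.
by apply: eq_measure_integral => A mA _; exact: lawY.
Qed.

Lemma gaussian_rv_mgf (t : R) : (\int[P]_w (expR (t * Y w))%:E = (expR (t ^+ 2 * v / 2))%:E)%E.
Proof.
rewrite (ge0_integral_gaussian_rv (f := fun x => expR (t * x)))//; last first.
  by apply: measurableT_comp => //; exact: measurable_funM.
case: eqVneq => [->|vn0]; first by rewrite !mulr0 mul0r.
by rewrite normal_mgf ?sqr_sqrtr// sqrtr_eq0 -ltNge lt_def vn0.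
Qed.

Lemma gaussian_rv_cos (b t : R) :
  (\int[P]_w (1 + cos (b * Y w + t))%:E = (1 + cos t * expR (- (v * b ^+ 2 / 2)))%:E)%E.
Proof.
rewrite (ge0_integral_gaussian_rv (f := fun x => 1 + cos (b * x + t))); last 2 first.
- by apply: measurable_funD => //; apply: measurable_cos_comp; apply: measurable_funD.
- by move=> x; have := cos_geN1 (b * x + t); lra.
case: eqVneq => [->|vn0]; first by rewrite mulr0 add0r !mul0r oppr0 expR0 mulr1.
by rewrite normal_cos ?sqr_sqrtr// sqrtr_eq0 -ltNge lt_def vn0.
Qed.

End centred_gaussian_rv_facts.

Definition gaussian_family d (T : measurableType d) (R : realType) (P : probability T R)
    (J : finType) (X : J -> T -> R) (C : J -> J -> R) : Prop :=
  (forall j, measurable_fun setT (X j)) /\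
  forall a : J -> R, centred_gaussian_rv P (fun w => \sum_j a j * X j w)
    (\sum_j \sum_k a j * a k * C j k).

(** * Rotation invariance of a pair of independent copies *)

Section rotation.
Context d (T : measurableType d) (R : realType) (P : probability T R).
Variables (J : finType) (X : J -> T -> R) (C : J -> J -> R).
Hypothesis GX : gaussian_family P X C.

Let mX j : measurable_fun setT (X j). Proof. by case: GX. Qed.

Definition rot_pair (th : R) (j : J + J) (w : T * T) : R :=
  match j with
  | inl j => cos th * X j w.1 + sin th * X j w.2
  | inr j => - sin th * X j w.1 + cos th * X j w.2
  end.

Let q (a : J -> R) := \sum_j \sum_k a j * a k * C j k.

Let mrot th j : measurable_fun setT (rot_pair th j).
Proof.
by case: j => j /=; apply: measurable_funD; apply: measurable_funM => //; exact: measurableT_comp.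
Qed.

Let qrot (a b : J -> R) c s : c ^+ 2 + s ^+ 2 = 1 ->
  q (fun j => c * a j - s * b j) + q (fun j => s * a j + c * b j) = q a + q b.
Proof.
move=> cs; rewrite /q -!big_split/=; apply: eq_bigr => j _; rewrite -!big_split/=.
apply: eq_bigr => k _.
transitivity ((c ^+ 2 + s ^+ 2) * (a j * a k * C j k + b j * b k * C j k)); first by ring.
by rewrite cs mul1r.
Qed.

Let cos_rot th (a : (J + J)%type -> R) t :
  (\int[(P \x P)%E]_w (1 + cos (\sum_j a j * rot_pair th j w + t))%:E =
   (1 + cos t * expR (- ((q (fun j => a (inl j)) + q (fun j => a (inr j))) / 2)))%:E)%E.
Proof.
have cs : cos th ^+ 2 + sin th ^+ 2 = 1 by exact: cos2Dsin2.
rewrite -(qrot (fun j => a (inl j)) (fun j => a (inr j)) cs).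
pose u j := cos th * a (inl j) - sin th * a (inr j).
pose v j := sin th * a (inl j) + cos th * a (inr j).
rewrite -/u -/v.
have E w : \sum_j a j * rot_pair th j w =
    1 * (\sum_j u j * X j w.1) + \sum_j v j * X j w.2.
  rewrite big_sumType/= mul1r -!big_split/=; apply: eq_bigr => j _.
  rewrite /u /v; ring.
under eq_integral do rewrite E.
have mlin (e : J -> R) : measurable_fun setT (fun w => \sum_j e j * X j w).
  by apply: measurable_sum => j; exact: measurable_funM.
rewrite (@fubini_tonelli2 _ _ _ _ _ P P) /=; last 2 first.
- apply/measurable_EFinP; apply: measurable_funD => //; apply: measurable_cos_comp.
  apply: measurable_funD => //; apply: measurable_funD.
    by apply: measurable_funM => //; exact: (measurableT_comp (mlin u)).
  exact: (measurableT_comp (mlin v)).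
- by move=> w; rewrite lee_fin; have := cos_geN1 (1 * (\sum_j u j * X j w.1) + \sum_j v j * X j w.2 + t); lra.
rewrite /fubini_G /=.
have gU : centred_gaussian_rv P (fun w => \sum_j u j * X j w) (q u) by apply: GX.2.
have gV : centred_gaussian_rv P (fun w => \sum_j v j * X j w) (q v) by apply: GX.2.
have qu0 : 0 <= q u by case: gU.
(* The inner integral is written as a combination, with nonnegative weights, of 1 and a term 1 +
   cos, so that the outer integrand stays nonnegative. *)
under eq_integral => y _.
  under eq_integral do rewrite -addrA.
  rewrite (gaussian_rv_cos gU) expr1n mulr1 (_ : 1 + _ = (1 - expR (- (q u / 2))) +
    expR (- (q u / 2)) * (1 + cos (1 * (\sum_j v j * X j y) + t))); last by rewrite mul1r; ring.
  over.
have e1 : 0 <= 1 - expR (- (q u / 2)).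
  by rewrite subr_ge0 -[leRHS]expR0 ler_expR oppr_le0 divr_ge0.
have mV : measurable_fun setT (fun w => 1 + cos (1 * (\sum_j v j * X j w) + t)).
  apply: measurable_funD => //; apply: measurable_cos_comp; apply: measurable_funD => //.
  exact: measurable_funM.
have V0 w : 0 <= 1 + cos (1 * (\sum_j v j * X j w) + t).
  by have := cos_geN1 (1 * (\sum_j v j * X j w) + t); lra.
rewrite ge0_integral_addr//; last first.
- by apply: measurable_funM.
rewrite integral_cst//= probability_setT mule1 ge0_integral_mulr ?expR_ge0//.
rewrite (gaussian_rv_cos gV) expr1n mulr1 -EFinM -EFinD; congr EFin.
rewrite mulrDl opprD expRD; ring.
Qed.

Lemma rotation_invariance th (F : (J + J -> R) -> R) :
  measurable_fun setT (fun z : #|{: J + J}|.-tuple R => F (fun j => tnth z (enum_rank j))) ->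
  (forall x, 0 <= F x) ->
  (\int[(P \x P)%E]_w (F (rot_pair th ^~ w))%:E = \int[(P \x P)%E]_w (F (rot_pair 0 ^~ w))%:E)%E.
Proof.
move=> mF F0; apply: cos_family_unique => //.
by move=> a t; rewrite !cos_rot.
Qed.

End rotation.

Section real_inequalities.
Variable R : realType.
Implicit Types x h : R.

Lemma expR_tangent (m u : R) : expR m * (1 + (u - m)) <= expR u.
Proof.
rewrite -[X in _ <= expR X](subrK m u) addrC [in leRHS]addrC expRD ler_wpM2l ?expR_ge0//.
by rewrite addrC expR_ge1Dx.
Qed.

Lemma expR_jensen (I : finType) (p u : I -> R) : (forall i, 0 <= p i) -> \sum_i p i = 1 ->
  expR (\sum_i p i * u i) <= \sum_i p i * expR (u i).
Proof.
move=> p0 p1; set m := \sum_i p i * u i.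
have -> : expR m = \sum_i p i * (expR m * (1 + (u i - m))).
  transitivity (expR m * \sum_i (p i * 1 + (p i * u i - p i * m))).
    rewrite big_split/= sumrB -/m -!mulr_suml p1 mulr1 mul1r; ring.
  by rewrite mulr_sumr; apply: eq_bigr => i _; ring.
by apply: ler_sum => i _; rewrite ler_wpM2l// expR_tangent.
Qed.

Lemma expR_le_onem (s y : R) : 0 <= s <= 1 -> expR (s * y) <= 1 - s + s * expR y.
Proof.
move=> /andP[s0 s1].
have := expR_tangent (s * y) 0; have := expR_tangent (s * y) y; rewrite expR0 => h1 h2.
have h3 : s * (expR (s * y) * (1 + (y - s * y))) <= s * expR y by rewrite ler_wpM2l.
have h4 : (1 - s) * (expR (s * y) * (1 + (0 - s * y))) <= (1 - s) * 1 by rewrite ler_wpM2l// subr_ge0.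
rewrite mulr1 in h4; apply: le_trans (lerD h4 h3).
by rewrite le_eqVlt; apply/orP; left; apply/eqP; ring.
Qed.

Lemma sin_le_id x : 0 <= x -> sin x <= x.
Proof.
rewrite le_eqVlt => /predU1P[<-|x0]; first by rewrite sin0.
have cs : {within `[0, x], continuous (@sin R)}.
  by apply: continuous_subspaceT; exact: continuous_sin.
have [c _] := MVT x0 (fun y _ => is_derive_sin y) cs.
rewrite sin0 !subr0 => ->; apply: ler_piMl; first exact: ltW.
exact: cos_le1.
Qed.

Lemma onem_cos_le x : 0 <= x -> 1 - cos x <= x ^+ 2 / 2.
Proof.
rewrite le_eqVlt => /predU1P[<-|x0]; first by rewrite cos0 expr0n/= mul0r subrr.
have dc y : is_derive y (1 : R) (fun y : R => - cos y - y ^+ 2 / 2) (sin y - y).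
  by apply: is_derive_eq; rewrite /GRing.scale/=; field.
have cc : {within `[0, x], continuous (fun y : R => - cos y - y ^+ 2 / 2)}.
  apply: continuous_subspaceT => y; apply: (@cvgB _ R^o).
    by apply: (@cvgN _ R^o); exact: continuous_cos.
  by apply: (@cvgM _ R^o); [exact: exprn_continuous|exact: cvg_cst].
have [c /[!in_itv]/= /andP[c0 cx]] := MVT x0 (fun y _ => dc y) cc.
rewrite cos0 expr0n/= mul0r !subr0 => E.
have : (sin c - c) * x <= 0 by rewrite mulr_le0_ge0 ?(ltW x0)// subr_le0 sin_le_id// ltW.
by rewrite -E; lra.
Qed.

Lemma sqr_sin_le x : 0 <= x -> sin x ^+ 2 <= x ^+ 2.
Proof.
move=> x0; have := onem_cos_le x0; have := cos_le1 x; have := cos_geN1 x.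
have := cos2Dsin2 x; have := sqr_ge0 x; nra.
Qed.

End real_inequalities.

(** * Concentration of averaged log-sums of exponentials of a Gaussian vector *)

Section log_sum_exp.
Variables (R : realType) (J K : finType) (Ic : K -> {set J}) (al : K -> R).
Hypotheses (al0 : forall c, 0 <= al c) (al1 : \sum_c al c = 1).
Hypothesis Ic0 : forall c, exists j, j \in Ic c.

Definition block_sum (c : K) (x : J -> R) : R := \sum_(j in Ic c) expR (x j).

Definition mean_log_sum (x : J -> R) : R := \sum_c al c * ln (block_sum c x).

Let S := block_sum.
Let f := mean_log_sum.

Lemma block_sum_gt0 c x : 0 < S c x.
Proof.
have [j jc] := Ic0 c; rewrite /S /block_sum (bigD1 j)//=.
by rewrite ltr_pwDl ?expR_gt0// sumr_ge0// => i _; exact: expR_ge0.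
Qed.

(** The Gibbs weights of the block c, that is the gradient of [ln (block_sum c x)]. *)
Let p c x j : R := if j \in Ic c then expR (x j - ln (S c x)) else 0.

Let p_ge0 c x j : 0 <= p c x j.
Proof. by rewrite /p; case: ifP => // _; exact: expR_ge0. Qed.

Let pE c x j : p c x j = if j \in Ic c then expR (x j) / S c x else 0.
Proof. by rewrite /p; case: ifP => // _; rewrite expRB lnK// posrE block_sum_gt0. Qed.

Let p_sum1 c x : \sum_j p c x j = 1.
Proof.
under eq_bigr do rewrite pE; rewrite -big_mkcond/= -mulr_suml divff//.
by rewrite gt_eqF// block_sum_gt0.
Qed.

Let nu x j : R := \sum_c al c * p c x j.

Let nu_ge0 x j : 0 <= nu x j.
Proof. by rewrite sumr_ge0// => c _; rewrite mulr_ge0. Qed.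

Let nu_sum1 x : \sum_j nu x j = 1.
Proof.
rewrite exchange_big/= -[RHS]al1; apply: eq_bigr => c _.
by rewrite -mulr_sumr p_sum1 mulr1.
Qed.

(** Convexity of f, whose gradient at x is [nu x]; on each block it is Jensen's inequality for the
    Gibbs weights. *)
Let f_grad x y : f x - f y <= \sum_j nu x j * (x j - y j).
Proof.
rewrite (_ : \sum_j _ = \sum_c al c * (\sum_j p c x j * (x j - y j))); last first.
  under eq_bigr do rewrite mulr_suml; rewrite exchange_big/=; apply: eq_bigr => c _.
  by rewrite mulr_sumr; apply: eq_bigr => j _; rewrite mulrA.
rewrite /f /mean_log_sum -sumrB; apply: ler_sum => c _.
rewrite -mulrBr ler_wpM2l// -lerN2 opprB.
have := expR_jensen (fun j => y j - x j) (p_ge0 c x) (p_sum1 c x).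
have -> : \sum_j p c x j * expR (y j - x j) = S c y / S c x.
  rewrite (bigID (mem (Ic c)))/= [X in _ + X]big1 ?addr0; last first.
    by move=> j jc; rewrite /p (negbTE jc) mul0r.
  rewrite /S /block_sum mulr_suml; apply: eq_bigr => j jc.
  by rewrite pE jc mulrAC -expRD addrC subrK.
rewrite -[leRHS]lnK ?posrE ?divr_gt0 ?block_sum_gt0// ler_expR.
rewrite ln_div ?posrE ?block_sum_gt0//; apply: le_trans.
by rewrite -sumrN le_eqVlt; apply/orP; left; apply/eqP; apply: eq_bigr => j _; rewrite -mulrN opprB.
Qed.

(** Each block carries the fixed mass [al c] of the gradient, wherever this mass sits inside the
    block. So the variance of the linear form grad f is controlled uniformly in x by bounds between
    blocks only. *)
Let nu_form x (C : J -> J -> R) (M : K -> K -> R) (L : R) :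
  (forall c c' j k, j \in Ic c -> k \in Ic c' -> C j k <= M c c') ->
  \sum_c \sum_c' al c * al c' * M c c' <= L ->
  \sum_j \sum_k nu x j * nu x k * C j k <= L.
Proof.
move=> CM; apply: le_trans.
have E j k : nu x j * nu x k * C j k = \sum_c \sum_c' al c * al c' * (p c x j * p c' x k * C j k).
  rewrite /nu mulr_suml mulr_suml; apply: eq_bigr => c _.
  by rewrite mulr_sumr mulr_suml; apply: eq_bigr => c' _; ring.
under eq_bigr do under eq_bigr do rewrite E.
under eq_bigr do rewrite exchange_big/=.
rewrite exchange_big/=; apply: ler_sum => c _.
under eq_bigr do rewrite exchange_big/=.
rewrite exchange_big/=; apply: ler_sum => c' _.
under eq_bigr do rewrite -mulr_sumr.
rewrite -mulr_sumr ler_wpM2l ?mulr_ge0//.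
apply: (@le_trans _ _ (\sum_j \sum_k p c x j * p c' x k * M c c')).
  apply: ler_sum => j _; apply: ler_sum => k _.
  case: (boolP (j \in Ic c)) => jc; last by rewrite /p (negbTE jc) !mul0r.
  case: (boolP (k \in Ic c')) => kc; last by rewrite /p (negbTE kc) mulr0 !mul0r.
  by rewrite ler_wpM2l ?mulr_ge0//; exact: CM.
under eq_bigr do rewrite -mulr_suml -mulr_sumr p_sum1 mulr1.
by rewrite -mulr_suml p_sum1 mul1r.
Qed.

Lemma measurable_block_sum d (T : measurableType d) (Z : J -> T -> R) c :
  (forall j, measurable_fun setT (Z j)) -> measurable_fun setT (fun w => S c (Z^~ w)).
Proof.
move=> mZ; rewrite (_ : (fun w => _) = fun w => \sum_j (if j \in Ic c then expR (Z j w) else 0)); last first.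
  by apply/funext => w; rewrite /S /block_sum big_mkcond.
by apply: measurable_sum => j; case: (j \in Ic c) => //; exact: measurableT_comp.
Qed.

Lemma measurable_mean_log_sum d (T : measurableType d) (Z : J -> T -> R) :
  (forall j, measurable_fun setT (Z j)) -> measurable_fun setT (fun w => f (Z^~ w)).
Proof.
move=> mZ; apply: measurable_sum => c; apply: measurable_funM => //.
by apply: measurableT_comp; [exact: measurable_ln|exact: measurable_block_sum].
Qed.

Let measurable_nu d (T : measurableType d) (Z : J -> T -> R) j :
  (forall j, measurable_fun setT (Z j)) -> measurable_fun setT (fun w => nu (Z^~ w) j).
Proof.
move=> mZ; apply: measurable_sum => c; apply: measurable_funM => //.
rewrite /p; case: (j \in Ic c) => //; apply: measurableT_comp => //; apply: measurable_funB => //.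
by apply: measurableT_comp; [exact: measurable_ln|exact: measurable_block_sum].
Qed.

Section concentration.
Context d (T : measurableType d) (P : probability T R).
Variables (X : J -> T -> R) (C : J -> J -> R).
Hypothesis GX : gaussian_family P X C.
Variables (M : K -> K -> R) (L lam : R).
Hypothesis CM : forall c c' j k, j \in Ic c -> k \in Ic c' -> C j k <= M c c'.
Hypothesis ML : \sum_c \sum_c' al c * al c' * M c c' <= L.
Hypothesis lam0 : 0 <= lam.

Let mX j : measurable_fun setT (X j). Proof. by case: GX. Qed.

Let mgf (a : J -> R) : (\int[P]_w (expR (\sum_j a j * X j w))%:E =
  (expR ((\sum_j \sum_k a j * a k * C j k) / 2))%:E)%E.
Proof.
have := gaussian_rv_mgf (GX.2 a) 1; rewrite expr1n mul1r => <-.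
by apply: eq_integral => w _; rewrite mul1r.
Qed.

Section step.
Variables (N : nat).
Hypothesis N0 : (0 < N)%N.
Let h : R := pi / 2 / N%:R.
Let s : R := N%:R * lam * (1 - cos h).
Hypothesis s1 : s <= 1.

Let Nr0 : (0 : R) < N%:R. Proof. by rewrite ltr0n. Qed.
Let NhE : N%:R * h = pi / 2. Proof. by rewrite /h mulrC divfK// gt_eqF. Qed.
Let h0 : 0 <= h. Proof. by rewrite !divr_ge0 ?pi_ge0. Qed.
Let s0 : 0 <= s. Proof. by rewrite !mulr_ge0// ?subr_ge0 ?cos_le1// ltW. Qed.

Let F (z : J + J -> R) : R :=
  expR (N%:R * lam * (f (fun j => z (inl j)) -
    f (fun j => cos h * z (inl j) + sin h * z (inr j)))).

Let mF d1 (T1 : measurableType d1) (Z : J + J -> T1 -> R) :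
  (forall j, measurable_fun setT (Z j)) -> measurable_fun setT (fun w => F (Z^~ w)).
Proof.
move=> mZ; apply: measurableT_comp => //; apply: measurable_funM => //; apply: measurable_funB.
  exact: (measurable_mean_log_sum (Z := fun j => Z (inl j))).
apply: (measurable_mean_log_sum (Z := fun j w => cos h * Z (inl j) w + sin h * Z (inr j) w)) => j.
by apply: measurable_funD; exact: measurable_funM.
Qed.

Let U th (w : T * T) (j : J) := rot_pair X th (inl j) w.

(** A quarter turn cut into N rotations of angle h leads from X to its copy; Jensen's inequality
    turns the exponential of the telescoping sum into a mean of exponentials with the extra factor
    N. *)
Let telescope w : expR (lam * (f (X^~ w.1) - f (X^~ w.2))) <=
  \sum_(k < N) N%:R^-1 * F (rot_pair X (k%:R * h) ^~ w).
Proof.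
have -> : X^~ w.1 = U (0%:R * h) w.
  by apply/funext => j; rewrite /U/= mul0r cos0 sin0 mul1r mul0r addr0.
have -> : X^~ w.2 = U (N%:R * h) w.
  apply/funext => j; rewrite /U/= NhE cos_pihalf sin_pihalf.
  by rewrite mul0r mul1r add0r.
have E : f (U (0%:R * h) w) - f (U (N%:R * h) w) =
    \sum_(k < N) (f (U (k%:R * h) w) - f (U (k.+1%:R * h) w)).
  rewrite -(big_mkord predT (fun k => f (U (k%:R * h) w) - f (U (k.+1%:R * h) w))).
  rewrite -opprB -(telescope_sumr (fun k => f (U (k%:R * h) w)) (leq0n N)) -sumrN.
  by apply: eq_bigr => k _; rewrite opprB.
rewrite E.
have := @expR_jensen R 'I_N (fun=> N%:R^-1)
  (fun k => N%:R * lam * (f (U (k%:R * h) w) - f (U (k.+1%:R * h) w))).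
have -> : \sum_(i < N) N%:R^-1 * (N%:R * lam * (f (U (i%:R * h) w) - f (U (i.+1%:R * h) w))) =
   lam * \sum_(k < N) (f (U (k%:R * h) w) - f (U (k.+1%:R * h) w)).
  by rewrite mulr_sumr; apply: eq_bigr => k _; rewrite !mulrA mulVf ?gt_eqF// mul1r.
move=> J1; apply: le_trans (J1 _ _) _.
- by move=> _; rewrite invr_ge0 ltW.
- by rewrite big_const_ord iter_addr_0 -[LHS]mulr_natl divff// gt_eqF.
apply: ler_sum => k _; apply: ler_wpM2l; first by rewrite invr_ge0 (ltW Nr0).
rewrite le_eqVlt; apply/orP; left; apply/eqP; rewrite /F; congr (expR (_ * (f _ - f _))).
apply/funext => j; rewrite /U/= (_ : k.+1%:R * h = k%:R * h + h); last by rewrite -natr1 mulrDl mul1r.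
rewrite cosD sinD; ring.
Qed.

(** By [f_grad] the exponent is at most s (nu . x) - N lam sin h (nu . X'), where s is of order 1/N.
    The first part is small and bounded crudely by a sum of exponentials; the second is Gaussian
    once the first copy is fixed. *)
Let F_le (w : T * T) : F (rot_pair X 0 ^~ w) <=
  (1 + s * \sum_j expR (X j w.1)) *
  expR (\sum_j (- (N%:R * lam * sin h) * nu (X^~ w.1) j) * X j w.2).
Proof.
rewrite /F /=; set x := X^~ w.1.
have -> : (fun j => cos 0 * X j w.1 + sin 0 * X j w.2) = x.
  by apply/funext => j; rewrite cos0 sin0 mul1r mul0r addr0.
set x' := fun j => _.
apply: (@le_trans _ _ (expR (s * (\sum_j nu x j * x j)) *
    expR (\sum_j (- (N%:R * lam * sin h) * nu x j) * X j w.2))).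
  rewrite -expRD ler_expR.
  apply: (@le_trans _ _ (N%:R * lam * \sum_j nu x j * (x j - x' j))).
    by rewrite ler_wpM2l ?f_grad// mulr_ge0// ltW.
  rewrite le_eqVlt; apply/orP; left; apply/eqP.
  rewrite /s -!mulrA !mulr_sumr -!big_split/=; apply: eq_bigr => j _.
  by rewrite /x' /= sin0 cos0 /x; ring.
rewrite ler_wpM2r ?expR_ge0//.
apply: le_trans (expR_le_onem _ _) _; first by rewrite s0 s1.
apply: lerD; first by rewrite gerBl.
rewrite ler_wpM2l//; apply: le_trans (expR_jensen _ (nu_ge0 x) (nu_sum1 x)) _.
apply: ler_sum => j _; apply: ler_piMl; first exact: expR_ge0.
by rewrite -(nu_sum1 x) (bigD1 j)//= lerDl sumr_ge0.
Qed.

Let A : R := \sum_j expR (C j j / 2).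

Lemma mean_log_sum_step : (\int[(P \x P)%E]_w (expR (lam * (f (X^~ w.1) - f (X^~ w.2))))%:E <=
  ((1 + s * A) * expR (2 * lam ^+ 2 * L))%:E)%E.
Proof.
have mrp th j : measurable_fun setT (rot_pair X th j).
  by case: j => j /=; apply: measurable_funD; apply: measurable_funM => //; exact: measurableT_comp.
have mf : measurable_fun setT (fun w => f (X^~ w)) by exact: measurable_mean_log_sum.
have mFr th : measurable_fun setT (fun w => F (rot_pair X th ^~ w)) by exact: mF.
have F0 z : 0 <= F z by exact: expR_ge0.
have Fint th : (\int[(P \x P)%E]_w (F (rot_pair X th ^~ w))%:E <=
    ((1 + s * A) * expR (2 * lam ^+ 2 * L))%:E)%E.
  rewrite (rotation_invariance GX)//; last first.
    by apply: (mF (Z := fun j z => tnth z (enum_rank j))) => j; exact: measurable_tnth.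
  pose G (w : T * T) := (1 + s * \sum_j expR (X j w.1)) *
    expR (\sum_j (- (N%:R * lam * sin h) * nu (X^~ w.1) j) * X j w.2).
  have m1 : measurable_fun setT (fun w => 1 + s * \sum_j expR (X j w)).
    by apply: measurable_funD => //; apply: measurable_funM => //; apply: measurable_sum => j; exact: measurableT_comp.
  have p1 w : 0 <= 1 + s * \sum_j expR (X j w).
    by rewrite addr_ge0// mulr_ge0// sumr_ge0// => j _; exact: expR_ge0.
  have m2 : measurable_fun setT (fun w : T * T => expR (\sum_j (- (N%:R * lam * sin h) * nu (X^~ w.1) j) * X j w.2)).
    apply: measurableT_comp => //; apply: measurable_sum => j; apply: measurable_funM.
      apply: measurable_funM => //.
      exact: (measurableT_comp (@measurable_nu _ _ _ j mX)).
    exact: measurableT_comp.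
  have mG : measurable_fun setT G.
    by apply: measurable_funM => //; exact: (measurableT_comp m1).
  apply: (@le_trans _ _ (\int[(P \x P)%E]_w (G w)%:E)%E).
    by apply: ge0_ler_integral => //.
  have G0 w : 0 <= G w by rewrite mulr_ge0 ?expR_ge0.
  rewrite fubini_tonelli1 /=; last 2 first.
  - exact/measurable_EFinP.
  - by move=> w; rewrite lee_fin.
  rewrite /fubini_F /G /=.
  apply: (@le_trans _ _ (\int[P]_x (expR (2 * lam ^+ 2 * L) * (1 + s * \sum_j expR (X j x)))%:E)%E).
    apply: ge0_le_integral => //.
    - by move=> x _; apply: integral_ge0 => y _; rewrite lee_fin mulr_ge0 ?expR_ge0.
    - apply: (@measurable_fun_fubini_tonelli_F _ _ _ _ _ P (fun w => (G w)%:E)) => //.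
        exact/measurable_EFinP.
    - by apply/measurable_EFinP; apply: measurable_funM.
    move=> x _; rewrite ge0_integral_mulr//; last first.
      by apply: measurableT_comp => //; apply: measurable_sum => j; exact: measurable_funM.
    rewrite mgf -EFinM lee_fin [leRHS]mulrC ler_wpM2l// ler_expR.
    rewrite (_ : \sum_j _ = (N%:R * lam * sin h) ^+ 2 * \sum_j \sum_k nu (X^~ x) j * nu (X^~ x) k * C j k); last first.
      rewrite mulr_sumr; apply: eq_bigr => j _; rewrite mulr_sumr; apply: eq_bigr => k _; ring.
    have L1 := nu_form (X^~ x) CM ML.
    (* From N sin h <= N h = pi / 2 <= 2 comes the constant in exp(2 lam^2 L) = exp((2 lam)^2 L /
       2). *)
    have Nh : N%:R * h <= 2.
      by rewrite NhE ltW// pihalf_lt2.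
    have Nh0 : 0 <= N%:R * h by rewrite mulr_ge0 ?(ltW Nr0).
    have s2 : (N%:R * lam * sin h) ^+ 2 <= lam ^+ 2 * 4.
      rewrite mulrAC mulrC !exprMn ler_wpM2l ?sqr_ge0//.
      apply: (@le_trans _ _ ((N%:R * h) ^+ 2)); last by nra.
      by rewrite exprMn ler_wpM2l ?sqr_ge0// sqr_sin_le.
    have q0 : 0 <= \sum_j \sum_k nu (X^~ x) j * nu (X^~ x) k * C j k.
      by case: (GX.2 (nu (X^~ x))).
    rewrite ler_pdivrMr//.
    apply: (@le_trans _ _ (lam ^+ 2 * 4 * \sum_j \sum_k nu (X^~ x) j * nu (X^~ x) k * C j k)).
      by rewrite ler_wpM2r.
    rewrite (_ : _ * 2 = lam ^+ 2 * 4 * L); last by ring.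
    by rewrite ler_wpM2l// mulr_ge0// sqr_ge0.
  rewrite ge0_integral_mulr ?expR_ge0// mulrC [leRHS]EFinM muleC.
  rewrite lee_wpmul2r ?lee_fin ?expR_ge0//.
  rewrite ge0_integral_addr//; last 2 first.
  - by apply: measurable_funM => //; apply: measurable_sum => j; exact: measurableT_comp.
  - by move=> x; rewrite mulr_ge0// sumr_ge0// => j _; exact: expR_ge0.
  rewrite integral_cst//= probability_setT mule1 ge0_integral_mulr//; last 2 first.
  - by apply: measurable_sum => j; exact: measurableT_comp.
  - by move=> x; rewrite sumr_ge0// => j _; exact: expR_ge0.
  rewrite ge0_integral_sumr//; last by move=> j; exact: measurableT_comp.
  have -> : (1 + s * A)%:E = (1 + s%:E * \sum_j (expR (C j j / 2))%:E)%E by rewrite sumEFin.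
  apply: leeD2l; apply: lee_wpmul2l; first by rewrite lee_fin.
  apply: lee_sum => j _.
  have pick (a : J -> R) : \sum_k (k == j)%:R * a k = a j.
    by rewrite (bigD1 j)//= eqxx mul1r big1 ?addr0// => k /negbTE ->; rewrite mul0r.
  have := mgf (fun k => (k == j)%:R).
  have -> : (\int[P]_w (expR (\sum_k (k == j)%:R * X k w))%:E = \int[P]_w (expR (X j w))%:E)%E.
    by apply: eq_integral => w _; congr (expR _)%:E; exact: (pick (X^~ w)).
  move=> ->; rewrite (_ : \sum_j0 _ = C j j)//.
  transitivity (\sum_k (k == j)%:R * (\sum_i (i == j)%:R * C k i)).
    by apply: eq_bigr => k _; rewrite mulr_sumr; apply: eq_bigr => i _; rewrite mulrA.
  exact: etrans (pick _) (pick _).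
apply: (@le_trans _ _ (\int[(P \x P)%E]_w (\sum_(k < N) N%:R^-1 * F (rot_pair X (k%:R * h) ^~ w))%:E)%E).
  apply: ge0_ler_integral => //.
  - apply: measurableT_comp => //; apply: measurable_funM => //; apply: measurable_funB.
      exact: (measurableT_comp mf).
    exact: (measurableT_comp mf).
  - by apply: measurable_sum => k; exact: measurable_funM.
rewrite ge0_integral_sumr//; last 2 first.
- by move=> k; exact: measurable_funM.
- by move=> k w; rewrite mulr_ge0// invr_ge0 ltW.
apply: (@le_trans _ _ (\sum_(k < N) (N%:R^-1 * ((1 + s * A) * expR (2 * lam ^+ 2 * L)))%:E)%E).
  apply: lee_sum => k _; rewrite ge0_integral_mulr// ?invr_ge0 ?(ltW Nr0)//.
  by rewrite EFinM lee_wpmul2l// lee_fin invr_ge0 ltW.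
by rewrite sumEFin lee_fin big_const_ord iter_addr_0 -[leLHS]mulr_natl mulrA divff ?mul1r// gt_eqF.
Qed.

End step.

(* Two independent copies of X are joined by the rotations cos(theta) X + sin(theta) X'.
   Each small rotation increases f, by convexity, at most by a linear form in the rotated
   pair, whose law does not depend on theta. *)
Lemma mean_log_sum_concentration :
  (\int[P]_w (expR (lam * f (X^~ w)))%:E * \int[P]_w (expR (- (lam * f (X^~ w))))%:E
    <= (expR (2 * lam ^+ 2 * L))%:E)%E.
Proof.
have mf : measurable_fun setT (fun w => f (X^~ w)) by exact: measurable_mean_log_sum.
have m1 : measurable_fun setT (fun w => expR (lam * f (X^~ w))).
  by apply: measurableT_comp => //; exact: measurable_funM.
have m2 : measurable_fun setT (fun w => expR (- (lam * f (X^~ w)))).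
  by apply: measurableT_comp => //; apply: measurableT_comp => //; exact: measurable_funM.
set B := expR (2 * lam ^+ 2 * L).
have -> : (\int[P]_w (expR (lam * f (X^~ w)))%:E * \int[P]_w (expR (- (lam * f (X^~ w))))%:E =
    \int[(P \x P)%E]_w (expR (lam * (f (X^~ w.1) - f (X^~ w.2))))%:E)%E.
  rewrite fubini_tonelli1 /=; last 2 first.
  - apply/measurable_EFinP; apply: measurableT_comp => //; apply: measurable_funM => //.
    by apply: measurable_funB; exact: (measurableT_comp mf).
  - by move=> w; rewrite lee_fin expR_ge0.
  rewrite /fubini_F /=.
  rewrite muleC -ge0_integralZl//; last 2 first.
  - exact/measurable_EFinP.
  - by apply: integral_ge0 => x _; rewrite lee_fin expR_ge0.
  apply: eq_integral => x _; rewrite muleC -ge0_integral_mulr ?expR_ge0//.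
  by apply: eq_integral => y _; rewrite -expRD mulrBr.
apply/lee_addgt0Pr => e e0.
set A := \sum_j expR (C j j / 2).
have A0 : 0 <= A by rewrite sumr_ge0// => j _; exact: expR_ge0.
have B0 : 0 < B by exact: expR_gt0.
(* As 1 - cos h <= h^2 / 2 and pi / 2 <= 2, one has s N <= 2 lam; this N then gives both s <= 1 and
   s A B <= e. *)
pose N := (Num.truncn (2 * lam * (1 + A * B / e))).+1.
have Nr0 : (0 : R) < N%:R by rewrite ltr0n.
pose h : R := pi / 2 / N%:R.
pose s : R := N%:R * lam * (1 - cos h).
have sle : s * N%:R <= 2 * lam.
  have h0 : 0 <= h by rewrite !divr_ge0 ?pi_ge0.
  have Nh : N%:R * h = pi / 2 by rewrite /h mulrC divfK// gt_eqF.
  have := onem_cos_le h0; rewrite ler_pdivlMr// => hc.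
  have p2 := pihalf_lt2 R.
  have : (N%:R * h) ^+ 2 <= 4 by rewrite Nh; have := pi_ge0 R; nra.
  have : lam * N%:R ^+ 2 * ((1 - cos h) * 2) <= lam * N%:R ^+ 2 * h ^+ 2.
    by rewrite ler_wpM2l// mulr_ge0// sqr_ge0.
  move=> h1 h2; have : lam * (N%:R * h) ^+ 2 <= lam * 4 by rewrite ler_wpM2l.
  by rewrite /s; nra.
have AB0 : 0 <= A * B / e by rewrite !mulr_ge0 ?invr_ge0 ?(ltW e0) ?(ltW B0).
have NN : 2 * lam * (1 + A * B / e) <= N%:R by apply/ltW; exact: truncnS_gt.
have l2 : 0 <= 2 * lam by rewrite mulr_ge0.
have s1 : s <= 1.
  rewrite -(ler_pM2r Nr0) mul1r (le_trans sle)// (le_trans _ NN)//.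
  by rewrite ler_peMr// lerDl.
have sAB : s * A * B <= e.
  rewrite -(ler_pM2r Nr0) (_ : s * A * B * N%:R = s * N%:R * (A * B)); last by ring.
  apply: (@le_trans _ _ (2 * lam * (A * B))); first by rewrite ler_wpM2r// mulr_ge0// ltW.
  have -> : 2 * lam * (A * B) = e * (2 * lam * (A * B / e)) by field; rewrite gt_eqF.
  rewrite (ler_wpM2l (ltW e0))// (le_trans _ NN)// ler_wpM2l//.
  by rewrite lerDr.
have := @mean_log_sum_step N isT s1.
rewrite -/h -/s -/A -/B => /le_trans; apply.
by rewrite -EFinD lee_fin mulrDl mul1r lerD2l.
Qed.

End concentration.
End log_sum_exp.

(** * Gibbs moments of log-correlated fields on finite sets *)

Section tangent_power_sum.
Variable R : realType.

(** Subadditivity of the power s, then concavity: each power of u k is replaced by its tangent at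
    exp(mu k). The result is affine in u k, so with a random mu k it plays the part of Jensen's
    inequality conditionally on mu k. *)
Lemma expR_ln_sum_le (K : finType) (u mu : K -> R) (S s : R) :
  0 <= s <= 1 -> 0 < S -> S <= \sum_k u k -> (forall k, 0 <= u k) ->
  expR (s * ln S) <= \sum_k expR (s * mu k) * (1 - s + s * (u k * expR (- mu k))).
Proof.
move=> /andP[s0 s1] S0 Su u0.
set S' := \sum_k u k in Su; have S'0 : 0 < S' by exact: lt_le_trans Su.
apply: (@le_trans _ _ (expR (s * ln S'))).
  by rewrite ler_expR ler_wpM2l// ler_ln ?posrE.
have -> : expR (s * ln S') = \sum_k u k * expR ((s - 1) * ln S').
  by rewrite -mulr_suml -/S' -{2}(lnK S'0) -expRD; congr expR; ring.
apply: ler_sum => k _; have := u0 k; rewrite le_eqVlt => /predU1P[<-|uk0].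
  by rewrite !mul0r mulr0 addr0 mulr_ge0 ?expR_ge0// subr_ge0.
have ukS : u k <= S' by rewrite /S' (bigD1 k)//= lerDl sumr_ge0.
apply: (@le_trans _ _ (expR (s * ln (u k)))).
  rewrite -{1}(lnK uk0) -expRD ler_expR.
  have : ln (u k) <= ln S' by rewrite ler_ln ?posrE.
  nra.
rewrite (_ : s * ln (u k) = s * mu k + s * (ln (u k) - mu k)); last by ring.
rewrite expRD ler_wpM2l ?expR_ge0//.
apply: le_trans (expR_le_onem _ _) _; first by rewrite s0 s1.
by rewrite expRD lnK.
Qed.

End tangent_power_sum.

(* A Gaussian space, indexed by the vector space [V] of formal linear combinations. *)
Record gaussian_space d (Om : measurableType d) (R : realType) (P : probability Om R)
    (V : lmodType R) (ev : V -> Om -> R) (c : V -> V -> R) : Prop := GaussianSpace {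
  gs_evP : forall a u v w, ev (a *: u + v) w = a * ev u w + ev v w;
  gs_cP : forall a u v z, c (a *: u + v) z = a * c u z + c v z;
  gs_csym : forall u v, c u v = c v u;
  gs_meas : forall v, measurable_fun setT (ev v);
  gs_mgf : forall v, (\int[P]_w (expR (ev v w))%:E = (expR (c v v / 2))%:E)%E }.

Section gaussian_space_theory.
Context d (Om : measurableType d) (R : realType) (P : probability Om R).
Variables (V : lmodType R) (ev : V -> Om -> R) (c : V -> V -> R).
Hypothesis GS : gaussian_space P ev c.

Lemma gs_evD u v w : ev (u + v) w = ev u w + ev v w.
Proof. by rewrite -{1}[u]scale1r (gs_evP GS) mul1r. Qed.

Lemma gs_ev0 w : ev 0 w = 0.
Proof. by have := gs_evD 0 0 w; rewrite addr0; lra. Qed.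

Lemma gs_evZ a u w : ev (a *: u) w = a * ev u w.
Proof. by rewrite -[a *: u]addr0 (gs_evP GS) gs_ev0 addr0. Qed.

Lemma gs_evB u v w : ev (u - v) w = ev u w - ev v w.
Proof. by rewrite gs_evD -scaleN1r gs_evZ mulN1r. Qed.

Lemma gs_cDl u v z : c (u + v) z = c u z + c v z.
Proof. by rewrite -{1}[u]scale1r (gs_cP GS) mul1r. Qed.

Lemma gs_c0l z : c 0 z = 0.
Proof. by have := gs_cDl 0 0 z; rewrite addr0; lra. Qed.

Lemma gs_cZl a u z : c (a *: u) z = a * c u z.
Proof. by rewrite -[a *: u]addr0 (gs_cP GS) gs_c0l addr0. Qed.

Lemma gs_cDr u v z : c z (u + v) = c z u + c z v.
Proof. by rewrite !(gs_csym GS z) gs_cDl. Qed.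

Lemma gs_cZr a u z : c z (a *: u) = a * c z u.
Proof. by rewrite !(gs_csym GS z) gs_cZl. Qed.

Lemma gs_cNl u z : c (- u) z = - c u z.
Proof. by rewrite -scaleN1r gs_cZl mulN1r. Qed.

Lemma gs_cNr u z : c z (- u) = - c z u.
Proof. by rewrite -scaleN1r gs_cZr mulN1r. Qed.

Definition gs_bilinE := (gs_cDl, gs_cDr, gs_cZl, gs_cZr, gs_cNl, gs_cNr).

Lemma gs_measE v : measurable_fun setT (fun w => expR (ev v w)).
Proof. by apply: measurableT_comp => //; exact: (gs_meas GS). Qed.

End gaussian_space_theory.

Section multiscale.
Context d (Om : measurableType d) (R : realType) (P : probability Om R).
Variables (V : lmodType R) (ev : V -> Om -> R) (c : V -> V -> R).

(* [x i] is the field at the site [i], [y k i] its average at scale [exp (- tau k t)]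
   around [i], and [Sh k i] a shell of sites at distance of order [exp (- tau k t)] of [i]. *)
Record multiscale (I : finType) (n : nat) (x : I -> V) (tau : 'I_n -> R) (y : 'I_n -> I -> V)
    (Sh : 'I_n -> I -> {set I}) (dd t dl : R) : Prop := Multiscale {
  ms_t : 0 < t;
  ms_dl : 0 <= dl <= 1;
  ms_dd : 0 <= dd;
  ms_tau : forall k, 0 <= tau k <= 1;
  ms_xx : forall i, `|c (x i) (x i) - t| <= dl * t;
  ms_xsh : forall k i j, j \in Sh k i -> c (x i) (x j) <= tau k * t + dl * t;
  ms_xy : forall k i j, j \in Sh k i -> `|c (x j) (y k i) - tau k * t| <= dl * t;
  ms_xyi : forall k i, `|c (x i) (y k i) - tau k * t| <= dl * t;
  ms_yy : forall k i, `|c (y k i) (y k i) - tau k * t| <= dl * t;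
  ms_cover : forall i j, exists k, j \in Sh k i;
  ms_card : forall k i, #|Sh k i|%:R <= expR (t * (dd * (1 - tau k) + dl));
  ms_n : n%:R <= expR (dl * t) }.

Definition partition_sum (I : finType) (x : I -> V) (A : {set I}) (beta : R) (w : Om) : R :=
  \sum_(j in A) expR (beta * ev (x j) w).

Hypothesis GS : gaussian_space P ev c.
Variables (I : finType) (n : nat) (x : I -> V) (tau : 'I_n -> R) (y : 'I_n -> I -> V)
    (Sh : 'I_n -> I -> {set I}) (dd t dl : R).
Hypothesis MS : multiscale x tau y Sh dd t dl.

Let t0 : 0 < t. Proof. exact: ms_t MS. Qed.
Let dl0 : 0 <= dl. Proof. by case/andP: (ms_dl MS). Qed.

Lemma partition_sum_gt0 (A : {set I}) beta i w : i \in A -> 0 < partition_sum x A beta w.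
Proof.
move=> iA; rewrite /partition_sum (bigD1 i)//= ltr_pwDl ?expR_gt0//.
by rewrite sumr_ge0// => j _; exact: expR_ge0.
Qed.

Lemma measurable_partition_sum (A : {set I}) beta : measurable_fun setT (partition_sum x A beta).
Proof.
rewrite (_ : partition_sum _ _ _ = fun w => \sum_j (if j \in A then expR (beta * ev (x j) w) else 0)); last first.
  by apply/funext => w; rewrite /partition_sum big_mkcond.
apply: measurable_sum => j; case: (j \in A) => //; apply: measurableT_comp => //.
by apply: measurable_funM => //; exact: (gs_meas GS).
Qed.

Let two_bounds (k : 'I_n) (a : R) : `|a - tau k * t| <= dl * t ->
  a <= tau k * t + dl * t /\ tau k * t - dl * t <= a.
Proof. by rewrite ler_norml => /andP[h1 h2]; split; lra. Qed.

Section fractional_moment.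
Variables (i : I) (ga beta s : R).
Hypotheses (ga0 : 0 <= ga) (be0 : 0 <= beta) (s01 : 0 <= s <= 1).
Hypothesis gabe : ga * beta <= dd + beta ^+ 2 / 2.

Let s0 : 0 <= s. Proof. by case/andP: s01. Qed.
Let s1 : s <= 1. Proof. by case/andP: s01. Qed.

(** [a k] is the tilt by ga X_i + s beta Y_k that remains once the power s is linearised at exp(b k
    + beta Y_k). [b k] estimates the logarithm of the sum over the shell of E exp(beta (X_j - Y_k)),
    with room for the errors in dl. *)
Let a k := ga *: x i + (s * beta) *: y k i.
Let b k := t * (dd * (1 - tau k) + beta ^+ 2 * (1 - tau k) / 2 + dl * (1 + 4 * beta ^+ 2 + 2 * beta * ga)).

(** The increment x j - y k i has covariance at most 2 dl t with both x i and y k i, and variance at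
    most about (1 - tau k) t: the tilt [a k] does not raise it beyond the errors. *)
Let inner k j : j \in Sh k i ->
  c (a k + beta *: (x j - y k i)) (a k + beta *: (x j - y k i)) / 2 <=
  c (a k) (a k) / 2 + (b k - t * (dd * (1 - tau k) + dl)).
Proof.
move=> jS; set z := x j - y k i.
have -> : c (a k + beta *: z) (a k + beta *: z) / 2 =
    c (a k) (a k) / 2 + (beta * c z (a k) + beta ^+ 2 / 2 * c z z).
  have gen (u v : V) : c (u + beta *: v) (u + beta *: v) / 2 =
      c u u / 2 + (beta * c v u + beta ^+ 2 / 2 * c v v).
    by rewrite !(gs_bilinE GS) !(gs_csym GS u v); field.
  exact: gen.
rewrite lerD2l.
have [u1 l1] := two_bounds (ms_xy MS jS); have [u2 l2] := two_bounds (ms_xyi MS k i).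
have [u3 l3] := two_bounds (ms_yy MS k i).
have h4 := ms_xsh MS jS.
have := ms_xx MS j; rewrite ler_norml => /andP[_ h5].
have z1 : c z (x i) <= 2 * dl * t.
  rewrite /z !(gs_bilinE GS) (gs_csym GS (x j)) (gs_csym GS (y k i)); lra.
have z2 : c z (y k i) <= 2 * dl * t.
  by rewrite /z !(gs_bilinE GS); lra.
have z3 : c z z <= t * (1 - tau k) + 4 * dl * t.
  by rewrite /z !(gs_bilinE GS) (gs_csym GS (y k i) (x j)); lra.
clearbody z.
have z4 : c z (a k) <= (ga + beta) * (2 * dl * t).
  rewrite /a !(gs_bilinE GS).
  have : ga * c z (x i) <= ga * (2 * dl * t) by rewrite ler_wpM2l.
  have dt0 : 0 <= 2 * dl * t by rewrite mulr_ge0 ?mulr_ge0// ltW.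
  have : (s * beta) * c z (y k i) <= beta * (2 * dl * t).
    apply: (@le_trans _ _ (s * beta * (2 * dl * t))); first by rewrite ler_wpM2l ?mulr_ge0.
    by rewrite ler_wpM2r// ler_piMl.
  lra.
have : beta * c z (a k) <= beta * ((ga + beta) * (2 * dl * t)) by rewrite ler_wpM2l.
have : beta ^+ 2 / 2 * c z z <= beta ^+ 2 / 2 * (t * (1 - tau k) + 4 * dl * t).
  by rewrite ler_wpM2l// divr_ge0// sqr_ge0.
rewrite /b; lra.
Qed.

(** [gabe] makes the shell tau = 0 dominate, up to the term s^2 beta^2 / 2. The -1 in front of dl
    keeps a factor exp(dl t) in reserve for the number of shells. *)
Let total k : s * b k + c (a k) (a k) / 2 <=
  t * (ga ^+ 2 / 2 + s * (dd + beta ^+ 2 / 2) + s ^+ 2 * beta ^+ 2 / 2 + (5 * (ga + beta + 1) ^+ 2 - 1) * dl).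
Proof.
have [u2 l2] := two_bounds (ms_xyi MS k i).
have [u3 l3] := two_bounds (ms_yy MS k i).
have := ms_xx MS i; rewrite ler_norml => /andP[_ h5].
have /andP[ta0 ta1] := ms_tau MS k.
have sb0 : 0 <= s * beta by rewrite mulr_ge0.
have e1 : ga ^+ 2 * c (x i) (x i) <= ga ^+ 2 * (t + dl * t) by rewrite ler_wpM2l ?sqr_ge0//; lra.
have e2 : ga * (s * beta) * c (x i) (y k i) <= ga * (s * beta) * (tau k * t + dl * t).
  by rewrite ler_wpM2l ?mulr_ge0.
have e3 : (s * beta) ^+ 2 * c (y k i) (y k i) <= (s * beta) ^+ 2 * (tau k * t + dl * t).
  by rewrite ler_wpM2l ?sqr_ge0.
have -> : c (a k) (a k) = ga ^+ 2 * c (x i) (x i) + 2 * (ga * (s * beta) * c (x i) (y k i)) +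
    (s * beta) ^+ 2 * c (y k i) (y k i).
  by rewrite /a !(gs_bilinE GS) (gs_csym GS (y k i)); ring.
have f1 : s * tau k * t * (ga * beta) <= s * tau k * t * (dd + beta ^+ 2 / 2).
  by rewrite ler_wpM2l// mulr_ge0 ?mulr_ge0// ltW.
have f2 : s ^+ 2 * beta ^+ 2 * t * tau k <= s ^+ 2 * beta ^+ 2 * t * 1.
  by rewrite ler_wpM2l// mulr_ge0 ?mulr_ge0 ?sqr_ge0// ltW.
have dt : 0 <= dl * t by rewrite mulr_ge0// ltW.
have f3 : dl * t * (ga ^+ 2 / 2 + ga * (s * beta) + (s * beta) ^+ 2 / 2 +
    s * (1 + 4 * beta ^+ 2 + 2 * beta * ga)) <= dl * t * (5 * (ga + beta + 1) ^+ 2 - 1).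
  rewrite ler_wpM2l//.
  have sb : s * beta <= beta by rewrite ler_piMl.
  have g1 : ga * (s * beta) <= ga * beta by rewrite ler_wpM2l.
  have g2 : (s * beta) ^+ 2 <= beta ^+ 2 by rewrite ler_sqr ?nnegrE.
  have g3 : 0 <= 1 + 4 * beta ^+ 2 + 2 * beta * ga.
    by have := sqr_ge0 beta; have := mulr_ge0 be0 ga0; lra.
  have g4 : s * (1 + 4 * beta ^+ 2 + 2 * beta * ga) <= 1 + 4 * beta ^+ 2 + 2 * beta * ga.
    by rewrite ler_piMl.
  have q1 := sqr_ge0 beta; have q2 := mulr_ge0 be0 ga0; have q3 := sqr_ge0 ga.
  have -> : (ga + beta + 1) ^+ 2 = ga ^+ 2 + beta ^+ 2 + 1 + 2 * (beta * ga) + 2 * ga + 2 * beta by ring.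
  move: ga0 be0 => ? ?; lra.
rewrite /b; lra.
Qed.

Let mu k (w : Om) := b k + beta * ev (y k i) w.

(** To first order in s the exponent is that of exp(ga X_i) times a power s of the typical size
    exp(t (dd + beta^2 / 2)) of the sum; the term in s^2 is an affordable loss because s will be
    small. *)
Lemma tilted_fractional_moment :
  (\int[P]_w (expR (ga * ev (x i) w + s * ln (partition_sum x [set: I]%SET beta w)))%:E <=
  (expR (t * (ga ^+ 2 / 2 + s * (dd + beta ^+ 2 / 2) + s ^+ 2 * beta ^+ 2 / 2 +
     5 * (ga + beta + 1) ^+ 2 * dl)))%:E)%E.
Proof.
pose g k (w : Om) := (1 - s) * expR (s * b k) * expR (ev (a k) w) +
  s * expR (s * b k - b k) * \sum_(j in Sh k i) expR (ev (a k + beta *: (x j - y k i)) w).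
have mg k : measurable_fun setT (g k).
  apply: measurable_funD; apply: measurable_funM => //; first exact: (gs_measE GS).
  rewrite (_ : (fun w => _) = fun w => \sum_j (if j \in Sh k i then expR (ev (a k + beta *: (x j - y k i)) w) else 0)); last first.
    by apply/funext => w; rewrite big_mkcond.
  by apply: measurable_sum => j; case: (j \in _) => //; exact: (gs_measE GS).
have g0 k w : 0 <= g k w.
  apply: addr_ge0; first by rewrite !mulr_ge0 ?expR_ge0 ?subr_ge0.
  by rewrite !mulr_ge0 ?expR_ge0// sumr_ge0// => j _; exact: expR_ge0.
apply: (@le_trans _ _ (\int[P]_w (\sum_k g k w)%:E)%E).
  apply: ge0_ler_integral => //.
  - apply: measurableT_comp => //; apply: measurable_funD.
      by apply: measurable_funM => //; exact: (gs_meas GS).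
    apply: measurable_funM => //; apply: measurableT_comp; first exact: measurable_ln.
    exact: measurable_partition_sum.
  - exact: measurable_sum.
  move=> w _; rewrite expRD.
  pose u k := partition_sum x (Sh k i) beta w.
  have u0 k : 0 <= u k by rewrite /u sumr_ge0// => j _; exact: expR_ge0.
  have Su : partition_sum x [set: I]%SET beta w <= \sum_k u k.
    rewrite /u /partition_sum.
    under [leRHS]eq_bigr do rewrite big_mkcond; rewrite exchange_big/= big_mkcond/=.
    apply: ler_sum => j _; rewrite inE; have [k jk] := ms_cover MS i j.
    rewrite (bigD1 k)//= jk lerDl sumr_ge0// => l _; case: ifP => // _; exact: expR_ge0.
  have S0 : 0 < partition_sum x [set: I]%SET beta w by apply: (@partition_sum_gt0 _ _ i); rewrite inE.
  have := expR_ln_sum_le (mu ^~ w) s01 S0 Su u0.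
  rewrite -(ler_pM2l (expR_gt0 (ga * ev (x i) w))) => /le_trans; apply.
  rewrite mulr_sumr; apply: ler_sum => k _.
  rewrite le_eqVlt; apply/orP; left; apply/eqP.
  have E1 : expR (ga * ev (x i) w) * expR (s * mu k w) = expR (s * b k) * expR (ev (a k) w).
    by rewrite -!expRD /mu /a (gs_evD GS) !(gs_evZ GS); congr expR; ring.
  have E2 : expR (ga * ev (x i) w) * expR (s * mu k w) * (u k * expR (- mu k w)) =
      expR (s * b k - b k) * \sum_(j in Sh k i) expR (ev (a k + beta *: (x j - y k i)) w).
    rewrite /u /partition_sum mulr_suml !mulr_sumr; apply: eq_bigr => j _.
    by rewrite -!expRD /mu /a !(gs_evD GS) !(gs_evZ GS) (gs_evB GS); congr expR; ring.
  have -> : g k w = (1 - s) * (expR (s * b k) * expR (ev (a k) w)) + s * (expR (s * b k - b k) *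
      \sum_(j in Sh k i) expR (ev (a k + beta *: (x j - y k i)) w)) by rewrite /g -!mulrA.
  by rewrite -E1 -E2; ring.
rewrite ge0_integral_sumr//.
have gk k : (\int[P]_w (g k w)%:E <= (expR (s * b k + c (a k) (a k) / 2))%:E)%E.
  have m1 j : measurable_fun setT (fun w => if j \in Sh k i then expR (ev (a k + beta *: (x j - y k i)) w) else 0).
    by case: (j \in _) => //; exact: (gs_measE GS).
  have p1 j w : 0 <= (if j \in Sh k i then expR (ev (a k + beta *: (x j - y k i)) w) else 0).
    by case: ifP => // _; exact: expR_ge0.
  have c1 : 0 <= (1 - s) * expR (s * b k) by rewrite mulr_ge0 ?expR_ge0 ?subr_ge0.
  have c2 : 0 <= s * expR (s * b k - b k) by rewrite mulr_ge0 ?expR_ge0.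
  have c3 w : 0 <= \sum_j (if j \in Sh k i then expR (ev (a k + beta *: (x j - y k i)) w) else 0).
    by rewrite sumr_ge0.
  rewrite /g; under eq_integral do rewrite (big_mkcond (fun j => j \in Sh k i)).
  rewrite ge0_integral_addr//; last 4 first.
  - by apply: measurable_funM => //; exact: (gs_measE GS).
  - by apply: measurable_funM => //; exact: measurable_sum.
  - by move=> w; rewrite mulr_ge0 ?expR_ge0.
  - by move=> w; rewrite mulr_ge0.
  rewrite ge0_integral_mulr//; last exact: (gs_measE GS).
  rewrite ge0_integral_mulr//; last exact: measurable_sum.
  rewrite ge0_integral_sumr// (gs_mgf GS).
  apply: (@le_trans _ _ (((1 - s) * expR (s * b k) * expR (c (a k) (a k) / 2))%:E +
    (s * expR (s * b k - b k) * (expR (c (a k) (a k) / 2 + b k)))%:E)%E).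
    rewrite -EFinM leeD2l// [leRHS]EFinM; apply: lee_wpmul2l; first by rewrite lee_fin.
    apply: (@le_trans _ _ (\sum_j (if j \in Sh k i then expR (c (a k) (a k) / 2 + (b k - t * (dd * (1 - tau k) + dl))) else 0)%:E)%E).
      apply: lee_sum => j _; case: ifPn => jS; last by rewrite integral0.
      by rewrite (gs_mgf GS) lee_fin ler_expR inner.
    rewrite sumEFin lee_fin -big_mkcond/= sumr_const -[leLHS]mulr_natl.
    apply: (@le_trans _ _ (expR (t * (dd * (1 - tau k) + dl)) * expR (c (a k) (a k) / 2 + (b k - t * (dd * (1 - tau k) + dl))))).
      by rewrite ler_wpM2r ?expR_ge0// (ms_card MS).
    by rewrite -expRD ler_expR; lra.
  rewrite -EFinD lee_fin -!mulrA -!expRD.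
  rewrite (_ : s * b k - b k + (c (a k) (a k) / 2 + b k) = s * b k + c (a k) (a k) / 2); last by ring.
  by rewrite -mulrDl subrK mul1r.
apply: (@le_trans _ _ (\sum_(k < n) (expR (t *
     (ga ^+ 2 / 2 + s * (dd + beta ^+ 2 / 2) + s ^+ 2 * beta ^+ 2 / 2 +
      (5 * (ga + beta + 1) ^+ 2 - 1) * dl)))%:E)%E).
  by apply: lee_sum => k _; apply: le_trans (gk k) _; rewrite lee_fin ler_expR total.
rewrite sumEFin lee_fin big_const_ord iter_addr_0 -[leLHS]mulr_natl.
apply: (@le_trans _ _ (expR (dl * t) * expR (t *
     (ga ^+ 2 / 2 + s * (dd + beta ^+ 2 / 2) + s ^+ 2 * beta ^+ 2 / 2 +
      (5 * (ga + beta + 1) ^+ 2 - 1) * dl)))).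
  by rewrite ler_wpM2r ?expR_ge0// (ms_n MS).
by rewrite -expRD ler_expR; lra.
Qed.

End fractional_moment.
End multiscale.

Section reversed_jensen.
Context d (Om : measurableType d) (R : realType) (P : probability Om R).

(* Jensen's inequality for [exp (- r Y)] under the measure of density [exp U]. *)
Lemma expR_reversed_jensen (U Y : Om -> R) (A r : R) :
  measurable_fun setT U -> measurable_fun setT Y -> 0 <= r ->
  (\int[P]_w (expR (U w))%:E = A%:E)%E ->
  (\int[P]_w (expR (U w + Y w))%:E <= A%:E)%E ->
  (A%:E <= \int[P]_w (expR (U w - r * Y w))%:E)%E.
Proof.
move=> mU mY r0 EU EY.
have m1 : measurable_fun setT (fun w => expR (U w - r * Y w)).
  by apply: measurableT_comp => //; apply: measurable_funB => //; exact: measurable_funM.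
have m2 : measurable_fun setT (fun w => expR (U w + Y w)).
  by apply: measurableT_comp => //; exact: measurable_funD.
have m3 : measurable_fun setT (fun w => expR (U w)) by exact: measurableT_comp.
(* Pointwise 1 + r <= exp(- r Y) + r exp Y, both exponentials lying above their tangents at 0. *)
have H : ((1 + r)%:E * \int[P]_w (expR (U w))%:E <=
    \int[P]_w (expR (U w - r * Y w))%:E + r%:E * \int[P]_w (expR (U w + Y w))%:E)%E.
  rewrite -!ge0_integral_mulr ?addr_ge0//; try (by move=> w; exact: expR_ge0).
  rewrite -ge0_integral_addr//; last 2 first.
  - exact: measurable_funM.
  - by move=> w; rewrite mulr_ge0 ?expR_ge0.
  apply: ge0_ler_integral => //.
  - exact: measurable_funM.
  - by apply: measurable_funD => //; exact: measurable_funM.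
  - by move=> w _; rewrite mulr_ge0 ?expR_ge0 ?addr_ge0.
  move=> w _; rewrite !expRD -mulrCA -mulrDr mulrC ler_wpM2l ?expR_ge0//.
  have h1 := expR_ge1Dx (- (r * Y w)); have h2 := expR_ge1Dx (Y w).
  have h3 : r * (1 + Y w) <= r * expR (Y w) by rewrite ler_wpM2l.
  lra.
have : (\int[P]_w (expR (U w - r * Y w))%:E + r%:E * \int[P]_w (expR (U w + Y w))%:E <=
    \int[P]_w (expR (U w - r * Y w))%:E + (r * A)%:E)%E.
  by rewrite leeD2l// EFinM lee_wpmul2l// lee_fin.
move/(le_trans H); rewrite EU -EFinM.
case: (\int[P]_w _)%E => [z| |]; rewrite -?EFinD ?lee_fin ?leey//.
by lra.
Qed.

End reversed_jensen.

(** * Lower bound for Gibbs moments *)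

Section lower_bound.
Context d (Om : measurableType d) (R : realType) (P : probability Om R).
Variables (V : lmodType R) (ev : V -> Om -> R) (c : V -> V -> R).
Hypothesis GS : gaussian_space P ev c.
Variables (I : finType) (n : nat) (x : I -> V) (tau : 'I_n -> R) (y : 'I_n -> I -> V)
    (Sh : 'I_n -> I -> {set I}) (dd t dl : R).
Hypothesis MS : multiscale c x tau y Sh dd t dl.

Definition participation (q beta : R) (w : Om) : R :=
  \sum_i expR (q * (beta * ev (x i) w - ln (partition_sum ev x [set: I]%SET beta w))).

Lemma measurable_participation q beta : measurable_fun setT (participation q beta).
Proof.
apply: measurable_sum => i; apply: measurableT_comp => //; apply: measurable_funM => //.
apply: measurable_funB.
  by apply: measurable_funM => //; exact: (gs_meas GS).
by apply: measurableT_comp; [exact: measurable_ln|exact: (measurable_partition_sum GS)].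
Qed.

(** The density exp(q0 beta X_i) is perturbed by h times the missing exponent with reversed sign; an
    upper bound on the perturbed moment becomes, by reversed Jensen with r = 1/h, a lower bound for
    the whole Gibbs weight. The price is h q^2 beta^2 from the terms of second order and dl / h from
    dividing the errors by h. *)
Lemma participation_lower (q q0 beta h : R) :
  0 <= beta -> 0 <= q0 <= q -> q0 * beta ^+ 2 <= dd + beta ^+ 2 / 2 ->
  0 < h <= 1 -> q * h <= 1 -> h * (q - q0) <= q0 ->
  expR (t * (dd - dl)) <= #|I|%:R ->
  ((expR (t * (dd + q0 ^+ 2 * beta ^+ 2 / 2 + q0 * (q - q0) * beta ^+ 2 - q * dd -
     q * beta ^+ 2 / 2 - (h * q ^+ 2 * beta ^+ 2 + 6 * (q * beta + beta + 1) ^+ 2 * dl / h))))%:E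
   <= \int[P]_w (participation q beta w)%:E)%E.
Proof.
move=> be0 /andP[q00 q0q] q0be /andP[h0 h1] qh hq cardI.
have hn0 : h != 0 by rewrite gt_eqF.
have t0 := ms_t MS; have /andP[dl0 dl1] := ms_dl MS.
have q0' : 0 <= q by exact: le_trans q0q.
set ga := (q0 - h * (q - q0)) * beta.
have ga0 : 0 <= ga by rewrite mulr_ge0// subr_ge0.
have hq0 : 0 <= h * (q - q0) by rewrite mulr_ge0 ?(ltW h0)// subr_ge0.
have gale : ga <= q0 * beta by rewrite ler_wpM2r// gerBl.
have gabe : ga * beta <= dd + beta ^+ 2 / 2.
  by apply: le_trans q0be; rewrite expr2 mulrA ler_wpM2r.
have s01 : 0 <= q * h <= 1 by rewrite qh mulr_ge0// ltW.
set Z := partition_sum ev x [set: I]%SET beta.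
have mlnZ : measurable_fun setT (fun w => ln (Z w)).
  by apply: measurableT_comp; [exact: measurable_ln|exact: (measurable_partition_sum GS)].
set B := t * (dd + q0 ^+ 2 * beta ^+ 2 / 2 + q0 * (q - q0) * beta ^+ 2 - q * dd -
     q * beta ^+ 2 / 2 - (h * q ^+ 2 * beta ^+ 2 + 6 * (q * beta + beta + 1) ^+ 2 * dl / h)).
have one i : ((expR (B - t * (dd - dl)))%:E <=
    \int[P]_w (expR (q * (beta * ev (x i) w - ln (Z w))))%:E)%E.
  have TM := tilted_fractional_moment GS MS i ga0 be0 s01 gabe.
  set L1 := t * _ in TM.
  set A := c ((q0 * beta) *: x i) ((q0 * beta) *: x i) / 2.
  have AE : A = (q0 * beta) ^+ 2 * c (x i) (x i) / 2.
    by rewrite /A !(gs_bilinE GS) expr2 !mulrA.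
  pose U w := ev ((q0 * beta) *: x i) w.
  (* U + Y is the exponent in [TM] shifted by A - L1, while U - Y / h is q (beta X_i - ln Z) plus
     the constant (L1 - A) / h. *)
  pose Y w := (- (h * (q - q0)) * beta) * ev (x i) w + (q * h) * ln (Z w) - (L1 - A).
  have mU : measurable_fun setT U by exact: (gs_meas GS).
  have mY : measurable_fun setT Y.
    apply: measurable_funB => //; apply: measurable_funD; apply: measurable_funM => //.
    exact: (gs_meas GS).
  have EU : (\int[P]_w (expR (U w))%:E = (expR A)%:E)%E by rewrite (gs_mgf GS).
  have mTM : measurable_fun setT (fun w => expR (ga * ev (x i) w + q * h * ln (Z w))).
    apply: measurableT_comp => //; apply: measurable_funD; apply: measurable_funM => //.
    exact: (gs_meas GS).
  have EY : (\int[P]_w (expR (U w + Y w))%:E <= (expR A)%:E)%E.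
    rewrite (eq_integral (fun w => (expR (A - L1) * expR (ga * ev (x i) w + q * h * ln (Z w)))%:E)%E); last first.
      by move=> w _; rewrite -expRD /U /Y (gs_evZ GS) /ga; congr (expR _)%:E; ring.
    rewrite ge0_integral_mulr ?expR_ge0//.
    apply: (@le_trans _ _ ((expR (A - L1))%:E * (expR L1)%:E)%E).
      by rewrite lee_wpmul2l// lee_fin expR_ge0.
    by rewrite -EFinM -expRD subrK.
  have := expR_reversed_jensen mU mY (ltW (_ : 0 < h^-1)) EU EY.
  rewrite invr_gt0 => /(_ h0) J.
  apply: (@le_trans _ _ ((expR (- ((L1 - A) / h)))%:E * (expR A)%:E)%E).
    rewrite -EFinM lee_fin -expRD ler_expR.
    have := ms_xx MS i; rewrite ler_norml => /andP[lc _].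
    have lA : (q0 * beta) ^+ 2 * (t - dl * t) / 2 <= A.
      rewrite AE ler_wpM2r ?invr_ge0// ler_wpM2l ?sqr_ge0//; lra.
    have C1 : 5 * (ga + beta + 1) ^+ 2 <= 5 * (q * beta + beta + 1) ^+ 2.
      have qb0 : 0 <= q * beta by rewrite mulr_ge0.
      have g1 : 0 <= ga + beta + 1 by move: ga0 be0 => ? ?; lra.
      have g2 : 0 <= q * beta + beta + 1 by move: qb0 be0 => ? ?; lra.
      rewrite ler_wpM2l// ler_sqr ?nnegrE//.
      by rewrite !lerD2r (le_trans gale)// ler_wpM2r.
    have td0 : 0 <= t * dl by rewrite mulr_ge0// ltW.
    have C2 : 5 * (ga + beta + 1) ^+ 2 * (t * dl) <= 5 * (q * beta + beta + 1) ^+ 2 * (t * dl).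
      by rewrite ler_wpM2r.
    rewrite -(ler_pM2r h0).
    have -> : (- ((L1 - A) / h) + A) * h = A * (1 + h) - L1 by field.
    have A2 : (q0 * beta) ^+ 2 * (t - dl * t) / 2 * (1 + h) <= A * (1 + h).
      by rewrite ler_wpM2r// addr_ge0// ltW.
    apply: le_trans (lerB A2 (lexx L1)).
    have -> : (B - t * (dd - dl)) * h = t * h * (q0 ^+ 2 * beta ^+ 2 / 2 + q0 * (q - q0) * beta ^+ 2 - q * dd -
       q * beta ^+ 2 / 2 - h * q ^+ 2 * beta ^+ 2) + t * dl * (h - 6 * (q * beta + beta + 1) ^+ 2).
      by rewrite /B; field.
    have -> : (q0 * beta) ^+ 2 * (t - dl * t) / 2 * (1 + h) - L1 =
       t * h * (q0 ^+ 2 * beta ^+ 2 / 2 + q0 * (q - q0) * beta ^+ 2 - q * dd -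
       q * beta ^+ 2 / 2 - h * ((q - q0) ^+ 2 + q ^+ 2) * beta ^+ 2 / 2)
       - t * dl * ((q0 * beta) ^+ 2 / 2 * (1 + h) + 5 * (ga + beta + 1) ^+ 2).
      by rewrite /L1 /ga; field.
    have K1 : t * h * (h * ((q - q0) ^+ 2 + q ^+ 2) * beta ^+ 2 / 2) <= t * h * (h * q ^+ 2 * beta ^+ 2).
      have e0 : (q - q0) ^+ 2 <= q ^+ 2 by rewrite ler_sqr ?nnegrE ?subr_ge0// gerBl.
      have e1 := ler_wpM2r (sqr_ge0 beta) e0.
      have e2 : ((q - q0) ^+ 2 + q ^+ 2) * beta ^+ 2 / 2 <= q ^+ 2 * beta ^+ 2 by lra.
      have thh : 0 <= t * h * h by rewrite !mulr_ge0// ltW.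
      by have := ler_wpM2l thh e2; rewrite !mulrA.
    have K2 : (q0 * beta) ^+ 2 / 2 * (1 + h) + 5 * (ga + beta + 1) ^+ 2 + h <= 6 * (q * beta + beta + 1) ^+ 2.
      have e1 : (q0 * beta) ^+ 2 <= (q * beta) ^+ 2.
        by rewrite ler_sqr ?nnegrE ?mulr_ge0// ler_wpM2r.
      have e2 : (q0 * beta) ^+ 2 / 2 * (1 + h) <= (q0 * beta) ^+ 2 / 2 * 2.
        by rewrite ler_wpM2l ?divr_ge0 ?sqr_ge0//; lra.
      have e3 : (q * beta) ^+ 2 + 1 <= (q * beta + beta + 1) ^+ 2.
        have qb : 0 <= q * beta by rewrite mulr_ge0.
        have := mulr_ge0 qb be0; have := sqr_ge0 beta.
        have -> : (q * beta + beta + 1) ^+ 2 = (q * beta) ^+ 2 + beta ^+ 2 + 1 + 2 * (q * beta * beta) + 2 * (q * beta) + 2 * beta by ring.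
        move: be0 qb => ? ?; lra.
      move: C1 e1 e2 e3 h1 => ? ? ? ? ?; lra.
    have K3 := ler_wpM2l td0 K2.
    move: K1 K3 => ? ?; lra.
  apply: (@le_trans _ _ ((expR (- ((L1 - A) / h)))%:E * \int[P]_w (expR (U w - h^-1 * Y w))%:E)%E).
    by rewrite lee_wpmul2l// lee_fin expR_ge0.
  rewrite -ge0_integral_mulr ?expR_ge0//; last first.
    by apply: measurableT_comp => //; apply: measurable_funB => //; exact: measurable_funM.
  apply: ge0_ler_integral => //.
  - apply: measurable_funM => //.
    by apply: measurableT_comp => //; apply: measurable_funB => //; exact: measurable_funM.
  - apply: measurableT_comp => //; apply: measurable_funM => //; apply: measurable_funB => //.
    by apply: measurable_funM => //; exact: (gs_meas GS).
  move=> w _; rewrite -expRD ler_expR /U /Y (gs_evZ GS) le_eqVlt; apply/orP; left; apply/eqP.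
  by field.
rewrite ge0_integral_sumr//; last first.
  move=> i; apply: measurableT_comp => //; apply: measurable_funM => //; apply: measurable_funB => //.
  by apply: measurable_funM => //; exact: (gs_meas GS).
apply: (@le_trans _ _ (\sum_(i : I) (expR (B - t * (dd - dl)))%:E)%E); last first.
  by apply: lee_sum => i _; exact: one.
rewrite sumEFin lee_fin sumr_const -[leRHS]mulr_natl.
apply: (@le_trans _ _ (expR (t * (dd - dl)) * expR (B - t * (dd - dl)))).
  by rewrite -expRD ler_expR; lra.
by rewrite ler_wpM2r ?expR_ge0.
Qed.

End lower_bound.

(** * Truncated second moments of partition functions *)

Section ereal_aux.
Variable R : realType.
Lemma lee_add_cancel (a b : R) (z : \bar R) : (0 <= z)%E -> (a%:E <= z + b%:E)%E -> ((a - b)%:E <= z)%E.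
Proof. by case: z => [z| |] //=; rewrite ?leey// -EFinD !lee_fin lerBlDr. Qed.

(** If W <= exp sg, write W as W^(1 - lam) W^lam and bound the factors through exp sg and S;
    otherwise W <= exp(- sg) W^2. Integrated, this bounds the moment of order lam of S from below by
    two moments of W. *)
Lemma ler_paley_zygmund (W S lam sg : R) : 0 <= W -> 0 < S -> W <= S -> 0 <= lam <= 1 ->
  W <= expR ((1 - lam) * sg) * expR (lam * ln S) + expR (- sg) * W ^+ 2.
Proof.
rewrite le_eqVlt => /predU1P[<-|W0] S0 WS /andP[l0 l1].
  by rewrite expr0n/= mulr0 addr0 mulr_ge0 ?expR_ge0.
have lWS : ln W <= ln S by rewrite ler_ln ?posrE.
have WE : W = expR (ln W) by rewrite lnK.
have [Ws|sW] := leP (ln W) sg.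
  apply: (@le_trans _ _ (expR ((1 - lam) * sg) * expR (lam * ln S))); last first.
    by rewrite lerDl mulr_ge0 ?expR_ge0 ?sqr_ge0.
  rewrite {1}WE -expRD ler_expR; nra.
apply: (@le_trans _ _ (expR (- sg) * W ^+ 2)); last first.
  by rewrite lerDr mulr_ge0 ?expR_ge0.
rewrite expr2 mulrA -[leLHS]mul1r ler_wpM2r ?(ltW W0)//.
by rewrite [X in _ * X]WE -expRD -[leLHS]expR0 ler_expR; lra.
Qed.
End ereal_aux.

Section truncated_second_moment.
Context d (Om : measurableType d) (R : realType) (P : probability Om R).
Variables (V : lmodType R) (ev : V -> Om -> R) (c : V -> V -> R).
Hypothesis GS : gaussian_space P ev c.
Variables (I : finType) (n : nat) (x : I -> V) (tau : 'I_n -> R) (y : 'I_n -> I -> V)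
    (Sh : 'I_n -> I -> {set I}) (dd t dl : R).
Hypothesis MS : multiscale c x tau y Sh dd t dl.
Variables (A : {set I}) (beta lam d1 : R).
Hypotheses (be0 : 0 <= beta) (bed : beta ^+ 2 <= 2 * dd) (lam01 : 0 <= lam <= 1).
Hypotheses (d10 : 0 < d1) (d1dl : 4 * beta * dl <= d1).
Hypothesis tail_small : expR (t * (dl - d1 ^+ 2 / 8)) <= 2^-1.
Hypothesis cardA : expR (t * (dd - dl)) <= #|A|%:R.
Hypothesis t_big : 16 <= expR (dl * t).

Let t0 : 0 < t. Proof. exact: ms_t MS. Qed.
Let dl0 : 0 <= dl. Proof. by case/andP: (ms_dl MS). Qed.
Let dl1 : dl <= 1. Proof. by case/andP: (ms_dl MS). Qed.

(** Under the tilt exp(beta X_i) the average Y_k has mean close to beta tau_k t; the slack d1 t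
    makes it exponentially unlikely to exceed the level. *)
Let thr k := (beta * tau k + d1) * t.

Let low k i w : R := (ev (y k i) w <= thr k)%R%:R.
Let p i w : R := \prod_k low k i w.

Let low01 k i w : 0 <= low k i w <= 1.
Proof. by rewrite /low; case: (ev _ _ <= _); rewrite ?lexx ?ler01. Qed.
Let p_ge0 i w : 0 <= p i w.
Proof. by apply: prodr_ge0 => k _; case/andP: (low01 k i w). Qed.
Let p_le_low k i w : p i w <= low k i w.
Proof.
rewrite /p (bigD1 k)//=; apply: ler_piMr; first by case/andP: (low01 k i w).
by apply: prodr_ile1 => j _; exact: low01.
Qed.
Let p_le1 i w : p i w <= 1.
Proof. by apply: prodr_ile1 => j _; exact: low01. Qed.

Let measurable_low k i : measurable_fun setT (low k i).
Proof.
rewrite (_ : low k i = fun w => \1_(`]-oo, thr k]%classic) (ev (y k i) w)).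
  by apply: measurableT_comp => //; exact: (gs_meas GS).
by apply/funext => w; rewrite /low indicE mem_setE/= in_itv.
Qed.

Let measurable_p i : measurable_fun setT (p i).
Proof. by apply: measurable_prod => k _; exact: measurable_low. Qed.

Let g i w := p i w * expR (beta * ev (x i) w).
Let g_ge0 i w : 0 <= g i w. Proof. by rewrite mulr_ge0 ?expR_ge0. Qed.
Let measurable_g i : measurable_fun setT (g i).
Proof.
apply: measurable_funM => //; apply: measurableT_comp => //; apply: measurable_funM => //.
exact: (gs_meas GS).
Qed.

Let W w := \sum_(i in A) g i w.

Let mexp v : measurable_fun setT (fun w => expR (ev v w)) := gs_measE GS v.

Let cxx i : t - dl * t <= c (x i) (x i) /\ c (x i) (x i) <= t + dl * t.
Proof. by have := ms_xx MS i; rewrite ler_norml => /andP[]; split; lra. Qed.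

Let bnd k (a : R) : `|a - tau k * t| <= dl * t -> a <= tau k * t + dl * t /\ tau k * t - dl * t <= a.
Proof. by rewrite ler_norml => /andP[h1 h2]; split; lra. Qed.

(** [u1] bounds the logarithm of E exp(beta X_i) from below; [u2] bounds the logarithm of the share
    of one site in the second moment from above. *)
Let u1 := beta ^+ 2 * (t - dl * t) / 2.
Let u2 := t * (beta ^+ 2 + dd + 5 * beta ^+ 2 * dl + beta * d1 + 2 * dl).

Let first_moment i : ((expR u1 / 2)%:E <= \int[P]_w (g i w)%:E)%E.
Proof.
set B := expR (beta ^+ 2 * c (x i) (x i) / 2).
suff H : ((B / 2)%:E <= \int[P]_w (g i w)%:E)%E.
  apply: le_trans H; rewrite lee_fin ler_wpM2r ?invr_ge0// ler_expR /u1.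
  have [l _] := cxx i.
  have := ler_wpM2l (sqr_ge0 beta) l; lra.
have Eb : (\int[P]_w (expR (ev (beta *: x i) w))%:E = B%:E)%E.
  by rewrite (gs_mgf GS) /B !(gs_bilinE GS) expr2 !mulrA.
(* Chernoff bound with parameter d1 / 2 under the tilt: of the gain d1^2 / 2, the variance (at most
   2 t) takes d1^2 / 4 and the error in dl takes d1^2 / 8 by [d1dl], which leaves d1^2 / 8. *)
pose v k := beta *: x i + (d1 / 2) *: y k i.
pose bad k w := expR (- (d1 / 2 * thr k)) * expR (ev (v k) w).
have mbad k : measurable_fun setT (bad k) by apply: measurable_funM => //; exact: mexp.
have bad0 k w : 0 <= bad k w by rewrite mulr_ge0 ?expR_ge0.
have Ebad k : (\int[P]_w (bad k w)%:E <= (B * expR (- (t * d1 ^+ 2 / 8)))%:E)%E.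
  rewrite /bad ge0_integral_mulr ?expR_ge0//.
  rewrite (gs_mgf GS) -EFinM lee_fin /B -!expRD ler_expR.
  rewrite /v !(gs_bilinE GS) (gs_csym GS (y k i)).
  have [a1 _] := bnd (ms_xyi MS k i); have [a2 _] := bnd (ms_yy MS k i).
  have /andP[ta0 ta1] := ms_tau MS k.
  have b1 : d1 / 2 * beta * c (x i) (y k i) <= d1 / 2 * beta * (tau k * t + dl * t).
    by rewrite ler_wpM2l ?mulr_ge0 ?divr_ge0 ?(ltW d10).
  have b2 : (d1 / 2) ^+ 2 * c (y k i) (y k i) <= (d1 / 2) ^+ 2 * (tau k * t + dl * t).
    by rewrite ler_wpM2l ?sqr_ge0.
  have b3 : (d1 / 2) ^+ 2 * (tau k * t + dl * t) <= (d1 / 2) ^+ 2 * (2 * t).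
    rewrite ler_wpM2l ?sqr_ge0// -mulrDl ler_wpM2r ?(ltW t0)//; have := dl1; lra.
  have b4 : d1 * t / 8 * (4 * beta * dl) <= d1 * t / 8 * d1.
    by rewrite ler_wpM2l// divr_ge0// mulr_ge0 ?ltW.
  rewrite /thr; lra.
apply: (@le_trans _ _ ((B - B / 2)%:E)); first by rewrite lee_fin; lra.
apply: lee_add_cancel; first by apply: integral_ge0 => w _; rewrite lee_fin.
rewrite -{1}Eb.
apply: (@le_trans _ _ (\int[P]_w (g i w + \sum_k bad k w)%:E)%E).
  apply: ge0_ler_integral => //.
  by apply: measurable_funD => //; exact: measurable_sum.
  move=> w _; rewrite (gs_evZ GS) /g.
  have [all_low|] := boolP [forall k, ev (y k i) w <= thr k].
    rewrite /p big1 ?mul1r; last by move=> k _; rewrite /low (forallP all_low k).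
    by rewrite lerDl sumr_ge0.
  rewrite negb_forall => /existsP[k]; rewrite -ltNge => hk.
  apply: (@le_trans _ _ (bad k w)); last first.
    rewrite (bigD1 k)//= addrCA lerDl addr_ge0 ?mulr_ge0 ?expR_ge0//.
    by rewrite sumr_ge0.
  rewrite /bad -expRD ler_expR /v (gs_evD GS) !(gs_evZ GS).
  have := ler_wpM2l (ltW (divr_gt0 d10 (ltr0Sn R 1))) (ltW hk); lra.
rewrite ge0_integral_addr//; last 2 first.
- exact: measurable_sum.
- by move=> w; rewrite sumr_ge0.
rewrite leeD2l// ge0_integral_sumr//.
apply: (@le_trans _ _ (\sum_(k < n) (B * expR (- (t * d1 ^+ 2 / 8)))%:E)%E).
  by apply: lee_sum => k _; exact: Ebad.
rewrite sumEFin lee_fin big_const_ord iter_addr_0 -[leLHS]mulr_natl mulrCA.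
rewrite ler_wpM2l ?expR_ge0//; apply: le_trans tail_small.
apply: (@le_trans _ _ (expR (dl * t) * expR (- (t * d1 ^+ 2 / 8)))).
  by rewrite ler_wpM2r ?expR_ge0// (ms_n MS).
by rewrite -expRD ler_expR; lra.
Qed.

(** On the truncation event 1 <= exp(beta (thr k - Y_k)), and for j in the shell k the variance of
    X_i + X_j - Y_k is at most about (2 - tau_k) t. The shell then has exponent about t (beta^2 + dd
    + (beta^2 / 2 - dd) tau_k), largest at tau = 0 because beta^2 <= 2 dd. *)
Let second_moment : (\int[P]_w (W w ^+ 2)%:E <= (#|A|%:R * expR u2)%:E)%E.
Proof.
pose v k i j := beta *: (x i + x j - y k i).
pose h i k j (w : Om) := if j \in Sh k i then expR (beta * thr k) * expR (ev (v k i j) w) else 0.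
have mh i k j : measurable_fun setT (h i k j).
  by rewrite /h; case: (j \in _) => //; apply: measurable_funM => //; exact: mexp.
have h0 i k j w : 0 <= h i k j w by rewrite /h; case: ifP => // _; rewrite mulr_ge0 ?expR_ge0.
have mh1 i k : measurable_fun setT (fun w => \sum_j h i k j w) by exact: measurable_sum.
have h01 i k w : 0 <= \sum_j h i k j w by exact: sumr_ge0.
have mh2 i : measurable_fun setT (fun w => \sum_k \sum_j h i k j w) by exact: measurable_sum.
have h02 i w : 0 <= \sum_k \sum_j h i k j w by exact: sumr_ge0.
have mW : measurable_fun setT W.
  rewrite (_ : W = fun w => \sum_i (if i \in A then g i w else 0)).
    by apply: measurable_sum => i; case: (i \in A).
  by apply/funext => w; rewrite /W big_mkcond.
have mh3 : measurable_fun setT (fun w => \sum_(i in A) \sum_k \sum_j h i k j w).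
  rewrite (_ : (fun w => _) = fun w => \sum_i (if i \in A then \sum_k \sum_j h i k j w else 0)).
    by apply: measurable_sum => i; case: (i \in A).
  by apply/funext => w; rewrite big_mkcond.
apply: (@le_trans _ _ (\int[P]_w (\sum_(i in A) \sum_k \sum_j h i k j w)%:E)%E).
  apply: ge0_ler_integral => //.
  - exact: measurable_funX.
  - by move=> w _; exact: sqr_ge0.
  move=> w _; rewrite expr2 {1}/W mulr_suml; apply: ler_sum => i iA.
  apply: (@le_trans _ _ (\sum_j g i w * expR (beta * ev (x j) w))).
    rewrite -mulr_sumr ler_wpM2l// /W big_mkcond/=; apply: ler_sum => j _.
    case: ifP => _; last exact: expR_ge0.
    by rewrite /g ler_piMl ?expR_ge0.
  rewrite exchange_big/=; apply: ler_sum => j _.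
  have [k jk] := ms_cover MS i j.
  rewrite (bigD1 k)//= -[leLHS]addr0; apply: lerD; last exact: sumr_ge0.
  rewrite /h jk /g.
  apply: (@le_trans _ _ (low k i w * (expR (beta * ev (x i) w) * expR (beta * ev (x j) w)))).
    by rewrite -mulrA ler_wpM2r ?mulr_ge0 ?expR_ge0.
  rewrite /low; case: (leP (ev (y k i) w) (thr k)) => hk /=; last first.
    by rewrite mul0r mulr_ge0 ?expR_ge0.
  rewrite mul1r -!expRD ler_expR /v (gs_evZ GS) (gs_evB GS) (gs_evD GS).
  have := ler_wpM2l be0 hk; lra.
rewrite ge0_integral_sumr//.
apply: (@le_trans _ _ (\sum_(i in A) (expR u2)%:E)%E); last first.
  by rewrite sumEFin lee_fin sumr_const -[leLHS]mulr_natl.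
apply: lee_sum => i _; rewrite ge0_integral_sumr//.
apply: (@le_trans _ _ (\sum_(k < n) (expR (u2 - dl * t))%:E)%E); last first.
  rewrite sumEFin lee_fin big_const_ord iter_addr_0 -[leLHS]mulr_natl.
  apply: (@le_trans _ _ (expR (dl * t) * expR (u2 - dl * t))).
    by rewrite ler_wpM2r ?expR_ge0// (ms_n MS).
  by rewrite -expRD ler_expR; lra.
apply: lee_sum => k _; rewrite ge0_integral_sumr//.
apply: (@le_trans _ _ (\sum_j (if j \in Sh k i then expR (u2 - dl * t - t * (dd * (1 - tau k) + dl)) else 0)%:E)%E).
  apply: lee_sum => j _; rewrite /h; case: ifPn => jS; last by rewrite integral0.
  rewrite ge0_integral_mulr ?expR_ge0//.
  rewrite (gs_mgf GS) -EFinM lee_fin -expRD ler_expR.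
  have [_ l1] := bnd (ms_xy MS jS); have [_ l2] := bnd (ms_xyi MS k i).
  have [l3 _] := bnd (ms_yy MS k i); have l4 := ms_xsh MS jS.
  have [_ l5] := cxx i; have [_ l6] := cxx j.
  have -> : c (v k i j) (v k i j) = beta ^+ 2 * (c (x i) (x i) + c (x j) (x j) + c (y k i) (y k i) +
      2 * c (x i) (x j) - 2 * c (x i) (y k i) - 2 * c (x j) (y k i)).
    rewrite /v !(gs_bilinE GS) (gs_csym GS (x j) (x i)) (gs_csym GS (y k i) (x i)) (gs_csym GS (y k i) (x j)).
    by ring.
  have f1 : c (x i) (x i) + c (x j) (x j) + c (y k i) (y k i) +
      2 * c (x i) (x j) - 2 * c (x i) (y k i) - 2 * c (x j) (y k i) <= t * (2 - tau k + 9 * dl) by lra.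
  have f2 := ler_wpM2l (sqr_ge0 beta) f1.
  have /andP[ta0 ta1] := ms_tau MS k.
  have f3 : t * tau k * beta ^+ 2 <= t * tau k * (2 * dd).
    by rewrite ler_wpM2l// mulr_ge0// ltW.
  have f4 : 0 <= t * beta ^+ 2 * dl by rewrite !mulr_ge0 ?sqr_ge0// ltW.
  rewrite /thr /u2; lra.
rewrite sumEFin lee_fin -big_mkcond/= sumr_const -[leLHS]mulr_natl.
apply: (@le_trans _ _ (expR (t * (dd * (1 - tau k) + dl)) * expR (u2 - dl * t - t * (dd * (1 - tau k) + dl)))).
  by rewrite ler_wpM2r ?expR_ge0// (ms_card MS).
by rewrite -expRD ler_expR; lra.
Qed.

(* Paley-Zygmund for the sum [W] of the terms whose averages at all scales stay below the
   typical slope [beta]: the truncation makes the second moment comparable to the square of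
   the first one in the whole range [beta ^+ 2 <= 2 * dd]. *)
Lemma partition_sum_moment_lower :
  ((expR (t * (lam * (dd + beta ^+ 2 / 2) - (7 * beta ^+ 2 * dl + beta * d1 + 4 * dl))))%:E <=
   \int[P]_w (expR (lam * ln (partition_sum ev x A beta w)))%:E)%E.
Proof.
have A0 : 0 < #|A|%:R :> R by exact: lt_le_trans (expR_gt0 _) cardA.
have [i0 i0A] : exists i, i \in A by apply/card_gt0P; rewrite -(ltr_nat R).
pose S := partition_sum ev x A beta.
have S0 w : 0 < S w by exact: partition_sum_gt0 i0A.
have WS w : W w <= S w.
  by apply: ler_sum => i _; rewrite /g ler_piMl ?expR_ge0.
have W0 w : 0 <= W w by rewrite sumr_ge0.
have mW : measurable_fun setT W.
  rewrite (_ : W = fun w => \sum_i (if i \in A then g i w else 0)).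
    by apply: measurable_sum => i; case: (i \in A).
  by apply/funext => w; rewrite /W big_mkcond.
have mS : measurable_fun setT (fun w => expR (lam * ln (S w))).
  apply: measurableT_comp => //; apply: measurable_funM => //.
  by apply: measurableT_comp; [exact: measurable_ln|exact: (measurable_partition_sum GS)].
(* At this level the second moment term is at most #|A| exp(u1) / 4, half of the lower bound for the
   first moment. *)
pose sg := u2 - u1 + ln 4.
have EW : ((#|A|%:R * expR u1 / 2)%:E <= \int[P]_w (W w)%:E)%E.
  rewrite /W ge0_integral_sumr//.
  apply: (@le_trans _ _ (\sum_(i in A) (expR u1 / 2)%:E)%E).
    by rewrite sumEFin lee_fin sumr_const -[leRHS]mulr_natl mulrA.
  by apply: lee_sum => i _; exact: first_moment.
have H : (\int[P]_w (W w)%:E <= (expR ((1 - lam) * sg))%:E * \int[P]_w (expR (lam * ln (S w)))%:E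
    + (expR (- sg))%:E * \int[P]_w (W w ^+ 2)%:E)%E.
  have W2 w : 0 <= W w ^+ 2 by exact: sqr_ge0.
  rewrite -!ge0_integral_mulr ?expR_ge0//; last exact: measurable_funX.
  rewrite -ge0_integral_addr//; last 3 first.
  - exact: measurable_funM.
  - by apply: measurable_funM => //; exact: measurable_funX.
  - by move=> w; rewrite mulr_ge0 ?expR_ge0.
  apply: ge0_ler_integral => //.
    by apply: measurable_funD; apply: measurable_funM => //; exact: measurable_funX.
  by move=> w _; exact: ler_paley_zygmund.
have {}H := le_trans EW H.
have e1 : ((expR (- sg))%:E * \int[P]_w (W w ^+ 2)%:E <= (#|A|%:R * expR u1 / 4)%:E)%E.
  apply: (@le_trans _ _ ((expR (- sg))%:E * (#|A|%:R * expR u2)%:E)%E).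
    by rewrite lee_wpmul2l// lee_fin expR_ge0.
  rewrite -EFinM lee_fin mulrCA -!mulrA ler_wpM2l//.
  rewrite -expRD (_ : - sg + u2 = u1 - ln 4); last by rewrite /sg; ring.
  by rewrite expRD expRN lnK ?posrE.
have {}H : ((#|A|%:R * expR u1 / 4)%:E <= (expR ((1 - lam) * sg))%:E * \int[P]_w (expR (lam * ln (S w)))%:E)%E.
  have := le_trans H (leeD2l _ e1) => /lee_add_cancel.
  rewrite (_ : #|A|%:R * expR u1 / 2 - #|A|%:R * expR u1 / 4 = #|A|%:R * expR u1 / 4); last by field.
  apply; rewrite mule_ge0 ?lee_fin ?expR_ge0//.
  by apply: integral_ge0 => w _; rewrite lee_fin expR_ge0.
have := lee_wpmul2l (_ : 0 <= (expR (- ((1 - lam) * sg)))%:E)%E H.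
rewrite lee_fin expR_ge0 => /(_ isT).
rewrite muleA -!EFinM -expRD addNr expR0 mul1e; apply: le_trans.
have /andP[l0 l1] := lam01.
rewrite lee_fin.
apply: (@le_trans _ _ (expR (- ((1 - lam) * (u2 - u1))) * 4^-1 * (expR (t * (dd - dl)) * expR u1 / 4))); last first.
  rewrite ler_pM ?mulr_ge0 ?expR_ge0 ?invr_ge0//.
    rewrite (_ : 4^-1 = expR (- ln 4)); last by rewrite expRN lnK ?posrE.
    have : 0 <= lam * ln (4 : R) by rewrite mulr_ge0// ln_ge0// ler1n.
    by rewrite -expRD ler_expR /sg; lra.
  by rewrite ler_wpM2r ?invr_ge0// ler_wpM2r ?expR_ge0.
rewrite [leRHS](_ : _ = expR (- ((1 - lam) * (u2 - u1)) + t * (dd - dl) + u1) / 16); last first.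
  by rewrite !expRD; field.
rewrite ler_pdivlMr//; apply: le_trans (ler_wpM2l (expR_ge0 _) t_big) _.
rewrite -expRD ler_expR /u1 /u2.
have td0 : 0 <= t * dl by rewrite mulr_ge0// ltW.
have g0 : 0 <= t * (5 * beta ^+ 2 * dl + beta * d1 + 2 * dl + beta ^+ 2 * dl / 2).
  rewrite mulr_ge0 ?(ltW t0)// !addr_ge0 ?mulr_ge0 ?sqr_ge0// ltW//.
have g1 : (1 - lam) * (t * (5 * beta ^+ 2 * dl + beta * d1 + 2 * dl + beta ^+ 2 * dl / 2)) <=
    t * (5 * beta ^+ 2 * dl + beta * d1 + 2 * dl + beta ^+ 2 * dl / 2).
  by rewrite ler_piMl//; lra.
have g2 : 0 <= t * (beta ^+ 2 * dl) by rewrite mulr_ge0 ?(ltW t0)// mulr_ge0 ?sqr_ge0.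
lra.
Qed.

End truncated_second_moment.

Section concentration_aux.
Variable R : realType.

Lemma lee_expR_mul_cancel (m k : R) (a b : \bar R) : ((expR m)%:E <= a)%E -> (0 <= b)%E ->
  (a * b <= (expR k)%:E)%E -> (b <= (expR (k - m))%:E)%E.
Proof.
move=> ma b0 abk.
have := lee_wpmul2l (_ : 0 <= (expR (- m))%:E)%E (le_trans (lee_wpmul2r b0 ma) abk).
rewrite lee_fin expR_ge0 => /(_ isT).
by rewrite muleA -!EFinM -!expRD addNr expR0 mul1e [- m + k]addrC.
Qed.

(* The negative moment [E exp(- lam f)] controls every positive moment of [f] from below. *)
Lemma expR_moment_tangent (b lam m s : R) : 0 <= b -> 0 < lam ->
  expR (b * m) * (1 + b / lam) <= expR (b * s) + expR (b * m) * (b / lam) * expR (lam * m) * expR (- (lam * s)).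
Proof.
move=> b0 l0.
have h1 : 1 + b * (s - m) <= expR (b * (s - m)) by exact: expR_ge1Dx.
have h2 : 1 - lam * (s - m) <= expR (- (lam * (s - m))) by exact: expR_ge1Dx.
have h3 := ler_wpM2l (divr_ge0 b0 (ltW l0)) h2.
have -> : expR (b * s) = expR (b * m) * expR (b * (s - m)) by rewrite -expRD; congr expR; ring.
have -> : expR (b * m) * (b / lam) * expR (lam * m) * expR (- (lam * s)) =
    expR (b * m) * (b / lam * expR (- (lam * (s - m)))).
  rewrite -!mulrA -expRD; do 3 congr (_ * _); congr expR; ring.
rewrite -mulrDr ler_wpM2l ?expR_ge0//.
have e : b / lam * (lam * (s - m)) = b * (s - m) by field; rewrite gt_eqF.
lra.
Qed.

(** Hoelder's inequality in pointwise form, with exponents 1/(1 - ka) and 1/ka: if exp(u / (1 - ka))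
    and exp(v / ka) have expectations at most exp(u0 / (1 - ka)) and exp(v0 / ka), the bracket has
    expectation at most 1. *)
Lemma expR_young (ka u v u0 v0 : R) : 0 < ka < 1 ->
  expR (u + v) <= expR (u0 + v0) *
   ((1 - ka) * expR (- (u0 / (1 - ka))) * expR (u / (1 - ka)) + ka * expR (- (v0 / ka)) * expR (v / ka)).
Proof.
move=> /andP[k0 k1].
have h (p q y z : R) : 0 <= p -> 0 <= q -> p + q = 1 -> expR (p * y + q * z) <= p * expR y + q * expR z.
  move=> p0 q0 pq; have := expR_tangent (p * y + q * z) y; have := expR_tangent (p * y + q * z) z.
  set e := expR (p * y + q * z); move=> h1 h2.
  have := ler_wpM2l p0 h2; have := ler_wpM2l q0 h1.
  have : e * (p + q) * (1 - (p * y + q * z)) + e * (p * y + q * z) = e by rewrite pq; ring.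
  lra.
rewrite -!mulrA -!expRD.
have := h (1 - ka) ka (- (u0 / (1 - ka)) + u / (1 - ka)) (- (v0 / ka) + v / ka).
rewrite (_ : (1 - ka) * (_ + _) + ka * (_ + _) = - (u0 + v0) + (u + v)); last first.
  by field; rewrite gt_eqF//= gt_eqF// subr_gt0.
rewrite subrK => /(_ _ (ltW k0) erefl) H.
rewrite -[u + v](addNKr (u0 + v0)) [leLHS]expRD ler_wpM2l ?expR_ge0// H//.
by rewrite subr_ge0 ltW.
Qed.
End concentration_aux.

(** * Upper bound for Gibbs moments *)

Section participation_upper.
Context d (Om : measurableType d) (R : realType) (P : probability Om R).
Variables (V : lmodType R) (ev : V -> Om -> R) (c : V -> V -> R).
Hypothesis GS : gaussian_space P ev c.
Variables (I : finType) (n : nat) (x : I -> V) (tau : 'I_n -> R) (y : 'I_n -> I -> V)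
    (Sh : 'I_n -> I -> {set I}) (dd t dl : R).
Hypothesis MS : multiscale c x tau y Sh dd t dl.
Hypothesis GF : gaussian_family P (fun i => ev (x i)) (fun i j => c (x i) (x j)).
Variables (K : finType) (Ic : K -> {set I}).
Hypothesis K0 : (0 < #|K|)%N.
Hypothesis slab_far : forall k l i j, k != l -> i \in Ic k -> j \in Ic l -> c (x i) (x j) <= dl * t.
Hypothesis card_slab : forall k, expR (t * (dd - dl)) <= #|Ic k|%:R.
Hypothesis cardI : #|I|%:R <= expR (t * (dd + dl)).
Variables (beta lam d1 ka q0 : R).
Hypotheses (be0 : 0 <= beta) (bed : beta ^+ 2 <= 2 * dd) (lam01 : 0 < lam <= 1).
Hypotheses (d10 : 0 < d1) (d1dl : 4 * beta * dl <= d1) (ka0 : 0 < ka <= 2^-1) (q00 : 0 < q0).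
Hypothesis tail_small : expR (t * (dl - d1 ^+ 2 / 8)) <= 2^-1.
Hypothesis t_big : 16 <= expR (dl * t).

Let t0 : 0 < t. Proof. exact: ms_t MS. Qed.
Let dl0 : 0 <= dl. Proof. by case/andP: (ms_dl MS). Qed.
Let dl1 : dl <= 1. Proof. by case/andP: (ms_dl MS). Qed.
Let l0 : 0 < lam. Proof. by case/andP: lam01. Qed.
Let l1 : lam <= 1. Proof. by case/andP: lam01. Qed.

Let X i w := beta * ev (x i) w.
Let GX : gaussian_family P X (fun i j => beta ^+ 2 * c (x i) (x j)).
Proof.
have [mx gx] := GF; split=> [i|a]; first exact: measurable_funM.
have := gx (fun i => a i * beta).
rewrite (_ : (fun w => _) = fun w => \sum_j a j * X j w); last first.
  by apply/funext => w; apply: eq_bigr => j _; rewrite /X mulrA.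
rewrite (_ : \sum_j _ = \sum_j \sum_k a j * a k * (beta ^+ 2 * c (x j) (x k)))//.
by apply: eq_bigr => j _; apply: eq_bigr => k _; ring.
Qed.

Let errC := 7 * beta ^+ 2 * dl + beta * d1 + 4 * dl.
(** The typical value t (dd + beta^2 / 2) of ln S, lowered by the error of the positive moment
    divided by lam and by the cost of concentration in one slab. *)
Let m := t * (dd + beta ^+ 2 / 2 - errC / lam - 4 * lam * beta ^+ 2).
Let S k w := partition_sum ev x (Ic k) beta w.

Let Ic_ne k : exists i, i \in Ic k.
Proof. by apply/card_gt0P; rewrite -(ltr_nat R); exact: lt_le_trans (expR_gt0 _) (card_slab k). Qed.

Let S_gt0 k w : 0 < S k w.
Proof. by have [i ik] := Ic_ne k; exact: partition_sum_gt0 ik. Qed.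

Let cxx i j : c (x i) (x j) <= dl * t + t.
Proof.
have [k kij] := ms_cover MS i j; apply: le_trans (ms_xsh MS kij) _.
by rewrite addrC lerD2l ler_piMl ?(ltW t0)//; case/andP: (ms_tau MS k).
Qed.

(** In one slab the concentration variance is of order t and costs 4 lam^2 beta^2 t, which for small
    lam is negligible against lam m. *)
Let neg_moment k : (\int[P]_w (expR (- (lam * ln (S k w))))%:E <= (expR (- (lam * m)))%:E)%E.
Proof.
have := @mean_log_sum_concentration R I unit (fun=> Ic k) (fun=> 1) (fun=> ler01)
  _ (fun=> Ic_ne k) _ _ P X _ GX (fun _ _ => beta ^+ 2 * (dl * t + t)) (beta ^+ 2 * (2 * t)) lam.
rewrite big_const card_unit iter_addr_0 => /(_ erefl).
move=> H; have {}H : (\int[P]_w (expR (lam * ln (S k w)))%:E * \int[P]_w (expR (- (lam * ln (S k w))))%:E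
    <= (expR (2 * lam ^+ 2 * (beta ^+ 2 * (2 * t))))%:E)%E.
  have E w : @mean_log_sum R I unit (fun=> Ic k) (fun=> 1) (X^~ w) = ln (S k w).
    rewrite /mean_log_sum (eq_bigr (fun=> ln (S k w))); last by move=> u _; rewrite mul1r.
    by rewrite big_const card_unit /= addr0.
  rewrite (_ : (fun w => (expR (- (lam * ln (S k w))))%:E) = fun w => (expR (- (lam * @mean_log_sum R I unit (fun=> Ic k) (fun=> 1) (X^~ w))))%:E); last by apply/funext => w; rewrite E.
  rewrite (_ : (fun w => (expR (lam * ln (S k w)))%:E) = fun w => (expR (lam * @mean_log_sum R I unit (fun=> Ic k) (fun=> 1) (X^~ w)))%:E); last by apply/funext => w; rewrite E.
  apply: H; last exact: ltW.
    by move=> _ _ i j _ _; rewrite ler_wpM2l ?sqr_ge0.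
  rewrite big_const card_unit /= addr0 big_const card_unit /= addr0 !mul1r ler_wpM2l ?sqr_ge0//.
  have := ler_piMl (ltW t0) dl1; lra.
have C := partition_sum_moment_lower GS MS be0 bed (_ : 0 <= lam <= 1) d10 d1dl tail_small (card_slab k) t_big.
have {}C := C ltac:(by rewrite (ltW l0) l1).
apply: le_trans (lee_expR_mul_cancel C _ H) _.
  by apply: integral_ge0 => w _; rewrite lee_fin expR_ge0.
rewrite lee_fin ler_expR /m -/errC.
rewrite (_ : lam * (t * _) = t * (lam * (dd + beta ^+ 2 / 2) - errC - 4 * lam ^+ 2 * beta ^+ 2)); last first.
  by field; rewrite gt_eqF.
lra.
Qed.

Let M : R := #|K|%:R.
Let M0 : 0 < M. Proof. by rewrite ltr0n. Qed.
Let f := mean_log_sum Ic (fun=> M^-1).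
Let F w := f (X^~ w).

Let mF : measurable_fun setT F.
Proof. by apply: measurable_mean_log_sum; exact: GX.1. Qed.

Let sumM : \sum_(k : K) M^-1 = 1.
Proof. by rewrite sumr_const -[LHS]mulr_natl divff// gt_eqF. Qed.

Let mexpS (a : R) k : measurable_fun setT (fun w => expR (a * ln (S k w))).
Proof.
apply: measurableT_comp => //; apply: measurable_funM => //.
by apply: measurableT_comp; [exact: measurable_ln|exact: (measurable_partition_sum GS)].
Qed.

Let F_neg_moment : (\int[P]_w (expR (- (lam * F w)))%:E <= (expR (- (lam * m)))%:E)%E.
Proof.
apply: (@le_trans _ _ (\int[P]_w (\sum_k M^-1 * expR (- lam * ln (S k w)))%:E)%E).
  apply: ge0_ler_integral => //.
  - by apply: measurableT_comp => //; apply: measurableT_comp => //; exact: measurable_funM.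
  - by apply: measurable_sum => k; exact: measurable_funM.
  move=> w _; rewrite -mulNr {1}/F /f /mean_log_sum mulr_sumr.
  rewrite (eq_bigr (fun k => M^-1 * (- lam * ln (S k w)))); last by move=> k _; rewrite mulrCA.
  by apply: expR_jensen => // k; rewrite invr_ge0 ltW.
rewrite ge0_integral_sumr//; last 2 first.
- by move=> k; exact: measurable_funM.
- by move=> k w; rewrite mulr_ge0 ?invr_ge0 ?expR_ge0// ltW.
apply: (@le_trans _ _ (\sum_(k : K) (M^-1 * expR (- (lam * m)))%:E)%E); last first.
  by rewrite sumEFin -mulr_suml sumM mul1r.
apply: lee_sum => k _; rewrite ge0_integral_mulr ?invr_ge0 ?(ltW M0)// EFinM.
rewrite lee_wpmul2l ?lee_fin ?invr_ge0 ?(ltW M0)//; apply: le_trans (neg_moment k).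
by under eq_integral do rewrite mulNr.
Qed.

Let L := beta ^+ 2 * (t * (dl + M^-1)).

(** Here b need not be small, so the concentration has to come from averaging over the slabs. Its
    input E exp(b F) >= exp(b m) follows from the small negative moment of F through
    [expR_moment_tangent]. *)
Let F_moment b : 0 <= b -> (\int[P]_w (expR (- (b * F w)))%:E <= (expR (2 * b ^+ 2 * L - b * m))%:E)%E.
Proof.
move=> b0.
have mb : measurable_fun setT (fun w => expR (b * F w)).
  by apply: measurableT_comp => //; exact: measurable_funM.
have ml : measurable_fun setT (fun w => expR (- (lam * F w))).
  by apply: measurableT_comp => //; apply: measurableT_comp => //; exact: measurable_funM.
have H := @mean_log_sum_concentration R I K Ic (fun=> M^-1) _ sumM Ic_ne _ _ P X _ GX
  (fun k l => beta ^+ 2 * (dl * t + t * (k == l)%:R)) L b _ _ b0.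
have low : ((expR (b * m))%:E <= \int[P]_w (expR (b * F w))%:E)%E.
  pose A := expR (b * m) * (b / lam).
  have A0 : 0 <= A by rewrite mulr_ge0 ?expR_ge0// divr_ge0// ltW.
  have A1 : 0 <= A * expR (lam * m) by rewrite mulr_ge0 ?expR_ge0.
  have : ((expR (b * m) + A)%:E <= \int[P]_w (expR (b * F w))%:E + A%:E)%E; last first.
    by move/lee_add_cancel; rewrite addrK; apply; apply: integral_ge0 => w _; rewrite lee_fin expR_ge0.
  apply: (@le_trans _ _ (\int[P]_w (expR (b * F w))%:E +
      (A * expR (lam * m))%:E * \int[P]_w (expR (- (lam * F w)))%:E)%E); last first.
    rewrite leeD2l//; apply: le_trans (lee_wpmul2l _ F_neg_moment) _; first by rewrite lee_fin.
    by rewrite -EFinM -mulrA expRxMexpNx_1 mulr1.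
  rewrite -ge0_integral_mulr// -ge0_integral_addr//; last 2 first.
  - exact: measurable_funM.
  - by move=> w; rewrite mulr_ge0 ?expR_ge0.
  apply: (@le_trans _ _ (\int[P]_w (expR (b * m) + A)%:E)%E).
    by rewrite integral_cst//= probability_setT mule1.
  apply: ge0_ler_integral => //.
  - by apply: measurable_funD => //; exact: measurable_funM.
  - by move=> w _; rewrite addr_ge0 ?expR_ge0.
  move=> w _; have := expR_moment_tangent m (F w) b0 l0; rewrite -/A mulrDr mulr1.
  by [].
apply: lee_expR_mul_cancel low _ _; first by apply: integral_ge0 => w _; rewrite lee_fin expR_ge0.
apply: H.
- by move=> k; rewrite invr_ge0 ltW.
- move=> k l i j ik jl; rewrite ler_wpM2l ?sqr_ge0//.
  have [_|kl] := eqVneq k l; first by rewrite mulr1.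
  by rewrite mulr0 addr0; exact: slab_far ik jl.
rewrite (eq_bigr (fun k : K => M^-1 * L)); first by rewrite -mulr_suml sumM mul1r.
move=> k _; rewrite (eq_bigr (fun l : K => M^-1 * beta ^+ 2 * (dl * t) * M^-1 +
   (if l == k then M^-1 * beta ^+ 2 * M^-1 * t else 0))); last first.
  by move=> l _; rewrite eq_sym; case: eqP => _ /=; rewrite ?mulr1n ?mulr0n; ring.
rewrite big_split/= -mulr_sumr sumM -big_mkcond/= big_pred1_eq /L; ring.
Qed.

(** Since F <= ln S, Hoelder's inequality with a small ka applies: exp(q0 beta X_i) loses only a
    multiple of ka in the exponent, and the high power q0 / ka of exp(- F) is paid by the variance t
    (dl + 1/M), harmless when dl + 1/M is small compared with ka. *)
Lemma participation_upper :
  (\int[P]_w (participation ev x q0 beta w)%:E <= (expR (t * (dd - q0 * dd + (q0 ^+ 2 - q0) * beta ^+ 2 / 2 +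
    (dl + q0 ^+ 2 * beta ^+ 2 * (dl + 2 * ka) + 2 * q0 ^+ 2 * beta ^+ 2 * (dl + M^-1) / ka +
     q0 * (errC / lam + 4 * lam * beta ^+ 2)))))%:E)%E.
Proof.
have /andP[k0 k2] := ka0.
have k1 : ka < 1 by apply: le_lt_trans k2 _; rewrite invf_lt1// ltr1n.
have k1' : 0 < 1 - ka by rewrite subr_gt0.
pose u0 := q0 ^+ 2 * beta ^+ 2 * (dl * t + t) / (2 * (1 - ka)).
pose v0 := ka * (2 * (q0 / ka) ^+ 2 * L - q0 / ka * m).
pose G i w := expR (u0 + v0) * ((1 - ka) * expR (- (u0 / (1 - ka))) * expR (ev ((q0 / (1 - ka) * beta) *: x i) w)
   + ka * expR (- (v0 / ka)) * expR (- (q0 / ka * F w))).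
have m1 i : measurable_fun setT (fun w => expR (ev ((q0 / (1 - ka) * beta) *: x i) w)) by exact: (gs_measE GS).
have m2 : measurable_fun setT (fun w => expR (- (q0 / ka * F w))).
  by apply: measurableT_comp => //; apply: measurableT_comp => //; exact: measurable_funM.
have mG i : measurable_fun setT (G i).
  by apply: measurable_funM => //; apply: measurable_funD; apply: measurable_funM.
have p1 : 0 <= (1 - ka) * expR (- (u0 / (1 - ka))) by rewrite mulr_ge0 ?expR_ge0// ltW.
have p2 : 0 <= ka * expR (- (v0 / ka)) by rewrite mulr_ge0 ?expR_ge0// ltW.
have G0 i w : 0 <= G i w by rewrite mulr_ge0 ?addr_ge0 ?mulr_ge0 ?expR_ge0// ltW.
have EG i : (\int[P]_w (G i w)%:E <= (expR (u0 + v0))%:E)%E.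
  rewrite /G ge0_integral_mulr ?expR_ge0//; last 2 first.
  - by apply: measurable_funD; apply: measurable_funM.
  - by move=> w; rewrite addr_ge0// mulr_ge0 ?expR_ge0.
  rewrite -[leRHS]mule1 lee_wpmul2l ?lee_fin ?expR_ge0//.
  rewrite ge0_integral_addr//; last 4 first.
  - exact: measurable_funM.
  - exact: measurable_funM.
  - by move=> w; rewrite mulr_ge0 ?expR_ge0.
  - by move=> w; rewrite mulr_ge0 ?expR_ge0.
  rewrite !ge0_integral_mulr//.
  apply: (@le_trans _ _ ((1 - ka)%:E + ka%:E)%E); last by rewrite -EFinD lee_fin; lra.
  apply: leeD.
    rewrite (gs_mgf GS) -EFinM lee_fin -[leLHS]mulrA ler_piMr ?(ltW k1')//.
    rewrite -expRD -[leRHS]expR0 ler_expR !(gs_bilinE GS).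
    rewrite addrC subr_le0 /u0.
    rewrite (_ : q0 ^+ 2 * beta ^+ 2 * (dl * t + t) / (2 * (1 - ka)) / (1 - ka) =
      (q0 / (1 - ka) * beta) ^+ 2 / 2 * (dl * t + t)); last by field; rewrite gt_eqF.
    rewrite (_ : _ / 2 = (q0 / (1 - ka) * beta) ^+ 2 / 2 * c (x i) (x i)); last first.
      by field; rewrite gt_eqF.
    by rewrite ler_wpM2l// divr_ge0// sqr_ge0.
  apply: le_trans (lee_wpmul2l _ (F_moment (_ : 0 <= q0 / ka))) _.
  - by rewrite lee_fin.
  - by rewrite divr_ge0// ltW.
  rewrite -EFinM lee_fin -[leLHS]mulrA -expRD /v0 mulrAC divff ?gt_eqF// mul1r addNr expR0 mulr1//.
apply: (@le_trans _ _ (\int[P]_w (\sum_i G i w)%:E)%E).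
  apply: ge0_ler_integral => //.
  - exact: (measurable_participation GS).
  - exact: measurable_sum.
  - by move=> w _; apply: sumr_ge0 => i _; exact: expR_ge0.
  move=> w _; apply: ler_sum => i _.
  have FS : F w <= ln (partition_sum ev x [set: I]%SET beta w).
    rewrite /F /f /mean_log_sum -[leRHS]mul1r -sumM mulr_suml; apply: ler_sum => k _.
    rewrite ler_wpM2l ?invr_ge0 ?(ltW M0)//.
    have [j jk] := Ic_ne k.
    have Z0 : 0 < partition_sum ev x [set: I]%SET beta w.
      by apply: (@partition_sum_gt0 _ _ _ _ _ _ _ _ _ j); rewrite finset.in_setT.
    rewrite ler_ln ?posrE ?Z0 ?(S_gt0 k w)//.
    rewrite /partition_sum /block_sum big_mkcond [leRHS]big_mkcond/=; apply: ler_sum => l _.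
    by rewrite finset.in_setT; case: ifP => _; rewrite ?expR_ge0.
  apply: (@le_trans _ _ (expR (q0 * (beta * ev (x i) w) + - (q0 * F w)))).
    by rewrite ler_expR mulrBr lerD2l lerN2 ler_wpM2l// ltW.
  apply: le_trans (@expR_young _ ka _ _ u0 v0 _) _; first by rewrite k0.
  rewrite /G (gs_evZ GS).
  rewrite (_ : q0 * (beta * ev (x i) w) / (1 - ka) = q0 / (1 - ka) * beta * ev (x i) w); last by ring.
  rewrite (_ : - (q0 * F w) / ka = - (q0 / ka * F w)); last by ring.
  by [].
rewrite ge0_integral_sumr//.
apply: (@le_trans _ _ (\sum_(i : I) (expR (u0 + v0))%:E)%E); first by apply: lee_sum.
rewrite sumEFin lee_fin sumr_const -[leLHS]mulr_natl.
apply: (@le_trans _ _ (expR (t * (dd + dl)) * expR (u0 + v0))).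
  by rewrite ler_wpM2r ?expR_ge0.
rewrite -expRD ler_expR.
have hu : u0 <= q0 ^+ 2 * beta ^+ 2 * t * (1 / 2 + dl + ka).
  rewrite /u0 ler_pdivrMr ?mulr_gt0//.
  rewrite (_ : q0 ^+ 2 * beta ^+ 2 * (dl * t + t) = q0 ^+ 2 * beta ^+ 2 * t * (dl + 1)); last by ring.
  rewrite -[leRHS]mulrA ler_wpM2l//; first by rewrite !mulr_ge0// ltW.
  have := mulr_ge0 dl0 (_ : 0 <= 2^-1 - ka).
  have := mulr_ge0 (ltW k0) (_ : 0 <= 2^-1 - ka).
  rewrite subr_ge0 => /(_ k2) h1 /(_ k2) h2; lra.
have hv : v0 = 2 * q0 ^+ 2 * beta ^+ 2 * (dl + M^-1) / ka * t - q0 * m.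
  by rewrite /v0 /L; set Mi := M^-1; field; rewrite gt_eqF.
have := mulr_ge0 (mulr_ge0 (mulr_ge0 (sqr_ge0 q0) (sqr_ge0 beta)) (ltW t0)) (ltW k0).
rewrite hv /m; lra.
Qed.

End participation_upper.

(** * The exponent of the Gibbs moments in the discrete model *)

Section gibbs_moment.
Context d (Om : measurableType d) (R : realType) (P : probability Om R).

(* [gibbs_moment F q beta] is [Z(q beta) / Z(beta)^q] for the partition function
   [Z(beta) = sum_i exp (beta F i)]. *)
Definition gibbs_moment (I : finType) (F : I -> Om -> R) (q beta : R) (w : Om) : R :=
  \sum_i expR (q * (beta * F i w - ln (\sum_j expR (beta * F j w)))).

Lemma participationE (V : lmodType R) (ev : V -> Om -> R) (I : finType) (x : I -> V) q beta w :
  participation ev x q beta w = gibbs_moment (fun i => ev (x i)) q beta w.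
Proof.
apply: eq_bigr => i _; congr (expR (_ * (_ - ln _))).
by apply: eq_bigl => j; rewrite finset.in_setT.
Qed.

Variables (I : finType) (F : I -> Om -> R).
Hypothesis mF : forall i, measurable_fun setT (F i).

Let Z beta w : R := \sum_j expR (beta * F j w).

Let gibbs_le1 i beta w : beta * F i w - ln (Z beta w) <= 0.
Proof.
have Zi : expR (beta * F i w) <= Z beta w.
  by rewrite /Z (bigD1 i)//= lerDl sumr_ge0// => j _; exact: expR_ge0.
rewrite subr_le0 -[leLHS]expRK ler_ln ?posrE ?expR_gt0//.
exact: lt_le_trans (expR_gt0 _) Zi.
Qed.

Lemma measurable_gibbs_moment q beta : measurable_fun setT (gibbs_moment F q beta).
Proof.
apply: measurable_sum => i; apply: measurableT_comp => //; apply: measurable_funM => //.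
apply: measurable_funB; first exact: measurable_funM.
apply: measurableT_comp; first exact: measurable_ln.
by apply: measurable_sum => j; apply: measurableT_comp => //; exact: measurable_funM.
Qed.

Lemma gibbs_moment_ge0 q beta w : 0 <= gibbs_moment F q beta w.
Proof. by apply: sumr_ge0 => i _; exact: expR_ge0. Qed.

Lemma gibbs_moment_le q q' beta w : q' <= q -> gibbs_moment F q beta w <= gibbs_moment F q' beta w.
Proof.
by move=> qq; apply: ler_sum => i _; rewrite ler_expR ler_wnM2r// gibbs_le1.
Qed.

Lemma gibbs_moment_le1 q beta w : 1 <= q -> gibbs_moment F q beta w <= 1.
Proof.
move=> q1; apply: le_trans (gibbs_moment_le beta w q1) _.
rewrite /gibbs_moment -/(Z beta w).
have [i0|] := pickP I; last first.
  by move=> I0; rewrite big1// => i; have := I0 i.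
move=> _.
have Z0 : 0 < Z beta w by rewrite /Z (bigD1 i0)//= ltr_pwDl ?expR_gt0// sumr_ge0// => j _; exact: expR_ge0.
rewrite (eq_bigr (fun i => expR (beta * F i w) / Z beta w)) => [|i _].
  by rewrite -mulr_suml divff// gt_eqF.
by rewrite mul1r expRD expRN lnK.
Qed.

(** ln Z(beta) / beta is nonincreasing: the Gibbs weights at beta' are at most 1, so their powers
    beta / beta' >= 1 sum to at most 1. *)
Lemma gibbs_moment_change_beta q beta beta' w : 0 <= q -> 0 < beta' <= beta ->
  gibbs_moment F (q * beta / beta') beta' w <= gibbs_moment F q beta w.
Proof.
move=> q0 /andP[b0 bb]; apply: ler_sum => i _; rewrite ler_expR -/(Z beta w) -/(Z beta' w).
have Z0 b : 0 < Z b w by rewrite /Z (bigD1 i)//= ltr_pwDl ?expR_gt0// sumr_ge0// => j _; exact: expR_ge0.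
pose r := beta / beta'.
have r1 : 1 <= r by rewrite ler_pdivlMr// mul1r.
have rb : r * beta' = beta by rewrite /r divfK// gt_eqF.
suff H : ln (Z beta w) <= r * ln (Z beta' w).
  rewrite (_ : q * beta / beta' * _ = q * (r * beta' * F i w - r * ln (Z beta' w))); last by rewrite /r; ring.
  by rewrite rb ler_wpM2l// lerD2l lerN2.
rewrite -[leRHS]expRK ler_ln ?posrE ?expR_gt0//.
rewrite -[leRHS]mul1r -ler_pdivrMr ?expR_gt0// -expRN {1}/Z mulr_suml.
apply: (@le_trans _ _ (\sum_j expR (beta' * F j w) / Z beta' w)); last first.
  by rewrite -mulr_suml -/(Z beta' w) divff// gt_eqF.
apply: ler_sum => j _; rewrite -expRD.
have -> : expR (beta' * F j w) / Z beta' w = expR (beta' * F j w - ln (Z beta' w)).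
  by rewrite expRD expRN lnK ?posrE.
rewrite ler_expR.
have := gibbs_le1 j beta' w; rewrite -rb.
nra.
Qed.

End gibbs_moment.

Section discrete_model.
Context d (Om : measurableType d) (R : realType) (P : probability Om R).

(* [F] is a log-correlated Gaussian field on the finite set [I] in dimension [dd] with
   variance [t], up to the relative error [dl]; [Ic] are slabs far apart from each other. *)
Definition log_correlated (I : finType) (F : I -> Om -> R) (M : nat) (dd t dl : R) : Prop :=
  exists (V : lmodType R) (ev : V -> Om -> R) (c : V -> V -> R) (n : nat) (x : I -> V)
    (tau : 'I_n -> R) (y : 'I_n -> I -> V) (Sh : 'I_n -> I -> {set I}) (Ic : 'I_M -> {set I}),
  [/\ gaussian_space P ev c, multiscale c x tau y Sh dd t dl,
      gaussian_family P F (fun i j => c (x i) (x j)) & forall i, ev (x i) = F i] /\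
  [/\ forall k l i j, k != l -> i \in Ic k -> j \in Ic l -> c (x i) (x j) <= dl * t,
      forall k, expR (t * (dd - dl)) <= #|Ic k|%:R,
      expR (t * (dd - dl)) <= #|I|%:R & #|I|%:R <= expR (t * (dd + dl))].

Lemma min_ge2 (a b x : R) : x <= Num.min a b -> x <= a /\ x <= b.
Proof. by rewrite le_min => /andP. Qed.

(** The errors force the order of choice: ka and lam, then d1, h and M, and dl after ka, lam, d1 and
    h, because it gets divided by ka, lam and h. The upper error has five terms of size e / 5, the
    lower one two of size e / 2. *)
Lemma gibbs_moment_bounds (dd q q0 beta e : R) : 0 <= dd -> 0 <= beta -> beta ^+ 2 <= 2 * dd ->
  0 < q0 <= q -> q0 * beta ^+ 2 <= dd + beta ^+ 2 / 2 -> 0 < e ->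
  exists (dl T0 : R) (M : nat), [/\ 0 < dl <= 1, (0 < M)%N & forall t (I : finType) (F : I -> Om -> R),
    T0 <= t -> log_correlated F M dd t dl ->
    ((expR (t * (dd + q0 ^+ 2 * beta ^+ 2 / 2 + q0 * (q - q0) * beta ^+ 2 - q * dd -
       q * beta ^+ 2 / 2 - e)))%:E <= \int[P]_w (gibbs_moment F q beta w)%:E)%E /\
    (\int[P]_w (gibbs_moment F q0 beta w)%:E <=
      (expR (t * (dd - q0 * dd + (q0 ^+ 2 - q0) * beta ^+ 2 / 2 + e)))%:E)%E].
Proof.
move=> dd0 be0 bed /andP[q00 q0q] q0be e0.
have q'0 : 0 < q by exact: lt_le_trans q0q.
have q'0' := ltW q'0; have q00' := ltW q00.
(* The added 1, here and below, keeps the divisors positive at beta = 0. *)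
pose a1 := 2 * q0 ^+ 2 * beta ^+ 2 + 1.
have a1_gt0 : 0 < a1 by rewrite ltr_wpDl// !mulr_ge0.
pose ka := Num.min 2^-1 (e / (5 * a1)).
have ka0 : 0 < ka by rewrite lt_min invr_gt0 ltr0n divr_gt0 ?mulr_gt0.
have [ka1 ka2] := min_ge2 (lexx ka).
pose a2 := 4 * q0 * beta ^+ 2 + 1.
have a2_gt0 : 0 < a2 by rewrite ltr_wpDl// !mulr_ge0.
pose lam := Num.min 1 (e / (5 * a2)).
have lam0 : 0 < lam by rewrite lt_min ltr01 divr_gt0 ?mulr_gt0.
have [lam1 lam2] := min_ge2 (lexx lam).
pose a3 := q0 * beta + 1.
have a3_gt0 : 0 < a3 by rewrite ltr_wpDl// !mulr_ge0.
pose d1 := e * lam / (10 * a3).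
have d10 : 0 < d1 by rewrite divr_gt0 ?mulr_gt0.
(* Each summand provides one condition: h <= 1, q h <= 1, h (q - q0) <= q0 and h q^2 beta^2 <= e /
   2. *)
pose h := (1 + q + q / q0 + 2 * q ^+ 2 * beta ^+ 2 / e)^-1.
have s1 : 0 <= 2 * q ^+ 2 * beta ^+ 2 / e by rewrite divr_ge0 ?(ltW e0)// !mulr_ge0.
have s2 : 0 <= q / q0 by rewrite divr_ge0// ltW.
have h'0 : 0 < 1 + q + q / q0 + 2 * q ^+ 2 * beta ^+ 2 / e.
  by rewrite -!addrA ltr_pwDl// !addr_ge0// ltW.
have h0 : 0 < h by rewrite invr_gt0.
have hX X : X <= 1 + q + q / q0 + 2 * q ^+ 2 * beta ^+ 2 / e -> h * X <= 1.
  by move=> H; rewrite /h mulrC ler_pdivrMr// mul1r.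
pose a4 := (q * beta + beta + 1) ^+ 2.
have a4_gt0 : 0 < a4 by rewrite exprn_gt0// ltr_wpDl// addr_ge0// mulr_ge0// ltW.
pose a5 := 1 + q0 ^+ 2 * beta ^+ 2.
have a5_gt0 : 0 < a5 by rewrite ltr_pwDl// !mulr_ge0.
pose a6 := q0 * (7 * beta ^+ 2 + 4).
have a6_gt0 : 0 < a6 by rewrite mulr_gt0// ltr_wpDl// mulr_ge0// sqr_ge0.
pose dl := Num.min 1 (Num.min (e / (5 * a5)) (Num.min (e * ka / (10 * a1)) (Num.min (e * lam / (10 * a6))
   (Num.min (d1 ^+ 2 / 16) (Num.min (d1 / (4 * beta + 1)) (e * h / (12 * a4))))))).
have b40 : 0 < 4 * beta + 1 by rewrite ltr_wpDl// mulr_ge0.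
have dl0 : 0 < dl.
  have p1 : 0 < e / (5 * a5) by rewrite divr_gt0 ?mulr_gt0.
  have p2 : 0 < e * ka / (10 * a1) by rewrite divr_gt0 ?mulr_gt0.
  have p3 : 0 < e * lam / (10 * a6) by rewrite divr_gt0 ?(mulr_gt0 _ a6_gt0) ?mulr_gt0.
  have p4 : 0 < d1 ^+ 2 / 16 by rewrite divr_gt0 ?exprn_gt0.
  have p5 : 0 < d1 / (4 * beta + 1) by rewrite divr_gt0.
  have p6 : 0 < e * h / (12 * a4) by rewrite divr_gt0 ?(mulr_gt0 _ a4_gt0) ?mulr_gt0.
  by rewrite !lt_min ltr01 p1 p2 p3 p4 p5 p6.
have [dl1 /min_ge2[dl2 /min_ge2[dl3 /min_ge2[dl4 /min_ge2[dl5 /min_ge2[dl6 dl7]]]]]] := min_ge2 (lexx dl).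
have d1E : d1 * (10 * a3) <= e * lam by rewrite /d1 divfK// gt_eqF// mulr_gt0.
clearbody dl d1 ka lam.
pose M := (Num.truncn (10 * a1 / (e * ka))).+1.
have M1 : M%:R^-1 <= e * ka / (10 * a1).
  rewrite -[leRHS]invrK invf_div lef_pV2 ?posrE ?divr_gt0 ?mulr_gt0//.
  by apply/ltW; rewrite /M truncnS_gt.
have M0 : (0 < M)%N by [].
clearbody h M.
(* The first term gives dl t >= 16; the second gives t d1^2 / 16 >= 1, so that exp(t (dl - d1^2 /
   8)) <= exp(-1) as dl <= d1^2 / 16. *)
exists dl, (16 / dl + 16 / d1 ^+ 2), M; split => //; first by rewrite dl0.
move=> t I F tT [V [ev [c [n [x [tau [y [Sh [Ic [[GS MS GF xF] [slab_far card_slab cardI1 cardI2]]]]]]]]]]].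
have FE : F = fun i => ev (x i) by apply/funext => i; rewrite xF.
have partE r w : gibbs_moment F r beta w = participation ev x r beta w by rewrite participationE FE.
have T1 : 16 / dl <= t by apply: le_trans tT; rewrite lerDl divr_ge0// ltW// exprn_gt0.
have T2 : 16 / d1 ^+ 2 <= t by apply: le_trans tT; rewrite lerDr divr_ge0// ltW.
have t0 : 0 < t by apply: lt_le_trans T1; rewrite divr_gt0.
split.
  rewrite (_ : (fun w => _) = fun w => (participation ev x q beta w)%:E); last by apply/funext => w; rewrite partE.
  apply: le_trans (participation_lower GS MS be0 _ q0be _ _ _ cardI1 (h := h)).
  - rewrite lee_fin ler_expR ler_pM2l// lerD2l lerN2.
    have : h * (2 * q ^+ 2 * beta ^+ 2 / e) <= 1 by apply: hX; rewrite lerDr !addr_ge0// ltW.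
    rewrite mulrA ler_pdivrMr// mul1r => H1.
    have : 6 * (q * beta + beta + 1) ^+ 2 * dl / h <= e / 2; last by lra.
    rewrite -/a4 ler_pdivrMr//; move: dl7; clearbody a4; rewrite ler_pdivlMr ?mulr_gt0//; clear; lra.
  - by rewrite (ltW q00).
  - by rewrite h0 -[leLHS]mulr1 hX// -!addrA lerDl !addr_ge0// ltW.
  - by rewrite mulrC hX// addrAC -!addrA addrCA lerDl !addr_ge0// ltW.
  - have : h * (q / q0) <= 1 by apply: hX; rewrite -addrA addrCA lerDl !addr_ge0// ltW.
    rewrite mulrA ler_pdivrMr// mul1r; apply: le_trans.
    by rewrite ler_wpM2l ?(ltW h0)// gerBl ltW.
rewrite (_ : (fun w => _) = fun w => (participation ev x q0 beta w)%:E); last by apply/funext => w; rewrite partE.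
rewrite FE in GF.
apply: le_trans (participation_upper GS MS GF _ slab_far card_slab cardI2 be0 bed _ d10 _ _ q00 _ _ (lam := lam) (ka := ka)) _.
- by rewrite card_ord.
- by rewrite lam0.
- move: dl6; rewrite ler_pdivlMr//; lra.
- by rewrite ka0.
- apply: (@le_trans _ _ (expR (- 1))).
    rewrite ler_expR; move: T2; rewrite ler_pdivrMr ?exprn_gt0// => T2.
    have := ler_wpM2l (ltW t0) dl5; lra.
  by rewrite expRN lef_pV2 ?posrE ?expR_gt0//; have := expR_ge1Dx (1 : R); lra.
- move: T1; rewrite ler_pdivrMr// mulrC => T1.
  by have := expR_ge1Dx (dl * t); lra.
rewrite lee_fin ler_expR ler_pM2l// lerD2l card_ord.
have E1 : dl * a5 <= e / 5 by move: dl2; rewrite ler_pdivlMr ?mulr_gt0//; clear; lra.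
have E2 : ka * a1 <= e / 5 by move: ka2; rewrite ler_pdivlMr ?mulr_gt0//; clear; lra.
have E3 : (dl + M%:R^-1) * a1 / ka <= e / 5.
  rewrite ler_pdivrMr//; move: dl3 M1; rewrite !ler_pdivlMr ?mulr_gt0//; clear; lra.
have E4 : q0 * (7 * beta ^+ 2 * dl + beta * d1 + 4 * dl) / lam <= e / 5.
  rewrite ler_pdivrMr//.
  move: d1E dl4 d10; rewrite ler_pdivlMr ?(mulr_gt0 _ a6_gt0)// /a6 /a3; clear; lra.
have E5 : lam * a2 <= e / 5 by move: lam2; rewrite ler_pdivlMr ?mulr_gt0//; clear; lra.
have E3' : 2 * q0 ^+ 2 * beta ^+ 2 * (dl + M%:R^-1) / ka <= (dl + M%:R^-1) * a1 / ka.
  rewrite ler_pM2r ?invr_gt0// [leLHS]mulrC ler_wpM2l ?addr_ge0 ?(ltW dl0)//.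
  by rewrite /a1 lerDl.
have E4' : q0 * ((7 * beta ^+ 2 * dl + beta * d1 + 4 * dl) / lam) <= e / 5 by rewrite mulrA.
move: E1 E2 E5 (le_trans E3' E3) E4' ka0 lam0; rewrite /a5 /a2 /a1; clear.
move: (_ / ka) (_ / lam) => A B; lra.
Qed.

(** The shift by dim (q - 1) removes from the exponent of the ratio of integrals the part due to the
    cell volumes. *)
Lemma gibbs_moment_exponent (dim : nat) (q beta e : R) : (0 < dim)%N -> 1 < q -> 0 <= beta -> 0 < e ->
  exists (dl T0 : R) (M : nat), [/\ 0 < dl <= 1, (0 < M)%N & forall t (I : finType) (F : I -> Om -> R),
    T0 <= t -> 0 < t -> log_correlated F M dim%:R t dl ->
    ((expR (- (t * (eta_tilde dim q beta + dim%:R * (q - 1) + e))))%:E <= \int[P]_w (gibbs_moment F q beta w)%:E)%E /\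
    (\int[P]_w (gibbs_moment F q beta w)%:E <=
      (expR (- (t * (eta_tilde dim q beta + dim%:R * (q - 1) - e))))%:E)%E].
Proof.
move=> dim0 q1 be0 e0; set dd : R := dim%:R.
have dd0 : 0 < dd by rewrite ltr0n.
have q0 : 0 < q by rewrite (lt_trans _ q1).
have q21 : 0 < 2 * q - 1 by lra.
have mgibbs M t dl (I : finType) (F : I -> Om -> R) q' b : log_correlated F M dd t dl ->
    measurable_fun setT (gibbs_moment F q' b).
  move=> [V [ev [c [n [x [tau [y [Sh [Ic [[_ _ [mF _] _] _]]]]]]]]]].
  exact: measurable_gibbs_moment.
have gibbs0 (I : finType) (F : I -> Om -> R) q' b w : 0 <= gibbs_moment F q' b w.
  by apply: sumr_ge0 => i _; exact: expR_ge0.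
rewrite /eta_tilde -/dd; case: ifPn => [b1|]; [|rewrite -leNgt => b1; case: ifPn => [b2|]].
- have b1' : beta ^+ 2 * (2 * q - 1) < 2 * dd by rewrite -ltr_pdivlMr.
  have := @gibbs_moment_bounds dd q q beta e (ltW dd0) be0.
  have sb := sqr_ge0 beta.
  case; rewrite ?q0 ?lexx//; try nra.
  move=> dl [T0 [M [dl01 M0 H]]]; exists dl, T0, M; split=> // t I F tT t0 LC.
  have [lo up] := H t I F tT LC; split.
    apply: le_trans lo; rewrite lee_fin ler_expR.
    clear; lra.
  apply: le_trans up _; rewrite lee_fin ler_expR.
  clear; lra.
- have b0 : 0 < beta ^+ 2 by apply: lt_le_trans b1; rewrite divr_gt0 ?mulr_gt0.
  have bn0 : beta != 0 by rewrite -sqrf_eq0 gt_eqF.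
  pose q' := 2^-1 + dd / beta ^+ 2.
  have q'E : q' * beta ^+ 2 = dd + beta ^+ 2 / 2 by rewrite /q'; field.
  have q'q : q' <= q.
    rewrite /q' -lerBrDl ler_pdivrMr//; move: b1; rewrite ler_pdivrMr//; lra.
  have q'0 : 0 < q' by rewrite ltr_pwDl ?invr_gt0// divr_ge0// ltW.
  have := @gibbs_moment_bounds dd q q' beta e (ltW dd0) be0.
  case; rewrite ?q'0 ?q'q ?q'E ?lexx// ?ltW//.
  move=> dl [T0 [M [dl01 M0 H]]]; exists dl, T0, M; split=> // t I F tT t0 LC.
  have [lo up] := H t I F tT LC.
  have sqE : q' ^+ 2 * beta ^+ 2 = (dd + beta ^+ 2 / 2) ^+ 2 / beta ^+ 2.
    by rewrite -q'E; field.
  have kE : (2 * dd - beta ^+ 2) ^+ 2 / (8 * beta ^+ 2) =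
      (dd + beta ^+ 2 / 2) ^+ 2 / beta ^+ 2 / 2 - dd.
    by field.
  rewrite kE -sqE; split.
    apply: le_trans lo; rewrite lee_fin ler_expR.
    have : q' * (q - q') * beta ^+ 2 = q * (dd + beta ^+ 2 / 2) - q' ^+ 2 * beta ^+ 2.
      by rewrite -q'E; ring.
    by move=> ->; clear; lra.
  apply: le_trans (le_trans _ up) _.
    apply: ge0_ler_integral => //; [exact: mgibbs LC|exact: mgibbs LC|].
    by move=> w _; exact: gibbs_moment_le.
  rewrite lee_fin ler_expR.
  have -> : (q' ^+ 2 - q') * beta ^+ 2 / 2 = q' ^+ 2 * beta ^+ 2 / 2 - (dd + beta ^+ 2 / 2) / 2.
    by rewrite -q'E; ring.
  have : q' * dd = q' * (dd + beta ^+ 2 / 2) - q' * beta ^+ 2 / 2 by ring.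
  have : q' * (dd + beta ^+ 2 / 2) = q' ^+ 2 * beta ^+ 2 by rewrite -q'E; ring.
  move=> E1 E2; rewrite E2 E1 q'E; clear; lra.
rewrite -leNgt => b2.
have b0 : 0 < beta.
  by rewrite lt_neqAle be0 andbT; apply/eqP => b0; move: b2; rewrite -b0 expr0n/=; lra.
(* At b'^2 = 2 dd the cut-off 1/2 + dd / b'^2 is 1, and the main terms of the lower bound cancel for
   every q', in agreement with V <= 1. *)
pose b' := Num.sqrt (2 * dd).
have b'2 : b' ^+ 2 = 2 * dd by rewrite sqr_sqrtr// mulr_ge0// ltW.
have b'0 : 0 < b' by rewrite sqrtr_gt0 mulr_gt0.
have b'b : b' <= beta by rewrite -(@ler_pXn2r _ 2)// ?nnegrE ?(ltW b'0)// b'2.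
pose q' := q * beta / b'.
have q'1 : 1 <= q'.
  by rewrite ler_pdivlMr// mul1r; apply: le_trans b'b _; rewrite ler_peMl// ltW.
have := @gibbs_moment_bounds dd q' 1 b' e (ltW dd0) (ltW b'0).
case; rewrite ?b'2 ?ltr01//; try lra.
move=> dl [T0 [M [dl01 M0 H]]]; exists dl, T0, M; split=> // t I F tT t0 LC.
have [lo _] := H t I F tT LC; split.
  apply: (@le_trans _ _ (\int[P]_w (gibbs_moment F q' b' w)%:E)%E).
    apply: le_trans lo; rewrite lee_fin ler_expR expr1n.
    by clear; lra.
  apply: ge0_ler_integral; [by []|exact: mgibbs LC|exact: mgibbs LC|by move=> w _; exact: gibbs0|].
  by move=> w _; apply: gibbs_moment_change_beta; rewrite ?b'0// ltW.
apply: (@le_trans _ _ (\int[P]_w 1%:E)%E).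
  apply: ge0_ler_integral => //; first exact: mgibbs LC.
  by move=> w _; rewrite gibbs_moment_le1// ltW.
rewrite integral_cst//= probability_setT mule1 lee_fin -[leLHS]expR0 ler_expR.
by have := mulr_ge0 (ltW t0) (ltW e0); lra.
Qed.

End discrete_model.

(** * The grid *)

Section cosh.
Variable R : realType.

(** From cosh(2 u) = 1 + 2 sinh(u)^2 and sinh u >= u. *)
Lemma cosh_ge (y : R) : 2 + y ^+ 2 <= expR y + expR (- y).
Proof.
have sh (u : R) : 0 <= u -> 2 * u <= expR u - expR (- u).
  rewrite le_eqVlt => /predU1P[<-|u0]; first by rewrite mulr0 oppr0 subrr.
  have df z : is_derive z (1 : R) (fun z : R => expR z - expR (- z)) (expR z + expR (- z)).
    by apply: is_derive_eq; rewrite /GRing.scale/=; ring.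
  have cf : {within `[0, u], continuous (fun z : R => expR z - expR (- z))}.
    apply: continuous_subspaceT => z; apply: (@cvgB _ R^o).
      exact: continuous_expR.
    apply: (@continuous_comp R R R (fun z => - z) expR); last exact: continuous_expR.
    exact: opp_continuous.
  have [z _] := MVT u0 (fun z _ => df z) cf.
  rewrite !oppr0 expR0 subrr !subr0 addr0 => ->.
  rewrite ler_wpM2r ?(ltW u0)//.
  rewrite expRN; have e0 := expR_gt0 z; move: (expR z) e0 => e e0.
  rewrite -subr_ge0 (_ : _ - _ = (e - 1) ^+ 2 / e); last by field; rewrite gt_eqF.
  by rewrite divr_ge0 ?sqr_ge0 ?ltW.
have sq (u : R) : 0 <= u -> 2 + (2 * u) ^+ 2 <= expR (2 * u) + expR (- (2 * u)).
  move=> u0; have := sh _ u0; have e1 : expR u * expR (- u) = 1 by exact: expRxMexpNx_1.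
  rewrite (_ : - (2 * u) = - u + - u); last by ring.
  rewrite (_ : 2 * u = u + u) ?expRD; last by ring.
  move: (expR u) (expR (- u)) e1 => a b ab h.
  have : (u + u) ^+ 2 <= (a - b) ^+ 2 by rewrite ler_pXn2r// ?nnegrE; lra.
  lra.
have [y0|y0] := leP 0 y.
  by have := sq (y / 2); rewrite (_ : 2 * (y / 2) = y); [apply; rewrite divr_ge0|field].
have := sq (- y / 2); rewrite (_ : 2 * (- y / 2) = - y); last by field.
by rewrite opprK sqrrN [expR (- y) + _]addrC; apply; rewrite divr_ge0// oppr_ge0 ltW.
Qed.

Lemma cos_ge (y : R) : 1 - y ^+ 2 / 2 <= cos y.
Proof.
have [y0|y0] := leP 0 y; first by have := onem_cos_le y0; lra.
by have := @onem_cos_le R (- y); rewrite cosN sqrrN oppr_ge0 => /(_ (ltW y0)); lra.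
Qed.

End cosh.

(** * Second moments, and the Gaussian vectors extracted from a field *)

Section gaussian_variance.
Context d (Om : measurableType d) (R : realType) (P : probability Om R).
Variables (Y : Om -> R) (v : R).
Hypothesis Yv : centred_gaussian_rv P Y v.

(** The second moment is squeezed between the moment generating function, through 2 + y^2 <= exp y +
    exp(- y), and the characteristic function, through 1 - y^2 / 2 <= cos y, at y = t Y with t -> 0.
    The first inequality also gives finiteness. *)
Lemma gaussian_rv_variance : (\int[P]_w (Y w ^+ 2)%:E = v%:E)%E.
Proof.
have v0 : 0 <= v by case: Yv.
have mY := measurable_gaussian_rv Yv.
have mY2 : measurable_fun setT (fun w => Y w ^+ 2) by exact: measurable_funX.
have mexp t : measurable_fun setT (fun w => expR (t * Y w)).
  by apply: measurableT_comp => //; exact: measurable_funM.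
have Y0 w : 0 <= Y w ^+ 2 by exact: sqr_ge0.
set I := (\int[P]_w (Y w ^+ 2)%:E)%E.
have I0 : (0 <= I)%E by apply: integral_ge0 => w _; rewrite lee_fin.
have up t : ((2%:E + (t ^+ 2)%:E * I) <= (2 * expR (t ^+ 2 * v / 2))%:E)%E.
  have -> : ((2 * expR (t ^+ 2 * v / 2))%:E =
      \int[P]_w (expR (t * Y w))%:E + \int[P]_w (expR (- t * Y w))%:E)%E.
    by rewrite !(gaussian_rv_mgf Yv) sqrrN -EFinD; congr EFin; ring.
  rewrite -ge0_integral_addr//.
  have -> : 2%:E = (\int[P]_w (2 : R)%:E)%E by rewrite integral_cst//= probability_setT mule1.
  rewrite /I -ge0_integral_mulr ?sqr_ge0// -ge0_integral_addr//; last 2 first.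
  - exact: measurable_funM.
  - by move=> w; rewrite mulr_ge0 ?sqr_ge0.
  apply: ge0_ler_integral => //.
  - by apply: measurable_funD => //; exact: measurable_funM.
  - by apply: measurable_funD.
  - by move=> w _; rewrite addr_ge0// mulr_ge0 ?sqr_ge0.
  by move=> w _; rewrite mulNr -exprMn; exact: cosh_ge.
have lo t : (2%:E <= (t ^+ 2 / 2)%:E * I + (1 + expR (- (v * t ^+ 2 / 2)))%:E)%E.
  have := gaussian_rv_cos Yv t 0; rewrite cos0 mul1r => <-.
  have -> : 2%:E = (\int[P]_w (2 : R)%:E)%E by rewrite integral_cst//= probability_setT mule1.
  have mc : measurable_fun setT (fun w => 1 + cos (t * Y w + 0)).
    apply: measurable_funD => //; apply: (@measurable_cos_comp _ _ _ (fun w => t * Y w + 0)).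
    by apply: measurable_funD => //; exact: measurable_funM.
  have c0 w : 0 <= 1 + cos (t * Y w + 0) by have := cos_geN1 (t * Y w + 0); lra.
  rewrite /I -ge0_integral_mulr ?divr_ge0 ?sqr_ge0// -ge0_integral_addr//; last 2 first.
  - exact: measurable_funM.
  - by move=> w; rewrite mulr_ge0 ?divr_ge0 ?sqr_ge0.
  apply: ge0_ler_integral => //.
  - by apply: measurable_funD => //; exact: measurable_funM.
  move=> w _; rewrite addr0; have := cos_ge (t * Y w); rewrite exprMn; lra.
case: I I0 up lo => [m| |]//; last first.
  by move=> _ /(_ 1) + _; rewrite expr1n mul1e addey.
rewrite lee_fin => m0 up lo.
have up' s : 0 < s -> m * (1 - s * v) <= v.
  move=> s0; have s20 : 0 <= 2 * s by rewrite mulr_ge0// ltW.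
  have := up (Num.sqrt (2 * s)); rewrite sqr_sqrtr//.
  rewrite -EFinM -EFinD lee_fin (_ : 2 * s * v / 2 = s * v); last by field.
  have e : expR (s * v) * expR (- (s * v)) = 1 by exact: expRxMexpNx_1.
  have := expR_ge1Dx (- (s * v)); have := expR_gt0 (s * v); have := expR_gt0 (- (s * v)).
  move: (expR _) (expR _) e => b a ab b0 a0 bs H.
  have H1 : 1 + s * m <= a by lra.
  have [sv|sv] := leP (1 - s * v) 0.
    by apply: le_trans v0; rewrite mulr_ge0_le0.
  have : (1 + s * m) * (1 - s * v) <= a * b.
    by apply: ler_pM => //; [rewrite addr_ge0// mulr_ge0// ltW|exact: ltW].
  rewrite ab; have -> : (1 + s * m) * (1 - s * v) = 1 + s * (m * (1 - s * v) - v) by ring.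
  by rewrite gerDl pmulr_rle0// subr_le0.
have lo' s : 0 < s -> v <= m * (1 + s * v).
  move=> s0; have s20 : 0 <= 2 * s by rewrite mulr_ge0// ltW.
  have := lo (Num.sqrt (2 * s)); rewrite sqr_sqrtr//.
  rewrite -EFinM -EFinD lee_fin (_ : v * (2 * s) / 2 = s * v); last by field.
  rewrite (_ : 2 * s / 2 = s); last by field.
  have e : expR (s * v) * expR (- (s * v)) = 1 by exact: expRxMexpNx_1.
  have := expR_ge1Dx (s * v); have := expR_gt0 (s * v); have := expR_gt0 (- (s * v)).
  move: (expR (s * v)) (expR (- (s * v))) e => a b ab b0 a0 bs H.
  have H1 : 1 - s * m <= b by lra.
  have sv0 : 0 <= s * v by rewrite mulr_ge0// ltW.
  have : b * (1 + s * v) <= 1 by rewrite -[leRHS]ab [a * b]mulrC ler_wpM2l// ltW.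
  have : (1 - s * m) * (1 + s * v) <= b * (1 + s * v) by rewrite ler_wpM2r// addr_ge0.
  move=> h1 h2; have := le_trans h1 h2.
  have -> : (1 - s * m) * (1 + s * v) = 1 + s * (v - m * (1 + s * v)) by ring.
  by rewrite gerDl pmulr_rle0// subr_le0.
have mv0 : 0 <= m * v by rewrite mulr_ge0.
congr EFin; apply/eqP; rewrite eq_le; apply/andP; split; apply/ler_addgt0Pr => e e0.
  have sp : 0 < e / (m * v + 1) by rewrite divr_gt0// ltr_wpDl.
  have := up' _ sp; set r := e / _.
  have : r * (m * v) <= e.
    by rewrite /r mulrAC ler_pdivrMr ?ltr_wpDl// ler_wpM2l ?(ltW e0)// lerDl.
  lra.
have sp : 0 < e / (m * v + 1) by rewrite divr_gt0// ltr_wpDl.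
have := lo' _ sp; set r := e / _.
have : r * (m * v) <= e.
  by rewrite /r mulrAC ler_pdivrMr ?ltr_wpDl// ler_wpM2l ?(ltW e0)// lerDl.
lra.
Qed.

End gaussian_variance.

Section gaussian_field.
Context d (Om : measurableType d) (R : realType) (P : probability Om R).
Variables (dim : nat) (D : set (dim.-tuple R)) (X : Om -> dim.-tuple R -> R)
  (K : dim.-tuple R -> dim.-tuple R -> R).
Hypothesis GX : centred_gaussian_field P D X.
Hypothesis XK : forall x y, D x -> D y -> ('E_P[(fun w => X w x * X w y)%R])%E = (K x y)%:E.

Lemma gaussian_field_rv (J : finType) (pts : J -> dim.-tuple R) (a : J -> R) :
  (forall j, D (pts j)) -> exists v, centred_gaussian_rv P (fun w => \sum_j a j * X w (pts j)) v.
Proof.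
move=> Dp; have [v Hv] := GX (fun i : 'I_#|J| => a (enum_val i)) (fun i => Dp (enum_val i)).
exists v; move: Hv; congr (centred_gaussian_rv P _ v); apply/funext => w.
by rewrite [RHS](reindex (fun i : 'I_#|J| => enum_val i))//; apply: onW_bij; exact: enum_val_bij.
Qed.

(** [centred_gaussian_field] only grants each linear combination some variance; equating second
    moments identifies it with the quadratic form of K. *)
Lemma gaussian_field_family (J : finType) (pts : J -> dim.-tuple R) :
  (forall j, D (pts j)) ->
  gaussian_family P (fun j w => X w (pts j)) (fun j k => K (pts j) (pts k)).
Proof.
move=> Dp.
have one j : exists v, centred_gaussian_rv P (fun w => X w (pts j)) v.
  have [v] := gaussian_field_rv (fun k => (k == j)%:R) Dp; rewrite (_ : (fun w => _) = fun w => X w (pts j)).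
    by exists v.
  apply/funext => w; rewrite (bigD1 j)//= eqxx mul1r big1 ?addr0// => k /negPf ->.
  by rewrite mul0r.
have mX j : measurable_fun setT (fun w => X w (pts j)).
  by have [v] := one j; exact: measurable_gaussian_rv.
have int2 j : P.-integrable setT (EFin \o (fun w => X w (pts j) ^+ 2)).
  have [v Hv] := one j.
  apply/integrableP; split; first by apply/measurable_EFinP; exact: measurable_funX.
  rewrite (eq_integral (fun w => (X w (pts j) ^+ 2)%:E)) ?(gaussian_rv_variance Hv) ?ltry// => w _.
  by rewrite /= ger0_norm// sqr_ge0.
have intM j k : P.-integrable setT (EFin \o (fun w => X w (pts j) * X w (pts k))).
  apply: (@le_integrable _ _ _ P setT measurableT _ (EFin \o (fun w => X w (pts j) ^+ 2 + X w (pts k) ^+ 2))) => //.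
  - by apply/measurable_EFinP; exact: measurable_funM.
  - move=> w _ /=; rewrite lee_fin normrM [leRHS]ger0_norm ?addr_ge0 ?sqr_ge0//.
    rewrite -(real_normK (num_real (X w (pts j)))) -(real_normK (num_real (X w (pts k)))).
    have := sqr_ge0 (`|X w (pts j)| - `|X w (pts k)|); have := sqr_ge0 `|X w (pts j)|; have := sqr_ge0 `|X w (pts k)|.
    by move: `|_| `|X w (pts k)| => a b; nra.
  - rewrite (_ : EFin \o _ = (EFin \o (fun w => X w (pts j) ^+ 2)) \+ (EFin \o (fun w => X w (pts k) ^+ 2)))//.
    exact: integrableD.
split=> // a; have [v Hv] := gaussian_field_rv a Dp.
suff -> : \sum_j \sum_k a j * a k * K (pts j) (pts k) = v by [].
apply: EFin_inj; rewrite -(gaussian_rv_variance Hv).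
rewrite (_ : (fun w => _) = fun w => \sum_j \sum_k (a j * a k)%:E * (X w (pts j) * X w (pts k))%:E)%E; last first.
  apply/funext => w; rewrite expr2 mulr_suml -sumEFin; apply: eq_bigr => j _.
  rewrite mulr_sumr -sumEFin; apply: eq_bigr => k _.
  by rewrite -EFinM; congr EFin; ring.
have intaM j k : P.-integrable setT (fun w => (a j * a k)%:E * (X w (pts j) * X w (pts k))%:E)%E.
  exact: (integrableZl _ _ (intM j k)).
rewrite integral_sum//; last first.
  by move=> j; apply: integrable_sum => // k _; exact: intaM.
rewrite -sumEFin; apply: eq_bigr => j _; rewrite integral_sum//.
rewrite -sumEFin; apply: eq_bigr => k _; rewrite integralZl//; last exact: intM.
by rewrite EFinM -XK// unlock.
Qed.

Variables (J : finType) (pts : J -> dim.-tuple R).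
Hypothesis Dpts : forall j, D (pts j).

Let V : lmodType R := {ffun J -> R^o}.

Definition field_ev (a : V) (w : Om) : R := \sum_j a j * X w (pts j).
Definition field_cov (a b : V) : R := \sum_j \sum_k a j * b k * K (pts j) (pts k).
Definition dirac_vec (j : J) : V := [ffun k => (k == j)%:R].

Lemma field_ev_dirac j w : field_ev (dirac_vec j) w = X w (pts j).
Proof.
rewrite /field_ev (bigD1 j)//= ffunE eqxx mul1r big1 ?addr0// => k /negPf kj.
by rewrite ffunE kj mul0r.
Qed.

Lemma field_cov_dirac j k : field_cov (dirac_vec j) (dirac_vec k) = K (pts j) (pts k).
Proof.
rewrite /field_cov (bigD1 j)//= [X in _ + X]big1 ?addr0 => [|i /negPf ij]; last first.
  by rewrite big1// => l _; rewrite ffunE ij !mul0r.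
rewrite (bigD1 k)//= big1 ?addr0 => [|i /negPf ij]; first by rewrite !ffunE !eqxx !mul1r.
by rewrite !ffunE ij mulr0 mul0r.
Qed.

Lemma gaussian_field_space : gaussian_space P field_ev field_cov.
Proof.
have [mX GJ] := gaussian_field_family Dpts.
split.
- move=> a u v w; rewrite /field_ev mulr_sumr -big_split/=; apply: eq_bigr => j _.
  by rewrite !ffunE /GRing.scale/=; ring.
- move=> a u v z; rewrite /field_cov mulr_sumr -big_split/=; apply: eq_bigr => j _.
  rewrite mulr_sumr -big_split/=; apply: eq_bigr => k _.
  by rewrite !ffunE /GRing.scale/=; ring.
- move=> u v; rewrite /field_cov exchange_big/=; apply: eq_bigr => k _; apply: eq_bigr => j _.
  have -> : K (pts j) (pts k) = K (pts k) (pts j).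
    apply: EFin_inj; rewrite -!XK//; congr expectation; apply/funext => w; exact: mulrC.
  by rewrite [u _ * _]mulrC.
- by move=> u; apply: measurable_sum => j; exact: measurable_funM.
move=> u; have := gaussian_rv_mgf (GJ u) 1; rewrite expr1n mul1r => <-.
by apply: eq_integral => w _; rewrite mul1r.
Qed.

End gaussian_field.

Section dist1.
Variables (R : realType) (d : nat).
Implicit Types x y z : d.-tuple R.

(** The l1 distance dominates each coordinate and splits over them; in the kernel it replaces the
    Euclidean distance at the price of ln d, by [log_kernel_dist1]. *)
Definition dist1 x y : R := \sum_(i < d) `|tnth x i - tnth y i|.

Lemma dist1_ge0 x y : 0 <= dist1 x y. Proof. exact: sumr_ge0. Qed.

Lemma dist1_coord x y i : `|tnth x i - tnth y i| <= dist1 x y.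
Proof. by rewrite /dist1 (bigD1 i)//= lerDl sumr_ge0. Qed.

Lemma dist1_triangle x y z : dist1 x z <= dist1 x y + dist1 y z.
Proof.
by rewrite /dist1 -big_split/=; apply: ler_sum => i _; exact: ler_distD.
Qed.

Lemma eucl_dist_le1 x y : eucl_dist x y <= dist1 x y.
Proof.
rewrite /eucl_dist -(ger0_norm (dist1_ge0 x y)) -sqrtr_sqr ler_wsqrtr//.
rewrite expr2 {1}/dist1 mulr_suml; apply: ler_sum => i _.
by rewrite -real_normK ?num_real// expr2 ler_wpM2l// dist1_coord.
Qed.

Lemma dist1_le_eucl x y : dist1 x y <= d%:R * eucl_dist x y.
Proof.
rewrite /dist1.
apply: (@le_trans _ _ (\sum_(i < d) eucl_dist x y)); last first.
  by rewrite big_const_ord iter_addr_0 -[leLHS]mulr_natl.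
apply: ler_sum => i _; rewrite /eucl_dist -sqrtr_sqr ler_wsqrtr// (bigD1 i)//= lerDl.
by apply: sumr_ge0 => j _; exact: sqr_ge0.
Qed.

Lemma log_kernel_dist1 eps a Cg x y : (0 < d)%N -> 0 < eps -> `|a| <= Cg ->
  `|- ln (eucl_dist x y + eps) + a + ln (dist1 x y + eps)| <= ln d%:R + Cg.
Proof.
move=> d0 e0 /ler_normlP[a1 a2].
have eu0 : 0 <= eucl_dist x y by exact: sqrtr_ge0.
have d1 : 1 <= d%:R :> R by rewrite ler1n.
have p1 : 0 < eucl_dist x y + eps by rewrite ltr_wpDl.
have p2 : 0 < dist1 x y + eps by rewrite ltr_wpDl ?dist1_ge0.
have l1 : ln (eucl_dist x y + eps) <= ln (dist1 x y + eps).
  by rewrite ler_ln ?posrE// lerD2r eucl_dist_le1.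
have l2 : ln (dist1 x y + eps) <= ln d%:R + ln (eucl_dist x y + eps).
  rewrite -lnM ?posrE ?ltr0n// ler_ln ?posrE ?mulr_gt0 ?ltr0n// mulrDr lerD ?dist1_le_eucl//.
  by rewrite ler_peMl// ltW.
by apply/ler_normlP; split; lra.
Qed.

End dist1.

Lemma ler_truncn (R : archiNumDomainType) (x : R) : 0 <= x -> (Num.truncn x)%:R <= x.
Proof. by rewrite truncn_le. Qed.

Lemma card_ord_interval n (a b : nat) : (#|[pred j : 'I_n | (a <= j <= b)%N]| <= b.+1 - a)%N.
Proof.
rewrite -[X in (_ <= X)%N](size_iota a) cardE -(size_map val).
apply: uniq_leq_size; first by rewrite map_inj_uniq ?enum_uniq//; exact: val_inj.
move=> z /mapP[j]; rewrite mem_enum inE => /andP[aj jb] ->.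
by rewrite mem_iota aj/=; lia.
Qed.

Lemma card_ord_interval_eq n (a w : nat) : (a + w <= n)%N -> #|[pred j : 'I_n | (a <= j < a + w)%N]| = w.
Proof.
move=> awn; rewrite -[RHS](size_iota a) cardE -(size_map val); apply/perm_size/uniq_perm.
- by rewrite map_inj_uniq ?enum_uniq//; exact: val_inj.
- exact: iota_uniq.
move=> z; rewrite mem_iota; apply/mapP/idP => [[j]|zin].
  by rewrite mem_enum inE => H ->.
have zn : (z < n)%N by lia.
by exists (Ordinal zn); rewrite ?mem_enum ?inE.
Qed.

Lemma interval_length (a q : nat) : ((a + q).+1 - (a - q) <= 2 * q + 1)%N.
Proof. by lia. Qed.

Lemma slab_arith1 (n M w r : nat) : n = (w * M + r)%N -> (r < M)%N -> (M <= w * M)%N -> (n <= 2 * M * w)%N.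
Proof. by nia. Qed.

Lemma slab_arith2 (s s' w a b : nat) : (s < s')%N -> (2 * s' * w <= b)%N -> (a < 2 * s * w + w)%N ->
  (w + a <= b)%N.
Proof. by move=> ss; have : (s.+1 * w <= s' * w)%N by [rewrite leq_mul2r ss orbT]; nia. Qed.

Lemma slab_arith3 (k M w n : nat) : (k < M)%N -> (w * M <= n)%N -> (2 * k * w + w <= 2 * n)%N.
Proof. by move=> kM; have : (k.+1 * w <= M * w)%N by [rewrite leq_mul2r kM orbT]; nia. Qed.

(** * Multiscale structure of the grid *)

Section geometry.
Context dO (Om : measurableType dO) (R : realType) (P : probability Om R).
Variables (d : nat) (o : 'I_d) (D : set (d.-tuple R)) (X : Om -> d.-tuple R -> R)
  (K : d.-tuple R -> d.-tuple R -> R).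
Hypothesis GX : centred_gaussian_field P D X.
Hypothesis XK : forall x y, D x -> D y -> ('E_P[(fun w => X w x * X w y)%R])%E = (K x y)%:E.
Hypothesis DD : sym_cube d 2 `<=` D.
Variables (t C1 dl : R) (N L M : nat).
Hypothesis KB : forall x y, D x -> D y -> `|K x y + ln (dist1 x y + expR (- t))| <= C1.
Hypotheses (t0 : 0 < t) (N0 : (0 < N)%N) (L0 : (0 < L)%N) (M0 : (0 < M)%N) (C10 : 0 <= C1).
Hypothesis dl01 : 0 <= dl <= 1.

Let D0 : R := 2 * d%:R + 1.
(** One term for each source of error: the size of the shells, the kernel, the averages over L
    points, the M slabs, and the number of scales. *)
Hypothesis err : d%:R * (ln (6 * D0) + t / N%:R) + C1 + ln (2 * L%:R) + t / L%:R +
  ln (4 * M%:R) + ln N.+1%:R <= dl * t.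

Let eps := expR (- t).
Definition mesh : nat := (Num.truncn (expR t)).+1.
Let m : R := mesh%:R.
Let I : finType := {ffun 'I_d -> 'I_(2 * mesh)}.

Definition grid_point (i : {ffun 'I_d -> 'I_(2 * mesh)}) : d.-tuple R := [tuple - 1 + (i l)%:R / m | l < d].
Let pt := grid_point.
Let tau (k : 'I_N.+1) : R := k%:R / N%:R.
Let r k := expR (- (tau k * t)).
(** The average at scale [r k] runs over L points of a segment of length at most [r k] in direction
    o, so that it stays in a finite Gaussian vector. At most one of the points has its coordinate o
    closer than r k / (2 L) to that of a given point, so the logarithmic singularity contributes at
    most t / L. *)
Let aux k (i : I) (l : 'I_L) : d.-tuple R :=
  [tuple tnth (pt i) j + (if j == o then l%:R / L%:R * r k else 0) | j < d].

Let m0 : 0 < m. Proof. by rewrite ltr0n. Qed.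
Let mlo : expR t < m. Proof. by rewrite /m /mesh truncnS_gt. Qed.
Let mhi : m <= 2 * expR t.
Proof.
rewrite /m /mesh -natr1; have := ler_truncn (expR_ge0 t); have : 1 <= expR t by rewrite -expR0 ler_expR ltW.
by move=> ? ?; lra.
Qed.
Let d1 : 1 <= d%:R :> R. Proof. by rewrite ler1n (leq_ltn_trans _ (ltn_ord o)). Qed.
Let D0ge : 3 <= D0. Proof. by have := d1; rewrite /D0; lra. Qed.
Let lnD0 : 0 <= ln (6 * D0). Proof. by apply: ln_ge0; have := D0ge; lra. Qed.
Let tN0 : 0 <= t / N%:R. Proof. by rewrite divr_ge0// ltW. Qed.
Let tL0 : 0 <= t / L%:R. Proof. by rewrite divr_ge0// ltW. Qed.
Let lnL0 : 0 <= ln (2 * L%:R : R).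
Proof. by apply: ln_ge0; have : (1 : R) <= L%:R by [rewrite ler1n]; lra. Qed.
Let lnM0 : 0 <= ln (4 * M%:R : R).
Proof. by apply: ln_ge0; have : (1 : R) <= M%:R by [rewrite ler1n]; lra. Qed.
Let lnN0 : 0 <= ln (N.+1%:R : R).
Proof. by apply: ln_ge0; rewrite ler1n. Qed.
Let dA : ln (6 * D0) + t / N%:R <= d%:R * (ln (6 * D0) + t / N%:R).
Proof. by rewrite ler_peMl// addr_ge0. Qed.

Ltac slra := move: (d1) (D0ge) (lnD0) (tN0) (tL0) (lnL0) (lnM0) (lnN0) (dA) (err) (t0) (C10); intros; lra.

Let tau01 k : 0 <= tau k <= 1.
Proof.
rewrite /tau divr_ge0//= ler_pdivrMr ?ltr0n// mul1r ler_nat.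
by have := ltn_ord k; rewrite ltnS.
Qed.
Let r_gt0 k : 0 < r k. Proof. exact: expR_gt0. Qed.
Let r_le1 k : r k <= 1.
Proof. by rewrite -expR0 ler_expR oppr_le0 mulr_ge0 ?(ltW t0)//; case/andP: (tau01 k). Qed.
Let eps_le_r k : eps <= r k.
Proof. by rewrite ler_expR lerN2 ler_piMl ?(ltW t0)//; case/andP: (tau01 k). Qed.
Let eps0 : 0 < eps. Proof. exact: expR_gt0. Qed.
Let ln_r k : ln (r k) = - (tau k * t). Proof. exact: expRK. Qed.

Lemma tnth_grid_point i l : tnth (grid_point i) l = - 1 + (i l)%:R / m.
Proof. by rewrite tnth_mktuple. Qed.

Let tnth_aux k i l j : tnth (aux k i l) j = tnth (pt i) j + (if j == o then l%:R / L%:R * r k else 0).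
Proof. by rewrite tnth_mktuple. Qed.

Lemma grid_point_bound i l : - 1 <= tnth (grid_point i) l <= 1.
Proof.
rewrite tnth_grid_point lerDl divr_ge0//= addrC lerBlDr ler_pdivrMr//.
rewrite /m (_ : 1 + 1 = 2%:R)// -natrM ler_nat; apply: ltnW; exact: ltn_ord.
Qed.

Let lL (l : 'I_L) : 0 <= l%:R / L%:R :> R. Proof. by rewrite divr_ge0. Qed.
Let lL1 (l : 'I_L) : l%:R / L%:R <= 1 :> R.
Proof. by rewrite ler_pdivrMr ?ltr0n// mul1r ler_nat ltnW. Qed.
Let lLr k (l : 'I_L) : 0 <= l%:R / L%:R * r k <= r k.
Proof. by rewrite mulr_ge0 ?(ltW (r_gt0 k))//= ler_piMl ?(ltW (r_gt0 k)). Qed.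

Let D_pt i : D (pt i).
Proof. by apply: DD => l; have /andP[] := grid_point_bound i l; rewrite /pt; slra. Qed.

Let D_aux k i l : D (aux k i l).
Proof.
apply: DD => j; rewrite tnth_aux; have /andP[] := grid_point_bound i j; rewrite /pt.
have /andP[] := lLr k l; have := r_le1 k.
by case: ifP => _; slra.
Qed.

Let dist_shift k i l l' : dist1 (aux k i l) (aux k i l') <= r k.
Proof.
rewrite /dist1 (bigD1 o)//= big1 ?addr0 => [|j /negPf jo].
  rewrite !tnth_aux eqxx; have /andP[? ?] := lLr k l; have /andP[? ?] := lLr k l'.
  by apply/ler_normlP; split; slra.
by rewrite !tnth_aux jo subrr normr0.
Qed.

Let dist_pt_aux k i l : dist1 (pt i) (aux k i l) <= r k.
Proof.
rewrite /dist1 (bigD1 o)//= big1 ?addr0 => [|j /negPf jo].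
  by rewrite tnth_aux eqxx opprD addrA subrr add0r normrN ger0_norm; case/andP: (lLr k l).
by rewrite tnth_aux jo addr0 subrr normr0.
Qed.

Let K_up x y : D x -> D y -> K x y <= - ln (dist1 x y + eps) + C1.
Proof. by move=> Dx Dy; have /ler_normlP[] := KB Dx Dy; rewrite -/eps; slra. Qed.

Let K_lo x y : D x -> D y -> - ln (dist1 x y + eps) - C1 <= K x y.
Proof. by move=> Dx Dy; have /ler_normlP[] := KB Dx Dy; rewrite -/eps; slra. Qed.

Let K_le x y a : D x -> D y -> 0 < a -> a <= dist1 x y + eps -> K x y <= - ln a + C1.
Proof.
move=> Dx Dy a0 ax; apply: le_trans (K_up Dx Dy) _; rewrite lerD2r lerN2 ler_ln ?posrE//.
exact: lt_le_trans ax.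
Qed.

Let K_ge x y a : D x -> D y -> 0 < a -> dist1 x y + eps <= a -> - ln a - C1 <= K x y.
Proof.
move=> Dx Dy a0 ax; apply: le_trans _ (K_lo Dx Dy); rewrite lerD2r lerN2 ler_ln ?posrE//.
by rewrite ltr_wpDl ?dist1_ge0.
Qed.

Let avg_up p k i : D p -> L%:R^-1 * (\sum_l K p (aux k i l)) <= tau k * t + ln (2 * L%:R) + t / L%:R + C1.
Proof.
move=> Dp; have L0' : 0 < L%:R :> R by rewrite ltr0n.
pose B := tau k * t + ln (2 * L%:R) + C1.
pose bad (l : 'I_L) := `|tnth p o - tnth (aux k i l) o| < r k / (2 * L%:R).
have KBl l : K p (aux k i l) <= B + (if bad l then t else 0).
  case: ifPn => [_|]; last first.
    rewrite -leNgt addr0 => h.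
    apply: le_trans (K_le (a := r k / (2 * L%:R)) Dp (D_aux k i l) _ _) _.
    - by rewrite divr_gt0 ?mulr_gt0.
    - by apply: le_trans h _; apply: le_trans (dist1_coord _ _ o) _; rewrite lerDl ltW.
    by rewrite lnM ?lnV ?ln_r ?posrE ?invr_gt0 ?mulr_gt0// /B; slra.
  apply: le_trans (K_le (a := eps) Dp (D_aux k i l) _ _) _ => //.
    by rewrite lerDr dist1_ge0.
  have /andP[ta _] := tau01 k.
  have := mulr_ge0 ta (ltW t0); rewrite /eps expRK /B; slra.
have bad1 l l' : bad l -> bad l' -> l = l'.
  rewrite /bad !tnth_aux eqxx => /ltr_normlP[a1 a2] /ltr_normlP[b1 b2].
  apply: val_inj; apply/eqP; rewrite eqn_leq; apply/andP.
  have gen (a b : nat) : (a < b)%N -> r k / L%:R <= b%:R / L%:R * r k - a%:R / L%:R * r k.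
    move=> ab; rewrite -mulrBl -mulrBl mulrAC ler_wpM2r ?invr_ge0 ?(ltW L0')//.
    by rewrite ler_peMl ?(ltW (r_gt0 k))// -natrB ?(ltnW ab)// ler1n subn_gt0.
  have half : r k / L%:R = r k / (2 * L%:R) + r k / (2 * L%:R) by field; rewrite gt_eqF.
  by split; rewrite leqNgt; apply/negP => /gen; slra.
rewrite mulrC ler_pdivrMr//.
apply: (@le_trans _ _ (\sum_l (B + (if bad l then t else 0)))); first exact: ler_sum.
rewrite big_split/= big_const_ord iter_addr_0 -[X in X + _]mulr_natl.
have : \sum_(l < L) (if bad l then t else 0) <= t.
  rewrite -big_mkcond/=; case: (pickP bad) => [l0 bl0|nb]; last by rewrite big_pred0// ltW.
  by rewrite (big_pred1 l0)// => l; apply/idP/eqP => [/bad1/(_ bl0)|->].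
move=> h; rewrite /B; have : t / L%:R * L%:R = t by rewrite divfK// gt_eqF.
slra.
Qed.

Let avg_lo p k i B : D p -> 0 < B -> (forall l, dist1 p (aux k i l) + eps <= B * r k) ->
  tau k * t - ln B - C1 <= L%:R^-1 * (\sum_l K p (aux k i l)).
Proof.
move=> Dp B0 h; have L0' : 0 < L%:R :> R by rewrite ltr0n.
rewrite [leRHS]mulrC ler_pdivlMr//.
apply: (@le_trans _ _ (\sum_(l < L) (tau k * t - ln B - C1))).
  by rewrite big_const_ord iter_addr_0 -[leRHS]mulr_natr.
apply: ler_sum => l _; apply: le_trans _ (K_ge Dp (D_aux k i l) _ (h l)); last by rewrite mulr_gt0.
by rewrite lnM ?posrE// ln_r; slra.
Qed.

Let J : finType := (I + 'I_N.+1 * I * 'I_L)%type.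
Let pts (j : J) : d.-tuple R := match j with inl i => pt i | inr (k, i, l) => aux k i l end.
Let D_pts j : D (pts j). Proof. case: j => [i|[[k i] l]]; [exact: D_pt|exact: D_aux]. Qed.

Let c := field_cov K pts.
Let ev := field_ev X pts.
Let GS : gaussian_space P ev c := gaussian_field_space GX XK D_pts.
Let x (i : I) : {ffun J -> R^o} := dirac_vec R (inl i : J).
Let z k i l : {ffun J -> R^o} := dirac_vec R (inr (k, i, l) : J).
Let y k i : {ffun J -> R^o} := L%:R^-1 *: \sum_l z k i l.

Let c_y v k i : c v (y k i) = L%:R^-1 * \sum_l c v (z k i l).
Proof.
rewrite /y (gs_cZr GS); congr (_ * _).
apply: (big_morph (c v)); first by move=> a b; exact: (gs_cDr GS).
by rewrite (gs_csym GS) (gs_c0l GS).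
Qed.

Let c_xx i j : c (x i) (x j) = K (pt i) (pt j). Proof. exact: field_cov_dirac. Qed.
Let c_xy j k i : c (x j) (y k i) = L%:R^-1 * \sum_l K (pt j) (aux k i l).
Proof. by rewrite c_y; congr (_ * _); apply: eq_bigr => l _; exact: field_cov_dirac. Qed.
Let c_yy k i : c (y k i) (y k i) = L%:R^-1 * \sum_l (L%:R^-1 * \sum_l' K (aux k i l) (aux k i l')).
Proof.
rewrite c_y; congr (_ * _); apply: eq_bigr => l _; rewrite (gs_csym GS) c_y; congr (_ * _).
by apply: eq_bigr => l' _; exact: field_cov_dirac.
Qed.

(** The width t / N is the spacing of the scales, so that the shells cover the grid; D0 = 2 d + 1
    bounds distance plus eps over the cube. *)
Let Sh k i : {set I} := [set j | `|- ln (dist1 (pt i) (pt j) + eps) - tau k * t| <= t / N%:R + ln D0]%SET.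

Let B0 := D0 * expR (t / N%:R) + 1.
Let etN : 1 <= expR (t / N%:R). Proof. by rewrite -[leLHS]expR0 ler_expR. Qed.
Let DetN : 3 <= D0 * expR (t / N%:R).
Proof. by apply: le_trans D0ge _; rewrite ler_peMr//; slra. Qed.
Let lnB0 : ln B0 <= ln (6 * D0) + t / N%:R.
Proof.
rewrite -[X in _ + X]expRK -lnM ?posrE ?expR_gt0//; last by slra.
rewrite ler_ln ?posrE; move: (DetN); rewrite /B0; slra.
Qed.

Let sh_dist k i j : j \in Sh k i -> dist1 (pt i) (pt j) + eps <= D0 * expR (t / N%:R) * r k.
Proof.
rewrite inE => /ler_normlP[h _].
have p0 : 0 < dist1 (pt i) (pt j) + eps by rewrite ltr_wpDl ?dist1_ge0.
rewrite -[leLHS]lnK ?posrE// -[D0]lnK ?posrE; last by slra.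
by rewrite -!expRD ler_expR; slra.
Qed.

Let two_r k i (p : d.-tuple R) l : dist1 p (aux k i l) <= r k -> dist1 p (aux k i l) + eps <= B0 * r k.
Proof.
move=> h; have := eps_le_r k; have : 2 * r k <= B0 * r k; last by slra.
apply: ler_wpM2r; first exact: ltW.
by move: (DetN); rewrite /B0; slra.
Qed.

Let B0_gt0 : 0 < B0. Proof. by move: (DetN); rewrite /B0; slra. Qed.

Let avg_bound p k i : D p -> (forall l, dist1 p (aux k i l) + eps <= B0 * r k) ->
  `|L%:R^-1 * (\sum_l K p (aux k i l)) - tau k * t| <= dl * t.
Proof.
move=> Dp h; have := avg_up k i Dp; have := avg_lo Dp B0_gt0 h; move: lnB0 => h1 h2 h3.
by apply/ler_normlP; split; slra.
Qed.

Let dist1C (p q : d.-tuple R) : dist1 p q = dist1 q p.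
Proof. by apply: eq_bigr => j _; exact: distrC. Qed.

Let dist1xx (p : d.-tuple R) : dist1 p p = 0.
Proof. by rewrite /dist1 big1// => j _; rewrite subrr normr0. Qed.

Let rho_bound i j : ln (dist1 (pt i) (pt j) + eps) <= ln D0.
Proof.
rewrite ler_ln ?posrE ?ltr_wpDl ?dist1_ge0//.
rewrite /D0 lerD//; last by rewrite -[leRHS]expR0 ler_expR oppr_le0 ltW.
apply: (@le_trans _ _ (\sum_(l < d) 2)); last first.
  by rewrite big_const_ord iter_addr_0 -[leLHS]mulr_natr.
apply: ler_sum => l _; have /andP[? ?] := grid_point_bound i l; have /andP[? ?] := grid_point_bound j l.
by apply/ler_normlP; split; rewrite /pt; slra.
Qed.

(** The shell lies in a product of d intervals of at most 2 q + 1 indices, q being its radius in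
    mesh steps. *)
Let card_shell k i : #|Sh k i|%:R <= expR (t * (d%:R * (1 - tau k) + dl)).
Proof.
pose Q := D0 * expR (t / N%:R) * r k * m.
have Q0 : 0 <= Q by rewrite !mulr_ge0 ?expR_ge0 ?(ltW m0)//; slra.
pose q := Num.truncn Q.
have qQ : q%:R <= Q by exact: ler_truncn.
have rm : 1 <= r k * m.
  apply: (@le_trans _ _ (eps * m)); last by rewrite ler_wpM2r ?(ltW m0).
  by rewrite -(expRxMexpNx_1 t) mulrC ler_wpM2l ?(ltW eps0)// ltW.
have Q1 : 1 <= Q.
  rewrite /Q -mulrA; apply: (le_trans rm); rewrite ler_peMl//; first exact: le_trans rm.
  by move: (DetN); slra.
have sub : (Sh k i \subset family (fun l => [pred j : 'I_(2 * mesh) | (i l - q <= j <= i l + q)%N]))%N.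
  apply/fintype.subsetP => j /sh_dist h; apply/familyP => l; rewrite inE.
  have : `|tnth (pt i) l - tnth (pt j) l| * m <= Q.
    rewrite /Q ler_wpM2r ?(ltW m0)//; apply: le_trans h; apply: le_trans (dist1_coord _ _ l) _.
    by rewrite lerDl ltW.
  rewrite /pt !tnth_grid_point opprD opprK addrACA addNr add0r -mulrBl normrM.
  rewrite [`|m^-1|]ger0_norm ?invr_ge0 ?(ltW m0)// divfK ?gt_eqF// => /ler_normlP[h1 h2].
  have gen (a b : nat) : a%:R - b%:R <= Q -> (a <= b + q)%N.
    move=> ab; rewrite -ltnS -(ltr_nat R).
    have : Q < q.+1%:R by exact: truncnS_gt.
    by rewrite -addnS natrD; slra.
  by rewrite leq_subLR addnC !gen//; slra.
have card1 l : (#|[pred j : 'I_(2 * mesh) | (i l - q <= j <= i l + q)%N]| <= 2 * q + 1)%N.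
  by apply: leq_trans (card_ord_interval _ _ _) _; exact: interval_length.
apply: (@le_trans _ _ ((2 * q + 1)%:R ^+ d)).
  rewrite -natrX ler_nat; apply: leq_trans (subset_leq_card sub) _; rewrite card_family.
  rewrite foldrE big_map big_enum/=.
  apply: (@leq_trans (\prod_(l < d) (2 * q + 1))); first by apply: leq_prod => l _; exact: card1.
  by rewrite prod_nat_const card_ord.
apply: (@le_trans _ _ (expR (ln (6 * D0) + t / N%:R + t * (1 - tau k)) ^+ d)).
  rewrite lerXn2r ?nnegrE ?expR_ge0//.
  apply: (@le_trans _ _ (3 * Q)); first by rewrite natrD natrM; slra.
  rewrite !expRD lnK ?posrE; last by slra.
  have -> : expR (t * (1 - tau k)) = r k * expR t by rewrite -expRD; congr expR; ring.
  rewrite /Q (_ : 3 * _ = 3 * D0 * expR (t / N%:R) * r k * m); last by ring.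
  rewrite (_ : 6 * D0 * _ * _ = 3 * D0 * expR (t / N%:R) * r k * (2 * expR t)); last by ring.
  by rewrite ler_wpM2l// !mulr_ge0 ?expR_ge0//; slra.
rewrite -expRM_natl ler_expR; slra.
Qed.

Let cover i j : exists k, j \in Sh k i.
Proof.
set s := - ln (dist1 (pt i) (pt j) + eps).
have st : s <= t.
  rewrite /s -[leRHS]opprK lerN2 -[leLHS]expRK -/eps ler_ln ?posrE ?ltr_wpDl ?dist1_ge0//.
  by rewrite lerDr dist1_ge0.
have sD : - ln D0 <= s by rewrite lerN2; exact: rho_bound.
have NR : 0 < N%:R :> R by rewrite ltr0n.
have lnD : 0 <= ln D0 by apply: ln_ge0; slra.
(* s can be negative, down to - ln D0, for sites at macroscopic distance; the scale is then 0, and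
   the term ln D0 in the width of the shell makes up for it. *)
pose s' := Num.max s 0.
have s'0 : 0 <= s' by rewrite le_max lexx orbT.
have s't : s' <= t by rewrite ge_max st ltW.
have s's : s' - ln D0 <= s by rewrite lerBlDr ge_max lerDl lnD -lerBlDr sub0r.
have ss' : s <= s' by rewrite le_max lexx.
have kN : (Num.truncn (N%:R * s' / t) < N.+1)%N.
  rewrite ltnS -(ler_nat R); apply: le_trans (ler_truncn _) _; first by rewrite divr_ge0 ?mulr_ge0// ltW.
  by rewrite ler_pdivrMr// ler_wpM2l// ltW.
exists (Ordinal kN); rewrite inE -/s /tau/=.
have a0 : 0 <= N%:R * s' / t by rewrite divr_ge0 ?mulr_ge0// ltW.
have := ler_truncn a0; have := truncnS_gt (N%:R * s' / t); rewrite -natr1.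
move: (Num.truncn _)%:R => k h1 h2.
rewrite -/s; clearbody s' s.
have e1 : k / N%:R * t <= s'.
  by rewrite mulrAC ler_pdivrMr// mulrC -ler_pdivlMl// mulrC [s' * _]mulrC.
have e2 : s' - t / N%:R <= k / N%:R * t.
  rewrite -mulrAC ler_pdivlMr// mulrBl divfK ?gt_eqF//.
  move: h1; rewrite ltr_pdivrMr//; slra.
by apply/ler_normlP; split; slra.
Qed.

Let MS : multiscale c x tau y Sh d%:R t dl.
Proof.
have /andP[dl0 dl1] := dl01.
split => //.
- move=> i; rewrite c_xx.
  have := K_up (D_pt i) (D_pt i); have := K_lo (D_pt i) (D_pt i); rewrite dist1xx add0r /eps expRK opprK.
  by move=> h1 h2; apply/ler_normlP; split; slra.
- move=> k i j jS; rewrite c_xx; apply: le_trans (K_up (D_pt i) (D_pt j)) _.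
  have lD : ln D0 <= ln (6 * D0) by rewrite ler_ln ?posrE; slra.
  by move: jS; rewrite inE => /ler_normlP[_ h]; slra.
- move=> k i j jS; rewrite c_xy; apply: avg_bound => // l.
  have := sh_dist jS; have := dist1_triangle (pt j) (pt i) (aux k i l); have := dist_pt_aux k i l.
  by rewrite (dist1C (pt j) (pt i)) /B0 mulrDl mul1r; lra.
- by move=> k i; rewrite c_xy; apply: avg_bound => // l; apply: two_r; exact: dist_pt_aux.
- move=> k i; rewrite c_yy.
  have h l : `|L%:R^-1 * (\sum_l' K (aux k i l) (aux k i l')) - tau k * t| <= dl * t.
    by apply: avg_bound => // l'; apply: two_r; exact: dist_shift.
  rewrite (_ : _ - _ = L%:R^-1 * \sum_(l < L) (L%:R^-1 * (\sum_l' K (aux k i l) (aux k i l')) - tau k * t)); last first.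
    rewrite sumrB mulrBr; congr (_ - _).
    by rewrite big_const_ord iter_addr_0 -[(tau k * t) *+ L]mulr_natl mulKf// pnatr_eq0 -lt0n.
  rewrite normrM ger0_norm ?invr_ge0// mulrC ler_pdivrMr ?ltr0n//.
  apply: le_trans (ler_norm_sum _ _ _) _.
  apply: (@le_trans _ _ (\sum_(l < L) dl * t)); first exact: ler_sum.
  by rewrite big_const_ord iter_addr_0 -[leLHS]mulr_natr.
- rewrite -[leLHS]lnK ?posrE ?ltr0n// ler_expR; slra.
Qed.

Let w := (mesh %/ M)%N.
(** Slabs of w indices in direction o, separated by gaps of the same width, hence at distance at
    least 1 / (2 M). *)
Let Ic (s : 'I_M) : {set I} := [set i : I | (2 * s * w <= i o < 2 * s * w + w)%N]%SET.

Let Mm : (M <= mesh)%N.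
Proof.
rewrite -(ler_nat R); apply: ltW; apply: le_lt_trans mlo.
have MR : 0 < M%:R :> R by rewrite ltr0n.
rewrite -[leLHS]lnK ?posrE// ler_expR.
have : ln (M%:R : R) <= ln (4 * M%:R) by rewrite ler_ln ?posrE; slra.
have /andP[_ dl1] := dl01; have := ler_piMl (ltW t0) dl1.
have := addr_ge0 lnD0 tN0; slra.
Qed.

Let w0 : (0 < w)%N. Proof. by rewrite /w divn_gt0. Qed.
Let w_lo : m <= 2 * M%:R * w%:R.
Proof.
rewrite /m -!natrM ler_nat; apply: slab_arith1 (divn_eq mesh M) (ltn_pmod _ M0) _.
by rewrite leq_pmull.
Qed.
Let wM : (w * M <= mesh)%N. Proof. exact: leq_trunc_div. Qed.

Let slab_far k l i j : k != l -> i \in Ic k -> j \in Ic l -> c (x i) (x j) <= dl * t.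
Proof.
move=> kl; rewrite !inE => /andP[i1 i2] /andP[j1 j2]; rewrite c_xx.
have MR : 0 < M%:R :> R by rewrite ltr0n.
apply: le_trans (K_le (a := (2 * M%:R)^-1) (D_pt i) (D_pt j) _ _) _.
- by rewrite invr_gt0 mulr_gt0.
- have gap : w%:R <= `|(i o)%:R - (j o)%:R| :> R.
    have gen (a b : nat) (s s' : 'I_M) : (s < s')%N -> (2 * s' * w <= b)%N -> (a < 2 * s * w + w)%N ->
        w%:R <= b%:R - a%:R :> R.
      move=> ss h1 h2; rewrite lerBrDr -natrD ler_nat.
      exact: slab_arith2 ss h1 h2.
    have [lt|] := ltnP k l.
      by rewrite distrC; apply: le_trans (ler_norm _); exact: gen lt j1 i2.
    rewrite leq_eqVlt => /orP[/eqP E|lt]; first by move/eqP: kl; case; apply: val_inj.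
    by apply: le_trans (ler_norm _); exact: gen lt i1 j2.
  apply: (@le_trans _ _ (`|tnth (pt i) o - tnth (pt j) o|)); last first.
    by apply: le_trans (dist1_coord _ _ o) _; rewrite lerDl ltW.
  rewrite /pt !tnth_grid_point opprD opprK addrACA addNr add0r -mulrBl normrM.
  rewrite [`|m^-1|]ger0_norm ?invr_ge0 ?(ltW m0)// ler_pdivlMr// mulrC ler_pdivrMr ?mulr_gt0//.
  by apply: le_trans w_lo _; rewrite mulrC ler_wpM2r// mulr_ge0.
rewrite lnV ?posrE ?mulr_gt0// opprK.
have : ln (2 * M%:R : R) <= ln (4 * M%:R) by rewrite ler_ln ?posrE; slra.
have := addr_ge0 lnD0 tN0; slra.
Qed.

Let card_slabE k : #|Ic k| = (w * (2 * mesh) ^ d.-1)%N.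
Proof.
rewrite cardsE.
pose F (l : 'I_d) : pred 'I_(2 * mesh) := if l == o then [pred j : 'I_(2 * mesh) | (2 * k * w <= j < 2 * k * w + w)%N] else predT.
rewrite (_ : #|_| = #|family F|); last first.
  apply: eq_card => i; rewrite unfold_in; apply/idP/familyP => [h l|/(_ o)].
    by rewrite /F; case: eqP => [->|].
  by rewrite /F eqxx.
rewrite card_family foldrE big_map big_enum/= (bigD1 o)//=; congr (_ * _)%N.
  by rewrite /F eqxx card_ord_interval_eq//; exact: slab_arith3 (ltn_ord k) wM.
rewrite (eq_bigr (fun=> (2 * mesh)%N)) => [|l /negPf lo]; last by rewrite /F lo card_ord.
by rewrite prod_nat_const cardC1 card_ord.
Qed.

Let dpred : d.-1.+1 = d. Proof. by rewrite prednK// (leq_ltn_trans _ (ltn_ord o)). Qed.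

Let cardI : #|I| = ((2 * mesh) ^ d)%N. Proof. by rewrite card_ffun !card_ord. Qed.

Let expdR : expR (t * d%:R) = expR t ^+ d. Proof. by rewrite -expRM_natl mulrC. Qed.

Let card_slab k : expR (t * (d%:R - dl)) <= #|Ic k|%:R.
Proof.
rewrite card_slabE natrM natrX.
have MR : 0 < M%:R :> R by rewrite ltr0n.
apply: (@le_trans _ _ (expR t ^+ d / (4 * M%:R))).
  rewrite -expdR -[X in _ / X]lnK ?posrE ?mulr_gt0// -expRN -expRD ler_expR.
  have := addr_ge0 lnD0 tN0; slra.
rewrite -{1}dpred exprS ler_pdivrMr ?mulr_gt0//.
have h1 : expR t ^+ d.-1 <= (2 * mesh)%:R ^+ d.-1.
  rewrite lerXn2r ?nnegrE ?expR_ge0// natrM; apply: le_trans (ltW mlo) _.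
  by rewrite -/m; move: (m0); slra.
have h2 : expR t <= w%:R * (4 * M%:R).
  by apply: le_trans (ltW mlo) _; apply: le_trans w_lo _; have := mulr_ge0 (ltW MR) (ler0n R w); slra.
rewrite mulrAC; apply: ler_pM => //; exact: exprn_ge0 (expR_ge0 _).
Qed.

Let card_lo : expR (t * (d%:R - dl)) <= #|I|%:R.
Proof.
rewrite cardI natrX; apply: (@le_trans _ _ (expR t ^+ d)).
  rewrite -expdR ler_expR ler_wpM2l ?(ltW t0)//; case/andP: dl01; slra.
by rewrite lerXn2r ?nnegrE ?expR_ge0// natrM; apply: le_trans (ltW mlo) _; rewrite -/m; move: (m0); slra.
Qed.

Let card_hi : #|I|%:R <= expR (t * (d%:R + dl)).
Proof.
rewrite cardI natrX; apply: (@le_trans _ _ ((6 * D0 * expR t) ^+ d)).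
  rewrite lerXn2r ?nnegrE ?mulr_ge0 ?expR_ge0//; first by slra.
  rewrite natrM -/m; have := expR_gt0 t; have := ler_wpM2r (expR_ge0 t) D0ge; move: mhi; slra.
rewrite exprMn -expdR -[6 * D0]lnK ?posrE; last by slra.
rewrite -expRM_natl -expRD ler_expR.
have := mulr_ge0 (le_trans ler01 d1) tN0; slra.
Qed.

Lemma grid_log_correlated :
  log_correlated P (fun (i : {ffun 'I_d -> 'I_(2 * mesh)}) w => X w (grid_point i)) M d%:R t dl.
Proof.
exists {ffun J -> R^o}, ev, c, N.+1, x, tau, y, Sh, Ic; split; split => //.
- have := gaussian_field_family GX XK D_pt.
  rewrite (_ : (fun j k => _) = fun i j => c (x i) (x j))//.
  by apply/funext => i; apply/funext => j; rewrite c_xx.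
- by move=> i; apply/funext => u; exact: field_ev_dirac.
Qed.

End geometry.

(** * From the grid to the cube *)

Section cube_int.
Variable R : realType.
Local Open Scope ereal_scope.

Let I11 : set R := `[(-1)%R, 1%R]%classic.
Let mI11 : measurable I11. Proof. exact: measurable_itv. Qed.

Definition cons_tup d (t : R) (v : d.-tuple R) : d.+1.-tuple R := [tuple of t :: v].

Lemma measurable_cons_tup d dT (T : measurableType dT) (f : T -> R) (g : T -> d.-tuple R) :
  measurable_fun setT f -> measurable_fun setT g -> measurable_fun setT (fun x => cons_tup (f x) (g x)).
Proof. exact: measurable_cons. Qed.

Lemma cube_intS d (f : d.+1.-tuple R -> \bar R) :
  cube_int f = \int[@lebesgue_measure R]_(t in I11) cube_int (fun v => f (cons_tup t v)).
Proof. by []. Qed.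

Lemma cube_int_ge0 d (f : d.-tuple R -> \bar R) : (forall x, 0 <= f x) -> 0 <= cube_int f.
Proof.
elim: d f => [|d IH] f f0; first exact: f0.
by rewrite cube_intS; apply: integral_ge0 => t _; exact: IH.
Qed.

Lemma sym_cube_cons d (t : R) (v : d.-tuple R) : I11 t -> sym_cube d 1 v -> sym_cube d.+1 1 (cons_tup t v).
Proof.
rewrite /I11/= in_itv/= => tI vI i; case: (unliftP ord0 i) => [j ->|->]; last by rewrite tnth0.
by rewrite tnthS.
Qed.

Lemma eq_cube_int d (f g : d.-tuple R -> \bar R) :
  (forall x, sym_cube d 1 x -> f x = g x) -> cube_int f = cube_int g.
Proof.
elim: d f g => [|d IH] f g fg; first by apply: fg => -[].
rewrite !cube_intS; apply: eq_integral => t /set_mem tI; apply: IH => v vI.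
by apply: fg; exact: sym_cube_cons.
Qed.

(** Integrals over [-1, 1] become integrals over the line of functions patched by 0, to which
    Fubini's theorem applies. *)
Let patch_meas dT (T : measurableType dT) (F : T * R -> \bar R) : measurable_fun setT F ->
  measurable_fun setT (fun x : T * R => ((fun t => F (x.1, t)) \_ I11) x.2).
Proof.
move=> mF; rewrite (_ : (fun x => _) = F \_ (snd @^-1` I11)); last first.
  apply/funext => -[w t]; rewrite /patch.
  have -> : ((w, t) \in (snd @^-1` I11)) = (t \in I11) by apply/idP/idP => /set_mem h; exact/mem_set.
  by [].
apply/(measurable_restrict _ _ _) => //.
- by rewrite -[X in measurable X]setTI; exact: measurable_snd.
- by apply: measurable_funS mF.
Qed.

(** The parameter space T is generalised in the induction: each step moves one coordinate of the
    cube into the parameter. *)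
Lemma measurable_cube_int d dT (T : measurableType dT) (f : T * d.-tuple R -> \bar R) :
  measurable_fun setT f -> (forall x, 0 <= f x) ->
  measurable_fun setT (fun w => cube_int (fun v => f (w, v))).
Proof.
elim: d dT T f => [|d IH] dT T f mf f0.
  by apply: (measurableT_comp mf); apply: measurable_fun_pair.
pose F (x : T * R) := cube_int (fun v : d.-tuple R => f (x.1, cons_tup x.2 v)).
have mF : measurable_fun setT F.
  apply: (IH _ _ (fun x => f (x.1.1, cons_tup x.1.2 x.2))) => //.
  apply: (measurableT_comp mf); apply: measurable_fun_pair => /=.
    exact: measurableT_comp.
  by apply: measurable_cons_tup => //; exact: measurableT_comp.
have F0 x : 0 <= F x by exact: cube_int_ge0.
rewrite (_ : (fun w => _) = fubini_F (@lebesgue_measure R) (fun x : T * R => ((fun t => F (x.1, t)) \_ I11) x.2)).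
  apply: measurable_fun_fubini_tonelli_F; first exact: patch_meas.
  by move=> x; apply: erestrict_ge0.
by apply/funext => w; rewrite cube_intS integral_mkcond.
Qed.

Section tonelli.
Context dT (T : measurableType dT) (P : {sigma_finite_measure set T -> \bar R}).

Lemma cube_int_tonelli d (f : T * d.-tuple R -> \bar R) :
  measurable_fun setT f -> (forall x, 0 <= f x) ->
  \int[P]_w cube_int (fun v => f (w, v)) = cube_int (fun v => \int[P]_w f (w, v)).
Proof.
elim: d f => [//|d IH] f mf f0.
pose F (x : T * R) := cube_int (fun v : d.-tuple R => f (x.1, cons_tup x.2 v)).
have mF : measurable_fun setT F.
  apply: (@measurable_cube_int _ _ _ (fun x => f (x.1.1, cons_tup x.1.2 x.2))) => //.
  apply: (measurableT_comp mf); apply: measurable_fun_pair => /=.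
    exact: measurableT_comp.
  by apply: measurable_cons_tup => //; exact: measurableT_comp.
have F0 x : 0 <= F x by exact: cube_int_ge0.
under eq_integral do rewrite cube_intS integral_mkcond.
rewrite (fubini_tonelli (m1 := P) (m2 := @lebesgue_measure R) (fun x : T * R => ((fun t => F (x.1, t)) \_ I11) x.2)).
- rewrite cube_intS [RHS]integral_mkcond; apply: eq_integral => t _ /=.
  rewrite /patch; case: ifP => tI; last by rewrite integral0.
  apply: (IH (fun x => f (x.1, cons_tup t x.2))) => //.
  by apply: (measurableT_comp mf); apply: measurable_fun_pair => //; exact: measurable_cons_tup.
- exact: patch_meas.
- by move=> x; apply: erestrict_ge0.
Qed.

End tonelli.

Let measurable_slice d (f : d.+1.-tuple R -> \bar R) t : measurable_fun setT f ->
  measurable_fun setT (fun v => f (cons_tup t v)).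
Proof. by move=> mf; apply: (measurableT_comp mf); exact: measurable_cons_tup. Qed.

Let measurable_outer d (f : d.+1.-tuple R -> \bar R) : measurable_fun setT f -> (forall x, 0 <= f x) ->
  measurable_fun I11 (fun t => cube_int (fun v => f (cons_tup t v))).
Proof.
move=> mf f0; apply: measurable_funTS.
apply: (@measurable_cube_int _ _ _ (fun x => f (cons_tup x.1 x.2))) => //.
by apply: (measurableT_comp mf); exact: measurable_cons_tup.
Qed.

Lemma cube_intD d (f g : d.-tuple R -> \bar R) : measurable_fun setT f -> measurable_fun setT g ->
  (forall x, 0 <= f x) -> (forall x, 0 <= g x) ->
  cube_int (fun x => f x + g x) = cube_int f + cube_int g.
Proof.
elim: d f g => [//|d IH] f g mf mg f0 g0; rewrite !cube_intS -ge0_integralD//.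
- by apply: eq_integral => t _; rewrite IH//; exact: measurable_slice.
- by move=> t _; exact: cube_int_ge0.
- exact: measurable_outer.
- by move=> t _; exact: cube_int_ge0.
- exact: measurable_outer.
Qed.

Lemma cube_intZl d (k : R) (f : d.-tuple R -> \bar R) : measurable_fun setT f -> (0 <= k)%R ->
  (forall x, 0 <= f x) -> cube_int (fun x => k%:E * f x) = k%:E * cube_int f.
Proof.
elim: d f => [//|d IH] f mf k0 f0; rewrite !cube_intS -ge0_integralZl//.
- by apply: eq_integral => t _; rewrite IH//; exact: measurable_slice.
- exact: measurable_outer.
- by move=> t _; exact: cube_int_ge0.
Qed.

Lemma le_cube_int d (f g : d.-tuple R -> \bar R) : measurable_fun setT f -> measurable_fun setT g ->
  (forall x, 0 <= f x) -> (forall x, 0 <= g x) -> (forall x, sym_cube d 1 x -> f x <= g x) ->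
  cube_int f <= cube_int g.
Proof.
elim: d f g => [|d IH] f g mf mg f0 g0 fg; first by apply: fg => -[].
rewrite !cube_intS; apply: ge0_le_integral => //.
- by move=> t _; exact: cube_int_ge0.
- exact: measurable_outer.
- exact: measurable_outer.
move=> t tI; apply: IH => //; [exact: measurable_slice|exact: measurable_slice|].
by move=> v vI; apply: fg; exact: sym_cube_cons.
Qed.

Lemma cube_int0 d : cube_int (fun _ : d.-tuple R => 0) = 0.
Proof. by elim: d => [//|d IH]; rewrite cube_intS IH integral0. Qed.

Lemma cube_int_sum d (J : Type) (s : seq J) (f : J -> d.-tuple R -> \bar R) :
  (forall j, measurable_fun setT (f j)) -> (forall j x, 0 <= f j x) ->
  cube_int (fun x => \sum_(j <- s) f j x) = \sum_(j <- s) cube_int (f j).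
Proof.
move=> mf f0; elim: s => [|j s IH].
  by rewrite big_nil -[RHS](cube_int0 d); apply: eq_cube_int => x _; rewrite big_nil.
rewrite big_cons -IH -cube_intD//.
- by apply: eq_cube_int => x _; rewrite big_cons.
- exact: emeasurable_sum.
- by move=> x; exact: sume_ge0.
Qed.

Lemma cube_int_box d (A : 'I_d -> set R) : (forall i, measurable (A i)) ->
  cube_int (fun x => (\prod_i \1_(A i) (tnth x i))%:E) = \prod_i (@lebesgue_measure R) (A i `&` I11).
Proof.
elim: d A => [|d IH] A mA; first by rewrite /= !big_ord0.
rewrite big_ord_recl/= -IH; last by move=> i.
set c := cube_int (fun x : d.-tuple R => (\prod_i \1_(A (lift ord0 i)) (tnth x i))%:E).
have c0 : 0 <= c by apply: cube_int_ge0 => x; rewrite lee_fin prodr_ge0.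
have mi i : measurable_fun setT (\1_(A i) : R -> R) by exact: measurable_indic.
have E t : cube_int (fun v => (\prod_i \1_(A i) (tnth (cons_tup t v) i))%:E) = (\1_(A ord0) t)%:E * c.
  rewrite -cube_intZl//.
  - apply: eq_cube_int => v _; rewrite big_ord_recl tnth0 -EFinM; congr (_ * _)%:E.
    by apply: eq_bigr => i _; rewrite tnthS.
  - apply/measurable_EFinP; apply: measurable_prod => i _.
    exact: measurableT_comp (mi _) (measurable_tnth i).
  - by move=> x; rewrite lee_fin prodr_ge0.
under eq_integral do rewrite E.
rewrite ge0_integralZr//.
  by rewrite integral_indic//; exact: mA.
by apply/measurable_EFinP; apply: measurable_funTS; exact: mi.
Qed.

End cube_int.

(** * Partition of the cube into cells around the grid *)

Section cells.
Variables (R : realType) (d : nat) (t : R).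
Hypothesis t0 : 0 <= t.
Let n := mesh t.
Let m : R := n%:R.
Let m0 : 0 < m. Proof. by rewrite ltr0n. Qed.
Let I : finType := {ffun 'I_d -> 'I_(2 * n)}.

(* The last cell is closed on the right within [-1, 1], so that cells partition the cube. *)
Let cell1_itv (a : 'I_(2 * n)) : interval R :=
  Interval (BLeft (- 1 + a%:R / m)) (if a.+1 == (2 * n)%N then +oo%O else BLeft (- 1 + a.+1%:R / m)).
Definition cell1 (a : 'I_(2 * n)) : set R := [set` cell1_itv a].

Lemma measurable_cell1 a : measurable (cell1 a).
Proof. exact: measurable_itv. Qed.

Lemma cell1P a x : -1 <= x <= 1 -> cell1 a x <->
  (a%:R / m <= x + 1 /\ (x + 1 < a.+1%:R / m \/ a.+1 = (2 * n)%N)).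
Proof.
move=> x1; rewrite /cell1 /= /cell1_itv in_itv/=; case: eqP => an /=.
  rewrite andbT; split=> [h|[h _]]; last by lra.
  by split; [lra|right].
split=> [/andP[h1 h2]|[h1 [h2|//]]]; first by split; [lra|left; lra].
by apply/andP; split; lra.
Qed.

Lemma sum_cell1 x : -1 <= x <= 1 -> \sum_a \1_(cell1 a) x = 1 :> R.
Proof.
move=> x1; have /andP[xl xr] := x1.
have y0 : 0 <= (x + 1) * m by rewrite mulr_ge0 ?(ltW m0)//; lra.
(* The minimum matters only at x = 1, which belongs to the last cell. *)
pose k := minn (Num.truncn ((x + 1) * m)) (2 * n).-1.
have n0 : (0 < 2 * n)%N by rewrite muln_gt0.
have kn : (k < 2 * n)%N by rewrite (leq_ltn_trans (geq_minr _ _))// prednK.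
pose a := Ordinal kn.
have cell_a : cell1 a x.
  apply/(cell1P a x1); split; rewrite /a/=.
    rewrite ler_pdivrMr//; apply: le_trans (ler_truncn y0).
    by rewrite ler_nat geq_minl.
  have [h|h] := leqP (Num.truncn ((x + 1) * m)) (2 * n).-1.
    by left; rewrite ltr_pdivlMr// /k (minn_idPl h) truncnS_gt.
  by right; rewrite /k (minn_idPr (ltnW h)) prednK.
rewrite (bigD1 a)//= indicE mem_set// big1 ?addr0// => b ba.
rewrite indicE memNset// => cell_b.
have [a1 a2] := (cell1P a x1).1 cell_a; have [b1 b2] := (cell1P b x1).1 cell_b.
have disj (c e : 'I_(2 * n)) : c%:R / m <= x + 1 -> x + 1 < e.+1%:R / m \/ e.+1 = (2 * n)%N -> (c <= e)%N.
  move=> h1 [h2|h2]; last by rewrite -ltnS h2.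
  have := le_lt_trans h1 h2; rewrite ltr_pM2r ?invr_gt0// ltr_nat ltnS//.
by move/eqP: ba; apply; apply: val_inj; apply/eqP; rewrite eqn_leq !disj.
Qed.

Lemma lebesgue_cell1 a : (@lebesgue_measure R) (cell1 a `&` `[(-1)%R, 1%R]%classic) = (m^-1)%:E.
Proof.
pose l := - 1 + a%:R / m; pose r := - 1 + a.+1%:R / m.
have rl : r - l = m^-1 by rewrite /r /l -natr1; field; rewrite gt_eqF.
have lr : l < r by rewrite -subr_gt0 rl invr_gt0.
have l1 : -1 <= l by rewrite lerDl divr_ge0 ?(ltW m0).
have r1 : r <= 1.
  rewrite /r addrC lerBlDr ler_pdivrMr// /m (_ : 1 + 1 = 2%:R)// -natrM ler_nat; exact: ltn_ord.
have mc : measurable (cell1 a `&` `[(-1)%R, 1%R]%classic) by apply: measurableI => //; exact: measurable_cell1.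
apply/eqP; rewrite eq_le; apply/andP; split.
  apply: (@le_trans _ _ ((@lebesgue_measure R) `[l, r]%classic)).
    apply: le_measure; rewrite ?inE// => x [] /=; rewrite in_itv/= => cx x1.
    have [h1 h2] := (cell1P a x1).1 cx; rewrite in_itv/= /l /r.
    have /andP[_ xr] := x1.
    apply/andP; split; first by lra.
    case: h2 => [|->]; first by lra.
    rewrite natrM -/m mulfK ?gt_eqF//; lra.
  by rewrite lebesgue_measure_itv/= lte_fin lr -EFinD rl.
apply: (@le_trans _ _ ((@lebesgue_measure R) `[l, r[%classic)); last first.
  apply: le_measure; rewrite ?inE// => x /=; rewrite in_itv/= => /andP[h1 h2].
  have x1 : -1 <= x <= 1 by apply/andP; split; lra.
  split; last by rewrite /= in_itv.
  by apply/(cell1P a x1); rewrite /l /r in h1 h2; split; [lra|left; lra].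
by rewrite lebesgue_measure_itv/= lte_fin lr -EFinD rl.
Qed.

Definition cell_ind (i : {ffun 'I_d -> 'I_(2 * n)}) (x : d.-tuple R) : R := \prod_l \1_(cell1 (i l)) (tnth x l).

Lemma cell_ind_ge0 i x : 0 <= cell_ind i x. Proof. exact: prodr_ge0. Qed.

Lemma measurable_cell_ind i : measurable_fun setT (cell_ind i).
Proof.
apply: measurable_prod => l _.
have mi : measurable_fun setT (\1_(cell1 (i l)) : R -> R) by apply: measurable_indic; exact: measurable_cell1.
exact: measurableT_comp mi (measurable_tnth l).
Qed.

Lemma sum_cell_ind x : sym_cube d 1 x -> \sum_i cell_ind i x = 1.
Proof.
move=> x1; rewrite /cell_ind.
rewrite -(bigA_distr_bigA (fun l a => \1_(cell1 a) (tnth x l))) big1// => l _.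
exact: sum_cell1 (x1 l).
Qed.

Definition cell_vol : R := (m^-1) ^+ d.

Lemma cell_vol_gt0 : 0 < cell_vol. Proof. by rewrite exprn_gt0// invr_gt0. Qed.

Lemma cube_int_cell_ind i : cube_int (fun x => (cell_ind i x)%:E) = cell_vol%:E.
Proof.
rewrite /cell_ind cube_int_box; last by move=> l; exact: measurable_cell1.
rewrite (eq_bigr (fun=> (m^-1)%:E)); last by move=> l _; exact: lebesgue_cell1.
by rewrite prodEFin prodr_const card_ord.
Qed.

Lemma cell_ind_dist i x : sym_cube d 1 x -> cell_ind i x != 0 ->
  dist1 (grid_point i) x <= d%:R * expR (- t).
Proof.
move=> x1 /prodf_neq0 h; rewrite /dist1.
apply: (@le_trans _ _ (\sum_(l < d) expR (- t))); last first.
  by rewrite big_const_ord iter_addr_0 -[leLHS]mulr_natl.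
apply: ler_sum => l _; rewrite tnth_grid_point -/n -/m.
have := h l isT; rewrite indicE; case: (boolP (_ \in _)) => [/set_mem|_]; last by rewrite eqxx.
move=> /(cell1P _ (x1 l))[h1 h2] _.
have h3 : tnth x l + 1 <= (i l).+1%:R / m.
  case: h2 => [/ltW//|->]; have /andP[_ ?] := x1 l.
  by rewrite natrM -/m mulfK ?gt_eqF//; lra.
have e1 : (i l).+1%:R / m = (i l)%:R / m + m^-1 by rewrite -natr1; field; rewrite gt_eqF.
have e2 : m^-1 <= expR (- t).
  by rewrite expRN lef_pV2 ?posrE ?expR_gt0//; apply/ltW; exact: truncnS_gt.
have : 0 <= m^-1 by rewrite invr_ge0 ltW.
by move=> ?; apply/ler_normlP; split; lra.
Qed.

End cells.

Section expR_tangent_power.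
Variable R : realType.

(** The tangent of the power p at exp a. Integrated over a cell for a suitable a, it yields Jensen's
    inequality for cell averages, as does its analogue for the power -p below. *)
Lemma expR_pow_tangent (p u a : R) : 1 <= p ->
  p * expR ((p - 1) * a) * expR u <= expR (p * u) + expR (p * a) * (p - 1).
Proof.
move=> p1; have p0 : 0 < p by lra.
have := @expR_le_onem R p^-1 (p * (u - a)) _.
rewrite invr_ge0 (ltW p0) invf_le1// p1 => /(_ isT).
rewrite mulrA mulVf ?gt_eqF// mul1r => /(ler_wpM2l (ltW p0)).
have -> : p * (1 - p^-1 + p^-1 * expR (p * (u - a))) = p - 1 + expR (p * (u - a)) by field; rewrite gt_eqF.
move=> /(ler_wpM2l (expR_ge0 (p * a))).
have -> : expR (p * a) * (p * expR (u - a)) = p * expR ((p - 1) * a) * expR u.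
  by rewrite mulrCA -mulrA -!expRD; congr (_ * expR _); ring.
rewrite mulrDr -expRD (_ : p * a + p * (u - a) = p * u); last by ring.
by lra.
Qed.

Lemma expR_negpow_tangent (p u a : R) : 0 <= p ->
  expR (- (p * a)) * (1 + p) <= expR (- (p * u)) + p * expR (- (p * a) - a) * expR u.
Proof.
move=> p0.
have h1 : 1 - p * (u - a) <= expR (- (p * (u - a))) by exact: expR_ge1Dx.
have h2 : 1 + (u - a) <= expR (u - a) by exact: expR_ge1Dx.
have h3 := ler_wpM2l p0 h2.
have -> : expR (- (p * u)) = expR (- (p * a)) * expR (- (p * (u - a))) by rewrite -expRD; congr expR; ring.
have -> : p * expR (- (p * a) - a) * expR u = expR (- (p * a)) * (p * expR (u - a)).
  by rewrite mulrCA -mulrA -!expRD; congr (_ * expR _); ring.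
rewrite -mulrDr ler_wpM2l ?expR_ge0//; lra.
Qed.
End expR_tangent_power.

(** * Pathwise comparison of the integrals with the sums over the grid *)

Section transfer.
Variables (R : realType) (d : nat) (t : R).
Hypothesis t0 : 0 <= t.
Variable Y : d.-tuple R -> R.
Hypothesis mY : measurable_fun setT Y.
Let n := mesh t.
Let I : finType := {ffun 'I_d -> 'I_(2 * n)}.
Let v : R := cell_vol d t.
Let v0 : 0 < v. Proof. exact: cell_vol_gt0. Qed.
Let y (i : I) := Y (grid_point i).

(** The factor by which the cell i corrects the grid approximation of the integral of exp(b Y), as
    in [cube_int_expR_cells]. *)
Definition cell_avg (i : {ffun 'I_d -> 'I_(2 * mesh t)}) (b : R) : \bar R :=
  ((cell_vol d t)^-1%:E * cube_int (fun x => (cell_ind i x * expR (b * (Y x - Y (grid_point i))))%:E))%E.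

Let g i b (x : d.-tuple R) : R := cell_ind i x * expR (b * (Y x - y i)).

Let mg i b : measurable_fun setT (fun x => (g i b x)%:E).
Proof.
apply/measurable_EFinP; apply: measurable_funM; first exact: measurable_cell_ind.
apply: measurableT_comp => //; apply: measurable_funM => //; exact: measurable_funB.
Qed.

Let g0 i b x : (0 <= (g i b x)%:E)%E.
Proof. by rewrite lee_fin mulr_ge0 ?expR_ge0 ?cell_ind_ge0. Qed.

Let mc i : measurable_fun setT (fun x => (@cell_ind R d t i x)%:E).
Proof. apply/measurable_EFinP; exact: measurable_cell_ind. Qed.

Let c0 i x : (0 <= (@cell_ind R d t i x)%:E)%E. Proof. by rewrite lee_fin cell_ind_ge0. Qed.

Lemma cell_avg_ge0 i b : (0 <= cell_avg i b)%E.
Proof. by rewrite mule_ge0 ?lee_fin ?invr_ge0 ?(ltW v0)//; apply: cube_int_ge0; exact: g0. Qed.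

Let cube_g i b : (cube_int (fun x => (g i b x)%:E) = v%:E * cell_avg i b)%E.
Proof. by rewrite /cell_avg muleA -EFinM divff ?gt_eqF// mul1e. Qed.

(** Jensen's inequality for the power p, and for -p in the next lemma: a bound H on averages of high
    order and both signs confines those of low order between H^(-1/p) and H^(1/p). *)
Lemma cell_avg_upper i a p H : 1 <= p -> 0 < H -> (cell_avg i (p * a) <= H%:E)%E ->
  (cell_avg i a <= (expR (ln H / p))%:E)%E.
Proof.
move=> p1 H0 AH; have p0 : 0 < p by lra.
set b := ln H / p.
have pb : expR (p * b) = H by rewrite /b mulrC divfK ?gt_eqF// lnK.
have k0 : 0 <= p * expR ((p - 1) * b) by rewrite mulr_ge0 ?expR_ge0// ltW.
have k1 : 0 <= expR (p * b) * (p - 1) by rewrite mulr_ge0 ?expR_ge0//; lra.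
have : ((p * expR ((p - 1) * b))%:E * (v%:E * cell_avg i a) <=
    v%:E * cell_avg i (p * a) + (expR (p * b) * (p - 1))%:E * v%:E)%E.
  rewrite -!cube_g -[X in (_ <= _ + _ * X)%E](cube_int_cell_ind i) -!cube_intZl// -cube_intD//.
  - apply: le_cube_int => //.
    + exact: emeasurable_funM.
    + by apply: emeasurable_funD => //; exact: emeasurable_funM.
    + by move=> x; rewrite mule_ge0.
    + by move=> x; rewrite adde_ge0// mule_ge0.
    move=> x _; rewrite -!EFinM -EFinD lee_fin /g.
    have := ler_wpM2l (cell_ind_ge0 i x) (expR_pow_tangent (a * (Y x - y i)) b p1).
    rewrite (mulrA p a); lra.
  - exact: emeasurable_funM.
  - by move=> x; rewrite mule_ge0.
move=> H1.
have {}H1 : ((p * expR ((p - 1) * b) * v)%:E * cell_avg i a <= (p * H * v)%:E)%E.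
  rewrite EFinM -muleA; apply: le_trans H1 _.
  apply: (@le_trans _ _ (v%:E * H%:E + (expR (p * b) * (p - 1))%:E * v%:E)%E).
    by rewrite leeD2r// lee_wpmul2l// lee_fin ltW.
  by rewrite -!EFinM -EFinD lee_fin pb; lra.
have K0 : 0 < p * expR ((p - 1) * b) * v by rewrite !mulr_gt0 ?expR_gt0.
have := lee_wpmul2l (_ : 0 <= (p * expR ((p - 1) * b) * v)^-1%:E)%E H1.
rewrite lee_fin invr_ge0 (ltW K0) => /(_ isT).
rewrite muleA -!EFinM mulVf ?gt_eqF// mul1e; move/le_trans; apply.
rewrite lee_fin ler_pdivrMl// -pb (_ : p * b = (p - 1) * b + b); last by ring.
by rewrite expRD; lra.
Qed.

Lemma cell_avg_lower i a p H : 0 < p -> 0 < H -> (cell_avg i (- (p * a)) <= H%:E)%E ->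
  ((expR (- (ln H / p)))%:E <= cell_avg i a)%E.
Proof.
move=> p0 H0 AH.
set b := - (ln H / p).
have pb : expR (- (p * b)) = H by rewrite /b mulrN opprK mulrC divfK ?gt_eqF// lnK.
have k0 : 0 <= expR (- (p * b)) * (1 + p) by rewrite mulr_ge0 ?expR_ge0//; lra.
have k1 : 0 <= p * expR (- (p * b) - b) by rewrite mulr_ge0 ?expR_ge0// ltW.
have : ((expR (- (p * b)) * (1 + p))%:E * v%:E <=
    v%:E * cell_avg i (- (p * a)) + (p * expR (- (p * b) - b))%:E * (v%:E * cell_avg i a))%E.
  rewrite -!cube_g -[X in (_ * X <= _)%E](cube_int_cell_ind i) -!cube_intZl// -cube_intD//.
  - apply: le_cube_int => //.
    + exact: emeasurable_funM.
    + by apply: emeasurable_funD => //; exact: emeasurable_funM.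
    + by move=> x; rewrite mule_ge0.
    + by move=> x; rewrite adde_ge0// mule_ge0.
    move=> x _; rewrite -!EFinM -EFinD lee_fin /g.
    have := ler_wpM2l (cell_ind_ge0 i x) (expR_negpow_tangent (a * (Y x - y i)) b (ltW p0)).
    rewrite (_ : - (p * a) * (Y x - y i) = - (p * (a * (Y x - y i)))); last by ring.
    lra.
  - exact: emeasurable_funM.
  - by move=> x; rewrite mule_ge0.
move=> H1.
have {}H1 : ((H * (1 + p) * v)%:E <= (p * expR (- (p * b) - b) * v)%:E * cell_avg i a + (H * v)%:E)%E.
  rewrite addeC EFinM -pb; apply: le_trans H1 _.
  rewrite pb !EFinM -[X in (_ <= _ + X)%E]muleA [(H%:E * _)%E]muleC; apply: leeD => //.
  by rewrite lee_wpmul2l// lee_fin ltW.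
have {}H1 : ((H * p * v)%:E <= (p * expR (- (p * b) - b) * v)%:E * cell_avg i a)%E.
  have := lee_add_cancel _ H1; rewrite (_ : H * (1 + p) * v - H * v = H * p * v); last by ring.
  by apply; rewrite mule_ge0 ?cell_avg_ge0// lee_fin mulr_ge0// ltW.
have K0 : 0 < p * expR (- (p * b) - b) * v by rewrite !mulr_gt0 ?expR_gt0.
have := lee_wpmul2l (_ : 0 <= (p * expR (- (p * b) - b) * v)^-1%:E)%E H1.
rewrite lee_fin invr_ge0 (ltW K0) => /(_ isT).
rewrite muleA -!EFinM mulVf ?gt_eqF// mul1e; apply: le_trans.
rewrite lee_fin ler_pdivlMl// -pb expRD.
rewrite [leLHS](_ : _ = expR (- (p * b)) * p * v * (expR b * expR (- b))); last by ring.
by rewrite expRxMexpNx_1 mulr1.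
Qed.

Lemma cube_int_expR_cells b :
  (cube_int (fun x => (expR (b * Y x))%:E) = \sum_i (v * expR (b * y i))%:E * cell_avg i b)%E.
Proof.
rewrite (@eq_cube_int _ _ _ (fun x => \sum_i (expR (b * y i))%:E * (g i b x)%:E)%E); last first.
  move=> x x1; under eq_bigr do rewrite -EFinM.
  rewrite sumEFin; congr EFin.
  rewrite -[LHS]mul1r -(sum_cell_ind t x1) mulr_suml; apply: eq_bigr => i _.
  by rewrite /g mulrCA -expRD; congr (_ * expR _); ring.
rewrite cube_int_sum//.
- by apply: eq_bigr => i _; rewrite cube_intZl// cube_g muleA -EFinM [v * _]mulrC.
- by move=> i; exact: emeasurable_funM.
- by move=> i x; rewrite mule_ge0// lee_fin expR_ge0.
Qed.

Variables (q beta k : R).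
Hypotheses (q1 : 1 < q) (k0 : 0 <= k).

(** The orders q beta and beta are reached from L with p = 2 (k + 1) and p q; numerator and
    denominator of the ratio then lose the power 1/p of the error each, in total the power 1/(k +
    1). *)
Let L := q * (2 * (k + 1)) * beta.
Definition cell_error : \bar R := (\sum_(i : {ffun 'I_d -> 'I_(2 * mesh t)}) (cell_avg i L + cell_avg i (- L)))%E.

Let W : R := fine (cube_int (fun x => (expR (q * beta * Y x))%:E)) /
   (fine (cube_int (fun x => (expR (beta * Y x))%:E))) `^ q.
Let V : R := \sum_i expR (q * (beta * y i - ln (\sum_j expR (beta * y j)))).
Let S b : R := \sum_i expR (b * y i).

Let i0 : I. Proof. by refine [ffun=> Ordinal (_ : 0 < 2 * n)%N]; rewrite muln_gt0. Qed.
Let S0 b : 0 < S b.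
Proof. by rewrite /S (bigD1 i0)//= ltr_pwDl ?expR_gt0// sumr_ge0// => j _; exact: expR_ge0. Qed.

Let cube_bounds b h : (forall i, ((expR (- h))%:E <= cell_avg i b <= (expR h)%:E)%E) ->
  v * expR (- h) * S b <= fine (cube_int (fun x => (expR (b * Y x))%:E)) <= v * expR h * S b.
Proof.
move=> Hb.
have fin i : cell_avg i b = (fine (cell_avg i b))%:E.
  rewrite fineK// fin_real//; have /andP[h1 h2] := Hb i.
  by rewrite (lt_le_trans _ h1) ?ltNyr// (le_lt_trans h2) ?ltry.
rewrite cube_int_expR_cells.
rewrite (eq_bigr (fun i => (v * expR (b * y i) * fine (cell_avg i b))%:E)); last first.
  by move=> i _; rewrite fin EFinM.
rewrite sumEFin/= /S !mulr_sumr; apply/andP; split; apply: ler_sum => i _.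
  rewrite mulrAC ler_wpM2l ?mulr_ge0 ?expR_ge0 ?(ltW v0)//.
  by have /andP[+ _] := Hb i; rewrite fin lee_fin.
rewrite [leRHS]mulrAC ler_wpM2l ?mulr_ge0 ?expR_ge0 ?(ltW v0)//.
by have /andP[_] := Hb i; rewrite fin lee_fin.
Qed.

Let V_E : V = S (q * beta) * expR (- (q * ln (S beta))).
Proof.
rewrite /V /S mulr_suml; apply: eq_bigr => i _.
by rewrite -expRD; congr expR; rewrite mulrBr mulrA.
Qed.

Let ratio_bounds h : 0 < h -> cell_error = h%:E ->
  expR (- (ln h / (k + 1))) * V <= v `^ (q - 1) * W <= expR (ln h / (k + 1)) * V.
Proof.
move=> h0 hE; have k0' := k0; have q1' := q1; pose p := 2 * (k + 1).
have p1 : 1 <= p by rewrite /p; lra.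
have p0 : 0 < p by lra.
have q0 : 0 < q by lra.
have le_h i : (cell_avg i L <= h%:E /\ cell_avg i (- L) <= h%:E)%E.
  have : (cell_avg i L + cell_avg i (- L) <= h%:E)%E.
    rewrite -hE /cell_error (bigD1 i)//= leeDl//.
    by apply: sume_ge0 => j _; rewrite adde_ge0 ?cell_avg_ge0.
  move=> H; split; apply: le_trans H; first by rewrite leeDl ?cell_avg_ge0.
  by rewrite leeDr ?cell_avg_ge0.
pose s := ln h / p.
have b1 i : ((expR (- s))%:E <= cell_avg i (q * beta) <= (expR s)%:E)%E.
  have [h1 h2] := le_h i; have LE : p * (q * beta) = L by rewrite /L /p; ring.
  by apply/andP; split; [apply: cell_avg_lower|apply: cell_avg_upper]; rewrite ?LE.
have b2 i : ((expR (- (s / q)))%:E <= cell_avg i beta <= (expR (s / q))%:E)%E.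
  have [h1 h2] := le_h i; have LE : (p * q) * beta = L by rewrite /L /p; ring.
  have -> : s / q = ln h / (p * q) by rewrite /s -mulrA -invfM.
  have pq1 : 1 <= p * q by rewrite mulr_ege1// ltW.
  have pq0 : 0 < p * q by rewrite mulr_gt0.
  apply/andP; split.
    by apply: (@cell_avg_lower i beta (p * q)) => //; rewrite LE.
  by apply: (@cell_avg_upper i beta (p * q)) => //; rewrite LE.
have /andP[z1 z2] := cube_bounds b1; have /andP[z3 z4] := cube_bounds b2.
rewrite /W; move: (fine _) (fine _) z1 z2 z3 z4 => Z2 Z1.
rewrite -/n => z1 z2 z3 z4.
have Z20 : 0 < Z2 by apply: lt_le_trans z3; rewrite !mulr_gt0 ?expR_gt0.
have z3' : ln v - s / q + ln (S beta) <= ln Z2.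
  rewrite -[s / q]expRK -lnV ?posrE ?expR_gt0// -expRN -!lnM ?posrE ?mulr_gt0 ?expR_gt0//.
  by rewrite ler_ln ?posrE// !mulr_gt0 ?expR_gt0.
have z4' : ln Z2 <= ln v + s / q + ln (S beta).
  rewrite -[s / q]expRK -!lnM ?posrE ?mulr_gt0 ?expR_gt0//.
  by rewrite ler_ln ?posrE// !mulr_gt0 ?expR_gt0.
have qs : q * (s / q) = s by rewrite mulrC divfK// gt_eqF.
have z3'' := ler_wpM2l (ltW q0) z3'; have z4'' := ler_wpM2l (ltW q0) z4'.
have ss : ln h / (k + 1) = s + s by rewrite /s /p; field; rewrite gt_eqF//; lra.
rewrite V_E /powR !gt_eqF// -expRN ss.
have vE : v = expR (ln v) by rewrite lnK.
have low : expR (- (s + s)) * (S (q * beta) * expR (- (q * ln (S beta)))) =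
    expR ((q - 1) * ln v) * (v * expR (- s) * S (q * beta) * expR (- (q * (ln v + s / q + ln (S beta))))).
  rewrite [in RHS]vE.
  rewrite [RHS](_ : _ = S (q * beta) * (expR ((q - 1) * ln v) * expR (ln v) * expR (- s) *
    expR (- (q * (ln v + s / q + ln (S beta)))))); last by rewrite expRK; ring.
  by rewrite mulrCA -!expRD !mulrDr qs; congr (_ * expR _); ring.
have up : expR (s + s) * (S (q * beta) * expR (- (q * ln (S beta)))) =
    expR ((q - 1) * ln v) * (v * expR s * S (q * beta) * expR (- (q * (ln v - s / q + ln (S beta))))).
  rewrite [in RHS]vE.
  rewrite [RHS](_ : _ = S (q * beta) * (expR ((q - 1) * ln v) * expR (ln v) * expR s *
    expR (- (q * (ln v - s / q + ln (S beta)))))); last by rewrite expRK; ring.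
  by rewrite mulrCA -!expRD !mulrDr mulrN qs; congr (_ * expR _); ring.
have Z10 : 0 <= Z1 by apply: le_trans z1; rewrite !mulr_ge0 ?expR_ge0// ltW.
rewrite low up; apply/andP; split; rewrite ler_wpM2l ?expR_ge0//; apply: ler_pM => //.
- by rewrite !mulr_ge0 ?expR_ge0// ltW.
- by rewrite ler_expR lerN2.
- by rewrite ler_expR lerN2.
Qed.

Lemma cell_error_gt0 : (0 < cell_error)%E.
Proof.
have h i : (0 < cell_avg i L + cell_avg i (- L))%E.
  rewrite lt_neqAle adde_ge0 ?cell_avg_ge0// andbT eq_sym padde_eq0 ?cell_avg_ge0//.
  apply/negP => /andP[/eqP L1 /eqP L2].
  have := @cell_avg_lower i (- L) 1 1 ltr01 ltr01.
  rewrite mul1r opprK L1 L2 => /(_ _); rewrite lee_fin ler01 => /(_ isT).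
  by rewrite lee_fin leNgt expR_gt0.
rewrite /cell_error (bigD1 i0)//=; apply: lt_le_trans (h i0) _.
by rewrite leeDl// sume_ge0// => j _; rewrite adde_ge0 ?cell_avg_ge0.
Qed.

Let V_ge0 : 0 <= V. Proof. by apply: sumr_ge0 => i _; exact: expR_ge0. Qed.

Let V_le1 : V <= 1.
Proof.
have := @gibbs_moment_le1 _ unit R {ffun 'I_d -> 'I_(2 * n)} (fun i _ => y i) q beta tt (ltW q1).
exact.
Qed.

(** Where h^(1/(k + 1)) exceeds exp s it is at most exp(- k s) h, and V <= 1. A large k damps the
    expectation of h, while the main term loses only exp s. *)
Let threshold h s : 0 < h -> expR (ln h / (k + 1)) * V <= expR s * V + expR (- (k * s)) * h.
Proof.
move=> h0; have k10 : 0 < k + 1 by rewrite ltr_wpDl.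
have [hs|hs] := leP (ln h / (k + 1)) s.
  rewrite -[leLHS]addr0 lerD ?mulr_ge0 ?expR_ge0 ?(ltW h0)//.
  by rewrite ler_wpM2r ?V_ge0// ler_expR.
rewrite -[leLHS]add0r lerD ?mulr_ge0 ?expR_ge0 ?V_ge0//.
apply: (@le_trans _ _ (expR (ln h / (k + 1)))); first by rewrite ler_piMr ?expR_ge0 ?V_le1.
rewrite -[X in _ <= _ * X]lnK ?posrE// -expRD ler_expR.
have e : ln h = (k + 1) * (ln h / (k + 1)) by rewrite mulrC divfK// gt_eqF.
have := ler_wpM2l k0 (ltW hs); move: e; set z := _ / _; lra.
Qed.

Lemma cube_ratio_upper s : 0 <= s ->
  ((v `^ (q - 1) * W)%:E <= (expR s * V)%:E + (expR (- (k * s)))%:E * cell_error)%E.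
Proof.
(* If the error is infinite so is the right-hand side, whatever value [fine] gives to the
   integrals. *)
move=> s0; have := cell_error_gt0; case hE : cell_error => [h| |]// h0; last first.
  by rewrite gt0_muley ?lte_fin ?expR_gt0// addey// leey.
rewrite -EFinM -EFinD lee_fin; rewrite lte_fin in h0.
have /andP[_ h2] := ratio_bounds h0 hE; apply: le_trans h2 _; exact: threshold.
Qed.

Lemma cube_ratio_lower s : 0 <= s ->
  (V%:E <= (expR s * (v `^ (q - 1) * W))%:E + (expR (- (k * s)))%:E * cell_error)%E.
Proof.
move=> s0; have := cell_error_gt0; case hE : cell_error => [h| |]// h0; last first.
  by rewrite gt0_muley ?lte_fin ?expR_gt0// addey// leey.
rewrite -EFinM -EFinD lee_fin; rewrite lte_fin in h0.
have k10 : 0 < k + 1 by rewrite ltr_wpDl.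
have /andP[h1 h2] := ratio_bounds h0 hE.
have W0 : 0 <= v `^ (q - 1) * W.
  by apply: le_trans h1; rewrite mulr_ge0 ?expR_ge0 ?V_ge0.
have [hs|hs] := leP (ln h / (k + 1)) s.
  rewrite -[leLHS]addr0 lerD ?mulr_ge0 ?expR_ge0 ?(ltW h0)//.
  apply: (@le_trans _ _ (expR s * (expR (- (ln h / (k + 1))) * V))); last by rewrite ler_wpM2l ?expR_ge0.
  rewrite mulrA -expRD ler_peMl ?V_ge0// -[leLHS]expR0 ler_expR; lra.
rewrite -[leLHS]add0r; apply: lerD; first by apply: mulr_ge0 => //; exact: expR_ge0.
apply: (le_trans V_le1).
rewrite -[X in _ <= _ * X]lnK ?posrE// -expRD -[leLHS]expR0 ler_expR.
have e : ln h = (k + 1) * (ln h / (k + 1)) by rewrite mulrC divfK// gt_eqF.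
have := ler_wpM2l k0 (ltW hs); have := le_trans s0 (ltW hs); move: e; set z := _ / _; lra.
Qed.

End transfer.

(** * The comparison in expectation *)

Section expected_transfer.
Context dO (Om : measurableType dO) (R : realType) (P : probability Om R).
Variables (d : nat) (D : set (d.-tuple R)) (X : Om -> d.-tuple R -> R)
  (K : d.-tuple R -> d.-tuple R -> R) (t C1 : R).
Hypothesis mX : measurable_fun [set: Om * d.-tuple R] (fun p => X p.1 p.2).
Hypothesis GX : centred_gaussian_field P D X.
Hypothesis XK : forall x y, D x -> D y -> ('E_P[(fun w => X w x * X w y)%R])%E = (K x y)%:E.
Hypothesis DD : sym_cube d 2 `<=` D.
Hypothesis KB : forall x y, D x -> D y -> `|K x y + ln (dist1 x y + expR (- t))| <= C1.

Let I : finType := {ffun 'I_d -> 'I_(2 * mesh t)}.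
Let pt (i : I) : d.-tuple R := grid_point i.

Let D_cube x : sym_cube d 1 x -> D x.
Proof. by move=> x1; apply: DD => l; have /andP[? ?] := x1 l; apply/andP; split; lra. Qed.

Let D_pt i : D (pt i).
Proof. by apply: D_cube => l; exact: grid_point_bound. Qed.

Lemma measurable_field_at x : measurable_fun setT (fun w => X w x).
Proof.
have m : measurable_fun setT (fun w : Om => (w, x)) by exact: measurable_fun_pair.
exact: measurableT_comp mX m.
Qed.

Lemma measurable_field_of w : measurable_fun setT (X w).
Proof.
have m : measurable_fun setT (fun x : d.-tuple R => (w, x)) by exact: measurable_fun_pair.
exact: measurableT_comp mX m.
Qed.

Let c0 : R := 2 * ln (d%:R + 1) + 4 * C1.

(** A point of the cell is within d eps of its grid point, so the covariances entering the variance
    of the increment agree up to constants: this variance is at most [c0], bounded though not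
    small. *)
Lemma increment_mgf i x b : sym_cube d 1 x -> cell_ind i x != 0 ->
  (\int[P]_w (expR (b * (X w x - X w (pt i))))%:E <= (expR (b ^+ 2 * c0 / 2))%:E)%E.
Proof.
move=> x1 cx; pose p (j : bool) := if j then x else pt i.
have Dp j : D (p j) by case: j => /=; [exact: D_cube|exact: D_pt].
have [_ GF] := gaussian_field_family GX XK Dp.
have := gaussian_rv_mgf (GF (fun j : bool => if j then 1 else -1)) b.
rewrite !big_bool/=.
under eq_integral do rewrite !big_bool/= mul1r mulN1r.
move=> ->; rewrite lee_fin ler_expR ler_wpM2r// ler_wpM2l ?sqr_ge0//.
have e0 := expR_gt0 (- t).
have Kl a c : D a -> D c -> K a c <= - ln (dist1 a c + expR (- t)) + C1.
  by move=> Da Dc; have /ler_normlP[_] := KB Da Dc; lra.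
have Kr a c : D a -> D c -> - ln (dist1 a c + expR (- t)) - C1 <= K a c.
  by move=> Da Dc; have /ler_normlP[] := KB Da Dc; lra.
have xx (a : d.-tuple R) : dist1 a a = 0 by rewrite /dist1 big1// => j _; rewrite subrr normr0.
have xy : dist1 x (pt i) = dist1 (pt i) x by apply: eq_bigr => j _; rewrite distrC.
have := Kl _ _ (D_cube x1) (D_cube x1); have := Kl _ _ (D_pt i) (D_pt i).
have := Kr _ _ (D_cube x1) (D_pt i); have := Kr _ _ (D_pt i) (D_cube x1).
rewrite !xx xy !add0r expRK.
have : ln (dist1 (pt i) x + expR (- t)) <= ln (d%:R + 1) - t.
  rewrite -[X in _ <= _ + X]expRK -lnM ?posrE ?ltr_wpDl// ler_ln ?posrE ?mulr_gt0 ?ltr_wpDl ?dist1_ge0//.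
  by rewrite mulrDl mul1r lerD2r; exact: cell_ind_dist.
rewrite /c0; lra.
Qed.

Let f i b (p : Om * d.-tuple R) : \bar R := (cell_ind i p.2 * expR (b * (X p.1 p.2 - X p.1 (pt i))))%:E.

Let mf i b : measurable_fun setT (f i b).
Proof.
apply/measurable_EFinP; apply: measurable_funM.
  by apply: (measurableT_comp (measurable_cell_ind i)).
apply: measurableT_comp => //; apply: measurable_funM => //; apply: measurable_funB => //.
exact: measurableT_comp (measurable_field_at _) _.
Qed.

Let f0 i b p : (0 <= f i b p)%E.
Proof. by rewrite lee_fin mulr_ge0 ?cell_ind_ge0 ?expR_ge0. Qed.

Lemma measurable_cell_avg i b : measurable_fun setT (fun w => @cell_avg R d t (X w) i b).
Proof.
by apply: emeasurable_funM => //; apply: (@measurable_cube_int _ _ _ _ (f i b)).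
Qed.

Lemma expected_cell_avg i b :
  (\int[P]_w @cell_avg R d t (X w) i b <= (expR (b ^+ 2 * c0 / 2))%:E)%E.
Proof.
have v0 := @cell_vol_gt0 R d t.
rewrite /cell_avg ge0_integralZl//; last 3 first.
- exact: (@measurable_cube_int _ _ _ _ (f i b)).
- by move=> w _; apply: cube_int_ge0 => x; exact: (f0 i b (w, x)).
- by rewrite lee_fin invr_ge0 ltW.
rewrite (cube_int_tonelli P (f := f i b))//.
have mc : measurable_fun setT (fun x : d.-tuple R => (@cell_ind R d t i x)%:E).
  by apply/measurable_EFinP; exact: measurable_cell_ind.
have c1 x : (0 <= (@cell_ind R d t i x)%:E)%E by rewrite lee_fin cell_ind_ge0.
apply: (@le_trans _ _ ((cell_vol d t)^-1%:E * cube_int (fun x => (expR (b ^+ 2 * c0 / 2))%:E * (@cell_ind R d t i x)%:E))%E).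
  rewrite lee_wpmul2l ?lee_fin ?invr_ge0 ?(ltW v0)//.
  apply: le_cube_int.
  - by apply: (@measurable_fun_fubini_tonelli_G _ _ _ _ _ P (f i b)).
  - exact: emeasurable_funM.
  - by move=> x; apply: integral_ge0 => w _; exact: f0.
  - by move=> x; rewrite mule_ge0 ?lee_fin ?expR_ge0// cell_ind_ge0.
  move=> x x1; rewrite /f/=.
  rewrite ge0_integral_mulr ?cell_ind_ge0//; last first.
    apply: measurableT_comp => //; apply: measurable_funM => //.
    by apply: measurable_funB; exact: measurable_field_at.
  rewrite muleC; have [->|cx] := eqVneq (cell_ind i x) 0; first by rewrite (_ : 0%:E = 0%E)// !mule0.
  by rewrite lee_wpmul2r ?lee_fin ?cell_ind_ge0// increment_mgf.
by rewrite cube_intZl ?expR_ge0// cube_int_cell_ind -!EFinM lee_fin mulrCA mulVf ?gt_eqF// mulr1.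
Qed.

Variables (q beta k : R).
Hypotheses (q1 : 1 < q) (k0 : 0 <= k).

Let L := q * (2 * (k + 1)) * beta.
Let M : R := #|I|%:R * (2 * expR (L ^+ 2 * c0 / 2)).

Let mH i : measurable_fun setT (fun w => @cell_avg R d t (X w) i L + @cell_avg R d t (X w) i (- L))%E.
Proof. by apply: emeasurable_funD; exact: measurable_cell_avg. Qed.

Let mCE : measurable_fun setT (fun w => cell_error t (X w) q beta k).
Proof. by apply: emeasurable_sum => i; exact: mH. Qed.

Let CE0 w : (0 <= cell_error t (X w) q beta k)%E.
Proof. by apply: sume_ge0 => i _; rewrite adde_ge0// cell_avg_ge0. Qed.

Lemma expected_cell_error : (\int[P]_w cell_error t (X w) q beta k <= M%:E)%E.
Proof.
rewrite /cell_error ge0_integral_sum//; last first.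
  by move=> i w _; rewrite adde_ge0// cell_avg_ge0.
apply: (@le_trans _ _ (\sum_(i : I) (2 * expR (L ^+ 2 * c0 / 2))%:E)%E); last first.
  by rewrite sumEFin lee_fin sumr_const -[leLHS]mulr_natl.
apply: lee_sum => i _; rewrite ge0_integralD//; first last.
- exact: measurable_cell_avg.
- by move=> w _; exact: cell_avg_ge0.
- exact: measurable_cell_avg.
- by move=> w _; exact: cell_avg_ge0.
rewrite -/L [2 * _]mulr_natl mulr2n EFinD; apply: leeD; first exact: expected_cell_avg.
by rewrite -[L ^+ 2]sqrrN; exact: expected_cell_avg.
Qed.

Let W w : R := Zpart X (q * beta) w / Zpart X beta w `^ q.
Let F (i : I) w := X w (pt i).
Let v : R := cell_vol d t.

Lemma Zpart_ge0 b w : 0 <= Zpart X b w.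
Proof. by apply: fine_ge0; apply: cube_int_ge0 => x; rewrite lee_fin expR_ge0. Qed.

Lemma measurable_Zpart b : measurable_fun setT (Zpart X b).
Proof.
apply: (measurableT_comp (@fine_measurable R setT measurableT)).
apply: (@measurable_cube_int _ _ _ _ (fun p => (expR (b * X p.1 p.2))%:E)).
  by apply/measurable_EFinP; apply: measurableT_comp => //; exact: measurable_funM.
by move=> p; rewrite lee_fin expR_ge0.
Qed.

Lemma Zratio_ge0 w : 0 <= W w.
Proof. by rewrite mulr_ge0 ?Zpart_ge0// invr_ge0 powR_ge0. Qed.

Lemma measurable_Zratio : measurable_fun setT W.
Proof.
rewrite (_ : W = fun w => Zpart X (q * beta) w * Zpart X beta w `^ (- q)); last first.
  by apply/funext => w; rewrite powRN.
apply: measurable_funM; first exact: measurable_Zpart.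
exact: measurableT_comp (measurable_powR _) (measurable_Zpart _).
Qed.

Let mG : measurable_fun setT (gibbs_moment F q beta).
Proof. by apply: measurable_gibbs_moment => i; exact: measurable_field_at. Qed.

Lemma Zratio_le_gibbs s : 0 <= s ->
  ((v `^ (q - 1))%:E * \int[P]_w (W w)%:E <=
    (expR s)%:E * \int[P]_w (gibbs_moment F q beta w)%:E + (expR (- (k * s)) * M)%:E)%E.
Proof.
move=> s0.
have v1 : 0 <= v `^ (q - 1) by exact: powR_ge0.
have G0 w : 0 <= gibbs_moment F q beta w by exact: gibbs_moment_ge0.
rewrite -!ge0_integral_mulr ?expR_ge0//; last 2 first.
- exact: measurable_Zratio.
- exact: Zratio_ge0.
apply: (@le_trans _ _ (\int[P]_w ((expR s * gibbs_moment F q beta w)%:E + (expR (- (k * s)))%:E * cell_error t (X w) q beta k))%E).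
  apply: ge0_le_integral => //.
  - by move=> w _; rewrite lee_fin mulr_ge0// Zratio_ge0.
  - by apply/measurable_EFinP; apply: measurable_funM => //; exact: measurable_Zratio.
  - apply: emeasurable_funD; last exact: emeasurable_funM.
    by apply/measurable_EFinP; exact: measurable_funM.
  by move=> w _; apply: cube_ratio_upper => //; exact: measurable_field_of.
rewrite ge0_integralD//; last 4 first.
- by move=> w _; rewrite lee_fin mulr_ge0 ?expR_ge0.
- by apply/measurable_EFinP; exact: measurable_funM.
- by move=> w _; rewrite mule_ge0// lee_fin expR_ge0.
- exact: emeasurable_funM.
rewrite leeD2l// ge0_integralZl// ?lee_fin ?expR_ge0// EFinM.
by rewrite lee_wpmul2l ?lee_fin ?expR_ge0// expected_cell_error.
Qed.

Lemma gibbs_le_Zratio s : 0 <= s ->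
  (\int[P]_w (gibbs_moment F q beta w)%:E <=
    (expR s * v `^ (q - 1))%:E * \int[P]_w (W w)%:E + (expR (- (k * s)) * M)%:E)%E.
Proof.
move=> s0.
have v1 : 0 <= expR s * v `^ (q - 1) by rewrite mulr_ge0 ?expR_ge0 ?powR_ge0.
have G0 w : 0 <= gibbs_moment F q beta w by exact: gibbs_moment_ge0.
have mW := measurable_Zratio; have W0 := Zratio_ge0.
rewrite -!ge0_integral_mulr//.
apply: (@le_trans _ _ (\int[P]_w ((expR s * v `^ (q - 1) * W w)%:E + (expR (- (k * s)))%:E * cell_error t (X w) q beta k))%E).
  apply: ge0_le_integral => //.
  - by move=> w _; rewrite lee_fin.
  - exact/measurable_EFinP.
  - apply: emeasurable_funD; last exact: emeasurable_funM.
    by apply/measurable_EFinP; exact: measurable_funM.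
  move=> w _; rewrite -mulrA; apply: cube_ratio_lower => //; exact: measurable_field_of.
rewrite ge0_integralD//; last 4 first.
- by move=> w _; rewrite lee_fin mulr_ge0.
- by apply/measurable_EFinP; exact: measurable_funM.
- by move=> w _; rewrite mule_ge0// lee_fin expR_ge0.
- exact: emeasurable_funM.
rewrite leeD2l// ge0_integralZl// ?lee_fin ?expR_ge0// EFinM.
by rewrite lee_wpmul2l ?lee_fin ?expR_ge0// expected_cell_error.
Qed.

End expected_transfer.

(** * Asymptotics *)

Section asymptotics.
Context dO (Om : measurableType dO) (R : realType) (P : probability Om R).
Variables (d : nat) (D : set (d.-tuple R)).
Hypothesis d0 : (0 < d)%N.
Hypothesis DD : sym_cube d 2 `<=` D.

(** The field at eps = exp(- t), its kernel being known through C1 alone, so that the thresholds on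
    t obtained below are uniform over all such fields. *)
Definition log_field (X : Om -> d.-tuple R -> R) (t C1 : R) : Prop :=
  measurable_fun [set: Om * d.-tuple R] (fun p => X p.1 p.2) /\ centred_gaussian_field P D X /\
  exists K : d.-tuple R -> d.-tuple R -> R,
    (forall x y, D x -> D y -> ('E_P[(fun w => X w x * X w y)%R])%E = (K x y)%:E) /\
    (forall x y, D x -> D y -> `|K x y + ln (dist1 x y + expR (- t))| <= C1).

Definition Zratio (X : Om -> d.-tuple R -> R) (q beta : R) (w : Om) : R := Zpart X (q * beta) w / Zpart X beta w `^ q.

(** One third of dl t for each of the term in t / N, the term in t / L, and the constants. *)
Lemma error_budget (dl C1 : R) (M : nat) : 0 < dl ->
  exists (N L : nat) (T : R), [/\ (0 < N)%N, (0 < L)%N & forall t, 0 < t -> T <= t ->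
    d%:R * (ln (6 * (2 * d%:R + 1)) + t / N%:R) + C1 + ln (2 * L%:R) + t / L%:R +
      ln (4 * M%:R) + ln N.+1%:R <= dl * t].
Proof.
move=> dl0.
pose N := (Num.truncn (3 * d%:R / dl)).+1; pose L := (Num.truncn (3 / dl)).+1.
pose A := d%:R * ln (6 * (2 * d%:R + 1)) + C1 + ln (2 * L%:R) + ln (4 * M%:R) + ln N.+1%:R.
exists N, L, (3 * A / dl); split => // t t0; rewrite ler_pdivrMr// => At.
have hN : d%:R * (t / N%:R) <= dl * t / 3.
  rewrite mulrA ler_pdivrMr ?ltr0n//.
  have := truncnS_gt (3 * d%:R / dl); rewrite -/N ltr_pdivrMr// => h.
  have := ler_wpM2r (ltW t0) (ltW h); lra.
have hL : t / L%:R <= dl * t / 3.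
  rewrite ler_pdivrMr ?ltr0n//.
  have := truncnS_gt (3 / dl); rewrite -/L ltr_pdivrMr// => h.
  have := ler_wpM2r (ltW t0) (ltW h); lra.
move: At hN hL; rewrite /A mulrDr; move: (ln _) (ln _) (ln _) (ln _) (t / _) (t / _); clear; intros; lra.
Qed.

Let cell_vol_bounds (q t : R) : 1 <= q -> 0 <= t ->
  expR (- (d%:R * (q - 1) * (t + ln 2))) <= cell_vol d t `^ (q - 1) <= expR (- (d%:R * (q - 1) * t)).
Proof.
move=> q1 t0; have v0 := @cell_vol_gt0 R d t.
have m0 : 0 < (mesh t)%:R :> R by rewrite ltr0n.
have q10 : 0 <= d%:R * (q - 1) by rewrite mulr_ge0// subr_ge0.
have lnv : ln (cell_vol d t) = - (d%:R * ln (mesh t)%:R).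
  by rewrite /cell_vol lnXn ?invr_gt0// lnV ?posrE// mulNrn mulr_natl.
rewrite /powR gt_eqF// lnv !ler_expR.
have l1 : t <= ln (mesh t)%:R.
  by rewrite -[leLHS]expRK ler_ln ?posrE ?expR_gt0//; apply/ltW/truncnS_gt.
have l2 : ln (mesh t)%:R <= t + ln 2.
  rewrite -[t in leRHS]expRK -lnM ?posrE ?expR_gt0// ler_ln ?posrE ?mulr_gt0 ?expR_gt0//.
  rewrite /mesh -natr1; have := ler_truncn (expR_ge0 t).
  have : 1 <= expR t by rewrite -expR0 ler_expR.
  lra.
by have := ler_wpM2l q10 l1; have := ler_wpM2l q10 l2; move=> ? ?; apply/andP; split; lra.
Qed.

Let card_grid (t : R) : 0 <= t -> #|{ffun 'I_d -> 'I_(2 * mesh t)}|%:R <= expR (d%:R * (t + ln 4)).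
Proof.
move=> t0; rewrite card_ffun !card_ord natrX expRM_natl lerXn2r ?nnegrE ?expR_ge0//.
rewrite expRD lnK ?posrE// natrM /mesh -natr1; have := ler_truncn (expR_ge0 t).
have : 1 <= expR t by rewrite -expR0 ler_expR.
lra.
Qed.

(** The part of the exponent of the expected cell error that does not depend on t. *)
Let er (q beta C1 k : R) : R :=
  ln 2 + (q * (2 * (k + 1)) * beta) ^+ 2 * (2 * ln (d%:R + 1) + 4 * C1) / 2 + d%:R * ln 4.

Section estimates.
Variables (q beta : R).
Hypotheses (q1 : 1 < q).
Variables (X : Om -> d.-tuple R -> R) (t C1 : R).
Hypotheses (t0 : 0 <= t) (XF : log_field X t C1).
Let F (i : {ffun 'I_d -> 'I_(2 * mesh t)}) w := X w (grid_point i).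

Let M_le k : #|{ffun 'I_d -> 'I_(2 * mesh t)}|%:R * (2 * expR ((q * (2 * (k + 1)) * beta) ^+ 2 * (2 * ln (d%:R + 1) + 4 * C1) / 2)) <=
  expR (d%:R * t + er q beta C1 k).
Proof.
apply: (@le_trans _ _ (expR (d%:R * (t + ln 4)) * (2 * expR ((q * (2 * (k + 1)) * beta) ^+ 2 * (2 * ln (d%:R + 1) + 4 * C1) / 2)))).
  by rewrite ler_wpM2r ?mulr_ge0 ?expR_ge0// card_grid.
set b := (q * _ * _) ^+ 2 * _ / _.
have -> : 2 * expR b = expR (ln 2 + b) by rewrite expRD lnK ?posrE.
by rewrite -expRD ler_expR /er -/b; lra.
Qed.

Lemma Zratio_upper k s : 0 <= k -> 0 <= s ->
  ((cell_vol d t `^ (q - 1))%:E * \int[P]_w (Zratio X q beta w)%:E <=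
    (expR s)%:E * \int[P]_w (gibbs_moment F q beta w)%:E + (expR (- (k * s) + d%:R * t + er q beta C1 k))%:E)%E.
Proof.
move=> k0 s0; have [mX [GX [K [XK KB]]]] := XF.
apply: le_trans (Zratio_le_gibbs mX GX XK DD KB beta q1 k0 s0) _.
rewrite leeD2l// lee_fin -addrA [leRHS]expRD.
by apply: ler_wpM2l; [exact: expR_ge0|exact: M_le].
Qed.

Lemma Zratio_lower k s : 0 <= k -> 0 <= s ->
  (\int[P]_w (gibbs_moment F q beta w)%:E <=
   (expR s * cell_vol d t `^ (q - 1))%:E * \int[P]_w (Zratio X q beta w)%:E +
    (expR (- (k * s) + d%:R * t + er q beta C1 k))%:E)%E.
Proof.
move=> k0 s0; have [mX [GX [K [XK KB]]]] := XF.
apply: le_trans (gibbs_le_Zratio mX GX XK DD KB beta q1 k0 s0) _.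
rewrite leeD2l// lee_fin -addrA [leRHS]expRD.
by apply: ler_wpM2l; [exact: expR_ge0|exact: M_le].
Qed.

Let mF i : measurable_fun setT (F i).
Proof. by have [mX _] := XF; exact: measurable_field_at. Qed.

Let mgibbs : measurable_fun setT (fun w => (gibbs_moment F q beta w)%:E).
Proof. by apply/measurable_EFinP; exact: measurable_gibbs_moment. Qed.

Let EW0 : (0 <= \int[P]_w (Zratio X q beta w)%:E)%E.
Proof. by apply: integral_ge0 => w _; rewrite lee_fin Zratio_ge0. Qed.

(** The case k = s = 0 of [Zratio_upper], the Gibbs moment being at most 1. *)
Lemma Zratio_lty : (\int[P]_w (Zratio X q beta w)%:E < +oo)%E.
Proof.
have v0 : 0 < cell_vol d t `^ (q - 1) by rewrite powR_gt0// cell_vol_gt0.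
have := Zratio_upper (lexx 0) (lexx 0).
have : (\int[P]_w (gibbs_moment F q beta w)%:E <= 1%:E)%E.
  apply: (@le_trans _ _ (\int[P]_w 1%:E)%E).
    apply: ge0_le_integral => //.
    - by move=> w _; rewrite lee_fin gibbs_moment_ge0.
    - by move=> w _; rewrite lee_fin gibbs_moment_le1// ltW.
  by rewrite integral_cst//= probability_setT mule1.
case: (\int[P]_w (gibbs_moment F q beta w)%:E)%E => [r| |]// _; last first.
  by rewrite expR0 mul1e addNye leeNy_eq; case: (\int[P]_w _)%E EW0 => [z| |]// _; rewrite gt0_muley.
rewrite -EFinM -EFinD.
by case: (\int[P]_w _)%E EW0 => [z| |]// _; rewrite ?ltry// gt0_muley ?lte_fin// leye_eq.
Qed.

(** If the expectation vanished, [Zratio_lower] with k = 1 and s -> +oo would make the Gibbs moment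
    vanish almost surely, although it is positive everywhere. *)
Lemma Zratio_integral_gt0 : (0 < \int[P]_w (Zratio X q beta w)%:E)%E.
Proof.
rewrite lt_neqAle EW0 andbT eq_sym; apply/eqP => E0.
have le_s s : 0 <= s -> (\int[P]_w (gibbs_moment F q beta w)%:E <= (expR (- s + d%:R * t + er q beta C1 1))%:E)%E.
  by move=> s0; have := Zratio_lower ler01 s0; rewrite E0 mule0 add0e mul1r.
have G0 : (\int[P]_w (gibbs_moment F q beta w)%:E = 0)%E.
  apply/eqP; rewrite eq_le; apply/andP; split; last first.
    by apply: integral_ge0 => w _; rewrite lee_fin gibbs_moment_ge0.
  apply/lee_addgt0Pr => e e0; rewrite add0e.
  pose c := d%:R * t + er q beta C1 1.
  pose s := Num.max 0 (c - ln e).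
  apply: le_trans (le_s s _) _; first by rewrite le_max lexx.
  have : c - ln e <= s by rewrite le_max lexx orbT.
  by move=> cs; rewrite lee_fin -[leRHS]lnK ?posrE// ler_expR -addrA -/c; lra.
have [G1 _] := @ae_eq_integral_abs _ _ _ P setT measurableT _ mgibbs.
have : (\int[P]_w `|(gibbs_moment F q beta w)%:E| = 0)%E.
  by rewrite -[RHS]G0; apply: eq_integral => w _; rewrite gee0_abs// lee_fin gibbs_moment_ge0.
move=> /G1 [A [mA PA0 sub]].
have AT : A = setT.
  apply/seteqP; split=> // w _; apply: sub => /= /(_ I)/eqP; rewrite eqe gt_eqF//.
  pose i0 : {ffun 'I_d -> 'I_(2 * mesh t)} := [ffun=> Ordinal (isT : 0 < 2 * mesh t)%N].
  rewrite /gibbs_moment (bigD1 i0)//= ltr_pwDl ?expR_gt0// sumr_ge0// => j _; exact: expR_ge0.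
have := @probability_setT _ _ _ P; rewrite -AT PA0 => /esym/eqP.
by rewrite onee_eq0.
Qed.

End estimates.

Lemma Zratio_exponent (q beta C1 e : R) : 1 < q -> 0 <= beta -> 0 <= C1 -> 0 < e ->
  exists T, forall t (X : Om -> d.-tuple R -> R), T <= t -> log_field X t C1 ->
    ((expR (- (t * (eta_tilde d q beta + e))))%:E <= \int[P]_w (Zratio X q beta w)%:E)%E /\
    (\int[P]_w (Zratio X q beta w)%:E <= (expR (- (t * (eta_tilde d q beta - e))))%:E)%E.
Proof.
move=> q1 be0 C10 e0; pose e1 := e / 5; have e10 : 0 < e1 by rewrite divr_gt0.
have [dl [T0 [M [/andP[dl0 dl1] M0 HG]]]] := @gibbs_moment_exponent _ _ R P d q beta e1 d0 q1 be0 e10.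
have [N [L [T1 [N0 L0 HE]]]] := @error_budget dl C1 M dl0.
set eta := eta_tilde d q beta in HG *.
pose kap := eta + d%:R * (q - 1).
(* With s = t e1 one gets k s = t (d + |kap| + 3 e1), which brings the error term, of size exp(d t)
   before damping, below exp(- t (kap + 2 e1)). *)
pose k := (d%:R + `|kap| + 3 * e1) / e1.
have k0 : 0 <= k by rewrite divr_ge0 ?addr_ge0 ?mulr_ge0// ltW.
pose erk := er q beta C1 k.
(* Beyond [bnd], t e1 absorbs the constants erk and d (q - 1) ln 2, and exp(t e1) >= 2. *)
pose bnd : R := (1 + `|erk| + d%:R * (q - 1) * ln 2) / e1.
have ln20 : 0 <= ln (2 : R) by rewrite ln_ge0// ler1n.
have q10 : 0 <= d%:R * (q - 1) * ln 2 by rewrite !mulr_ge0// subr_ge0 ltW.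
have bnd0 : 0 < bnd by rewrite divr_gt0// ltr_pwDl ?addr_ge0// ltr_pwDl.
exists (Num.max T0 (Num.max T1 bnd)) => t X; rewrite !ge_max => /andP[T0t /andP[T1t bt]] XF.
have t0 : 0 < t by exact: lt_le_trans bt.
have LC : log_correlated P (fun (i : {ffun 'I_d -> 'I_(2 * mesh t)}) w => X w (grid_point i)) M d%:R t dl.
  have [mX [GX [K [XK KB]]]] := XF.
  apply: (grid_log_correlated (Ordinal d0) GX XK DD KB t0 N0 L0 M0 C10 _ (HE _ t0 T1t)).
  by rewrite ltW.
have [] := HG _ _ _ T0t t0 LC; rewrite -/kap.
have s0 : 0 <= t * e1 by rewrite mulr_ge0 ?ltW.
have := Zratio_upper beta q1 (ltW t0) XF k0 s0.
have := Zratio_lower beta q1 (ltW t0) XF k0 s0.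
have := Zratio_lty beta q1 (ltW t0) XF; have := Zratio_integral_gt0 beta q1 (ltW t0) XF.
case: (\int[P]_w (Zratio X q beta w)%:E)%E => [z| |]//; rewrite lte_fin => z0 _.
set G := (\int[P]_w _)%E.
have v0 : 0 < cell_vol d t `^ (q - 1) by rewrite powR_gt0// cell_vol_gt0.
have /andP[v1 v2] := cell_vol_bounds (ltW q1) (ltW t0).
rewrite -/erk; case: G => [G| |]; last 2 first.
- by move=> _ _ _; rewrite leye_eq.
- by move=> _ _; rewrite leeNy_eq.
rewrite -!EFinM -!EFinD !lee_fin.
move: (cell_vol d t `^ (q - 1)) v0 v1 v2 => v v0 v1 v2.
have bt' : 1 + `|erk| + d%:R * (q - 1) * ln 2 <= t * e1 by rewrite -ler_pdivrMr.
have er_le := ler_norm erk; have nk := ler_norm kap; have er0 := normr_ge0 erk.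
have kE : k * (t * e1) = t * (d%:R + `|kap| + 3 * e1) by rewrite /k mulrCA divfK ?gt_eqF.
have tk : t * kap <= t * `|kap| by rewrite ler_wpM2l// ltW.
have small : expR (- (k * (t * e1)) + d%:R * t + erk) <= expR (- (t * (kap + 2 * e1))).
  by rewrite ler_expR kE; lra.
have two : 2 <= expR (t * e1).
  by apply: le_trans (expR_ge1Dx _); lra.
move=> lo up Glo Gup; split.
  have h1 : expR (- (t * (kap + e1))) <= expR (t * e1) * v * z + expR (- (t * (kap + 2 * e1))) by lra.
  have h2 : expR (- (t * (kap + e1))) = expR (t * e1) * expR (- (t * (kap + 2 * e1))).
    by rewrite -expRD; congr expR; ring.
  have h3 := ler_wpM2r (expR_ge0 (- (t * (kap + 2 * e1)))) two.
  have h4 : expR (- (t * (kap + 2 * e1))) <= expR (t * e1) * v * z by lra.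
  have h5 : expR (t * e1) * v * z <= expR (t * e1) * expR (- (d%:R * (q - 1) * t)) * z.
    by rewrite ler_wpM2r ?(ltW z0)// ler_wpM2l ?expR_ge0.
  have := le_trans h4 h5; rewrite -expRD -ler_pdivrMl ?expR_gt0// -expRN -expRD; apply: le_trans.
  rewrite ler_expR /kap.
  have : t * e = t * e1 * 5 by rewrite /e1; field.
  lra.
have h1 : v * z <= expR (- (t * (kap - 3 * e1))).
  have g1 : expR (t * e1) * G <= expR (- (t * (kap - 2 * e1))).
    apply: le_trans (ler_wpM2l (expR_ge0 _) Gup) _; rewrite -expRD ler_expR; lra.
  have g2 : expR (- (t * (kap + 2 * e1))) <= expR (- (t * (kap - 2 * e1))).
    rewrite ler_expR; lra.
  have -> : expR (- (t * (kap - 3 * e1))) = expR (t * e1) * expR (- (t * (kap - 2 * e1))).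
    by rewrite -expRD; congr expR; ring.
  have := ler_wpM2r (expR_ge0 (- (t * (kap - 2 * e1)))) two; lra.
have h2 : expR (- (d%:R * (q - 1) * (t + ln 2))) * z <= v * z by rewrite ler_wpM2r ?(ltW z0).
have := le_trans h2 h1; rewrite -ler_pdivlMl ?expR_gt0// -expRN -expRD => /le_trans; apply.
rewrite ler_expR /kap.
have : t * e = t * e1 * 5 by rewrite /e1; field.
lra.
Qed.

End asymptotics.

(** * Reduction to nonnegative beta *)

Section sign_of_beta.
Context dO (Om : measurableType dO) (R : realType) (P : probability Om R).
Variables (d : nat) (D : set (d.-tuple R)).

Lemma log_field_opp (X : Om -> d.-tuple R -> R) t C1 :
  log_field P D X t C1 -> log_field P D (fun w x => - X w x) t C1.
Proof.
move=> [mX [GX [K [XK KB]]]]; split; first exact: measurableT_comp.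
split; last first.
  exists K; split=> // x y Dx Dy; rewrite -XK//; congr expectation; apply/funext => w.
  by rewrite mulrNN.
move=> n pts a Dp; have [v Hv] := GX n pts (fun i => - a i) Dp; exists v.
by rewrite (_ : (fun w => _) = fun w => \sum_(i < n) - a i * X w (pts i))//; apply/funext => w; apply: eq_bigr => i _; rewrite mulrN mulNr.
Qed.

Lemma Zpart_opp (X : Om -> d.-tuple R -> R) b w : Zpart (fun w x => - X w x) (- b) w = Zpart X b w.
Proof. by congr fine; apply: eq_cube_int => x _; rewrite mulrNN. Qed.

Lemma Zratio_opp (X : Om -> d.-tuple R -> R) q b w :
  Zratio (fun w x => - X w x) q (- b) w = Zratio X q b w.
Proof. by rewrite /Zratio mulrN !Zpart_opp. Qed.

End sign_of_beta.

Theorem theorem1p1 (R : realType) (d : nat) (d0 : measure_display)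
  (Omega : measurableType d0) (P : probability Omega R)
  (D : set (d.-tuple R))
  (X : R -> Omega -> d.-tuple R -> R)
  (g : R -> d.-tuple R -> d.-tuple R -> R) (Cg beta q : R) :
  (0 < d)%N ->
  domain D -> sym_cube d 2 `<=` D ->
  0 < Cg ->
  (forall eps, 0 < eps <= 1 ->
     measurable_fun [set: Omega * d.-tuple R] (fun p => X eps p.1 p.2) /\
     centred_gaussian_field P D (X eps) /\
     continuous_on2 D (g eps) /\
     (forall x y, D x -> D y -> `|g eps x y| <= Cg) /\
     (forall x y, D x -> D y ->
        ('E_P[(fun w => X eps w x * X eps w y)%R])%E
        = (- ln (eucl_dist x y + eps) + g eps x y)%:E)) ->
  1 < q ->
  let E eps := ('E_P[(fun w => Zpart (X eps) (q * beta) w / Zpart (X eps) beta w `^ q)%R])%E in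
  (forall eps, 0 < eps <= 1 -> (0 < E eps /\ E eps < +oo)%E) /\
  (fun eps => ln (fine (E eps)) / ln eps) x @[x --> 0^'+] --> eta_tilde d q beta.
Proof.
move=> dim0 _ DD Cg0 HX q1 E.
have C10 : 0 <= ln d%:R + Cg by rewrite addr_ge0 ?ln_ge0 ?ler1n// ltW.
have XF eps : 0 < eps <= 1 -> log_field P D (X eps) (- ln eps) (ln d%:R + Cg).
  move=> e01; have /andP[e0 e1] := e01; have [mX [GX [_ [gC XK]]]] := HX eps e01.
  split=> //; split=> //; exists (fun x y => - ln (eucl_dist x y + eps) + g eps x y).
  by split=> // x y Dx Dy; rewrite opprK lnK// log_kernel_dist1// gC.
have t0 (eps : R) : 0 < eps <= 1 -> 0 <= - ln eps.
  by move=> /andP[e0 e1]; rewrite oppr_ge0 ln_le0.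
have EE eps : E eps = (\int[P]_w (Zratio (X eps) q beta w)%:E)%E.
  by rewrite /E unlock.
have fin eps : 0 < eps <= 1 -> (0 < E eps /\ E eps < +oo)%E.
  move=> e01; rewrite EE; split.
    exact: (Zratio_integral_gt0 DD beta q1 (t0 _ e01) (XF _ e01)).
  exact: (Zratio_lty DD beta q1 (t0 _ e01) (XF _ e01)).
split=> //; apply/cvgrPdist_le => e e0.
have [T HT] : exists T, forall t Y, T <= t -> log_field P D Y t (ln d%:R + Cg) ->
    ((expR (- (t * (eta_tilde d q beta + e))))%:E <=
       \int[P]_w (Zratio Y q beta w)%:E)%E /\
    (\int[P]_w (Zratio Y q beta w)%:E <=
      (expR (- (t * (eta_tilde d q beta - e))))%:E)%E.
  have [b0|b0] := leP 0 beta; first exact: (Zratio_exponent P dim0 DD q1 b0 C10 e0).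
  (* [eta_tilde] depends on beta through its square, and - X is a field of the same kind. *)
  have nb0 : 0 <= - beta by rewrite oppr_ge0 ltW.
  have [T HT] := Zratio_exponent P dim0 DD q1 nb0 C10 e0.
  exists T => t Y Tt YF.
  have EY : (\int[P]_w (Zratio (fun w x => - Y w x) q (- beta) w)%:E = \int[P]_w (Zratio Y q beta w)%:E)%E.
    by apply: eq_integral => w _; rewrite Zratio_opp.
  have Eeta : eta_tilde d q (- beta) = eta_tilde d q beta by rewrite /eta_tilde !sqrrN.
  have [h1 h2] := HT t _ Tt (log_field_opp YF).
  rewrite Eeta in h1 h2.
  rewrite -EY.
  split.
    exact: h1.
  exact: h2.
near=> eps.
have e01 : 0 < eps <= 1.
  by apply/andP; split; near: eps; [exact: nbhs_right_gt|exact: nbhs_right_le].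
have /andP[eps0 eps1] := e01.
(* T may be negative: |T| + 1 makes - ln eps both at least T and positive, so that dividing by ln
   eps reverses the inequalities. *)
have small : eps < expR (- (`|T| + 1)) by near: eps; apply: nbhs_right_lt; exact: expR_gt0.
have lne : ln eps < - (`|T| + 1) by rewrite -[ltRHS]expRK ltr_ln ?posrE// expR_gt0.
have Tt : T <= - ln eps by have := ler_norm T; lra.
have [h1 h2] := HT _ _ Tt (XF _ e01).
have [E0 Eoo] := fin _ e01; move: h1 h2 E0 Eoo; rewrite -EE.
case: (E eps) => [z| |]//; rewrite !lee_fin lte_fin/= => h1 h2 z0 _.
have le1 : - (- ln eps * (eta_tilde d q beta + e)) <= ln z.
  by rewrite -[leLHS]expRK ler_ln ?posrE// expR_gt0.
have le2 : ln z <= - (- ln eps * (eta_tilde d q beta - e)).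
  by rewrite -[leRHS]expRK ler_ln ?posrE// expR_gt0.
have l0 : ln eps < 0 by have := normr_ge0 T; lra.
rewrite ler_distlC; apply/andP; split.
  by rewrite ler_ndivlMr//; lra.
by rewrite ler_ndivrMr//; lra.
Unshelve. all: by end_near.
Qed.
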